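(* Let $K$ be a number field and $d\ge1$. For each nonzero prime ideal $\mathfrak p$ of the ring of integers of $K$ let $\alpha_{\mathfrak p,1},\dots,\alpha_{\mathfrak p,d}\in\mathbf C$ with $|\alpha_{\mathfrak p,j}|\le 1$, and let \[ L(s) = \prod_{\mathfrak p}\frac{1}{(1-\alpha_{\mathfrak p,1}\mathrm N\mathfrak p^{-s})\cdots(1-\alpha_{\mathfrak p,d}\mathrm N\mathfrak p^{-s})}, \qquad \mathrm{Re}(s)>1. \] Suppose $L(s)$ admits an analytic continuation to $\mathrm{Re}(s)\ge 1$ which is nonvanishing on $\mathrm{Re}(s)=1$. Then for every $s$ with $\mathrm{Re}(s)=1$, \[ L(s) = \lim_{x\to\infty}\prod_{\mathrm N\mathfrak p\le x}\frac{1}{(1-\alpha_{\mathfrak p,1}\mathrm N\mathfrak p^{-s})\cdots(1-\alpha_{\mathfrak p,d}\mathrm N\mathfrak p^{-s})}. \]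
   Context: $\mathrm N\mathfrak p$ denotes the absolute norm of the prime ideal $\mathfrak p$. The Euler product converges absolutely and is nonvanishing for $\mathrm{Re}(s)>1$. *)

(* Defs.v *)
From HB Require Import structures.
From mathcomp Require Import all_boot all_order all_algebra all_field.
From mathcomp Require Import finmap.
From mathcomp Require Import all_classical all_reals all_analysis.
From mathcomp Require Import complex.
From mathcomp Require summability.

Set Implicit Arguments.
Unset Strict Implicit.
Unset Printing Implicit Defensive.

Import Order.TTheory GRing.Theory Num.Theory.
Import numFieldNormedType.Exports.

Local Open Scope classical_set_scope.
Local Open Scope ring_scope.
Local Open Scope complex_scope.

(* A number field is a [K : fieldExtType rat]: a finite-dimensional field
   extension of the rationals. *)

Definition algebraic_integer (K : fieldExtType rat) : {pred K} :=
  fun x => `[< integralOver (intr : int -> K) x >].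

Fact algebraic_integer_subring (K : fieldExtType rat) :
  subring_closed (@algebraic_integer K).
Proof.
split.
- exact/asboolP/integral1.
- by move=> x y /asboolP ix /asboolP iy; exact/asboolP/integral_sub.
- by move=> x y /asboolP ix /asboolP iy; exact/asboolP/integral_mul.
Qed.

HB.instance Definition _ (K : fieldExtType rat) :=
  GRing.isSubringClosed.Build K (@algebraic_integer K)
    (algebraic_integer_subring K).

Record ring_of_integers (K : fieldExtType rat) := RingOfIntegers {
  integer_val :> K;
  _ : integer_val \in @algebraic_integer K }.

HB.instance Definition _ (K : fieldExtType rat) :=
  [isSub of ring_of_integers K for @integer_val K].
HB.instance Definition _ (K : fieldExtType rat) :=
  [Choice of ring_of_integers K by <:].
HB.instance Definition _ (K : fieldExtType rat) :=
  [SubChoice_isSubComNzRing of ring_of_integers K by <:].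

(* [idealr_closed] includes properness: 1 is not in the ideal. *)
Record nonzero_prime (K : fieldExtType rat) := NonzeroPrime {
  prime_set :> ring_of_integers K -> bool;
  prime_set_ideal : idealr_closed prime_set;
  prime_set_prime : prime_idealr_closed prime_set;
  prime_set_nonzero : exists x, x \in prime_set /\ x != 0 }.

HB.instance Definition _ (K : fieldExtType rat) (p : nonzero_prime K) :=
  isIdealr.Build (ring_of_integers K) (prime_set p) (@prime_set_ideal K p).
HB.instance Definition _ (K : fieldExtType rat) (p : nonzero_prime K) :=
  isPrimeIdealrClosed.Build (ring_of_integers K) (prime_set p)
    (@prime_set_prime K p).

HB.instance Definition _ (K : fieldExtType rat) :=
  gen_eqMixin (nonzero_prime K).
HB.instance Definition _ (K : fieldExtType rat) :=
  gen_choiceMixin (nonzero_prime K).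

(* The residue rings are finite, so the junk value 0 that [fset_set] gives for
   an infinite set does not occur. *)
Definition abs_norm (K : fieldExtType rat) (p : nonzero_prime K) : nat :=
  #|` fset_set [set: {ideal_quot (prime_set p : idealr (ring_of_integers K))}] |.

Definition cexp (R : realType) (z : R[i]) : R[i] :=
  (expR (complex.Re z) * cos (complex.Im z))
  +i* (expR (complex.Re z) * sin (complex.Im z)).

(* n^z for an integer n >= 1 *)
Definition natcpow (R : realType) (n : nat) (z : R[i]) : R[i] :=
  cexp (z * (ln n%:R)%:C).

Definition euler_factor (R : realType) (K : fieldExtType rat) (d : nat)
    (alpha : nonzero_prime K -> 'I_d -> R[i]) (s : R[i]) (p : nonzero_prime K) :
    R[i] :=
  (\prod_(j < d) (1 - alpha p j * natcpow (abs_norm p) (- s)))^-1.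

(* The limit is along the finite sets of primes, directed by inclusion: the
   order-free meaning of an absolutely convergent product. [R[i]^o] is R[i]
   with the topology given by its own norm. *)
Definition euler_product (R : realType) (K : fieldExtType rat) (d : nat)
    (alpha : nonzero_prime K -> 'I_d -> R[i]) (s : R[i]) : R[i]^o :=
  lim ((fun A : {fset nonzero_prime K} =>
          (\prod_(p <- A) euler_factor alpha s p : R[i]^o))
       @ summability.totally).

(* There are finitely many primes of norm at most x, so the value 1 that a
   product over [i \in A] takes when infinitely many factors differ from 1 does
   not occur. *)
Definition partial_euler_product (R : realType) (K : fieldExtType rat)
    (d : nat) (alpha : nonzero_prime K -> 'I_d -> R[i]) (s : R[i]) (x : R) :
    R[i]^o :=
  \big[*%R/1]_(p \in [set p : nonzero_prime K | (abs_norm p)%:R <= x])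
    euler_factor alpha s p.

(* Analytic on a set, not necessarily open: complex differentiable at every
   point of some open set containing it. *)
Definition analytic_on (R : realType) (A : set R[i]) (f : R[i] -> R[i]) : Prop :=
  exists2 U : set R[i]^o, open U /\ A `<=` U &
    forall z, U z -> derivable (f : R[i]^o -> R[i]^o) z 1.

(* Main.v *)
Require Import Defs.
From mathcomp Require Import all_boot all_order all_algebra all_field.
From mathcomp Require Import finmap.
From mathcomp Require Import all_classical all_reals all_analysis.
From mathcomp Require Import complex.
From mathcomp Require Import zify ring lra.
From mathcomp Require summability.

Set Implicit Arguments.
Unset Strict Implicit.
Unset Printing Implicit Defensive.

Import Order.TTheory GRing.Theory Num.Theory.
Import numFieldNormedType.Exports.

Local Open Scope classical_set_scope.
Local Open Scope ring_scope.
Local Open Scope complex_scope.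

(** The logarithm of L splits as D = F + H on Re s > 1: F is the Dirichlet series
    with coefficient the sum of the alpha_{p,j} over the primes p of norm k, and
    H collects the terms of order at least 2, so that H is Lipschitz on
    Re s >= 1.  At most [K : Q] primes have a given norm, hence the
    coefficients of F are bounded.  Lifting the path of L, which is continuous
    and nonzero on Re s >= 1, shows that D, hence F, is uniformly continuous on
    bounded parts of the strip 1 < Re s <= 2; differentiability of L at s0 makes
    D Lipschitz at s0.

    These two facts suffice for a Fourier-analytic Tauberian theorem.  Put
    x_k = lam ln k, e = 1/T and integrate (F(s0 + lam z) - A) / z, z = e + it,
    against (1 + cos t) exp(zT) over -pi <= t <= pi.  The integral is small by
    the Riemann-Lebesgue lemma, uniformly in e; computed termwise it is a
    nonzero multiple of the partial sum of F(s0) - A up to x_k <= T, with an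
    error O(1 / lam) because the coefficients are O(1 / k).  So no contour
    integral is needed: the Dirichlet series F converges at s0, and with it the
    Euler product. *)

(** * Calculus on the real line *)

Section RealDerivatives.
Variable R : realType.
Implicit Types (f g : R -> R) (x a b : R).

(** Termwise, the integral replaces the sharp cutoff x_k <= T by the weight [kernel] at x_k - T,
    which is nearly a constant P >= 1/2 far to the left of 0 and nearly 0 far to the right. Since 1
    + cos t vanishes to second order at t = pi and t = -pi, its Fourier transform is O(u^-3), so
    [kernel] deviates from a step by O(u^-2) only; against points x_k of density 1/lam such
    deviations add up to O(1/lam) uniformly in T. This dictates the order of choices: lam from the
    tolerance, then T, then the truncation of the series, whose error is multiplied by T. In the
    oscillating integral the delicate point is t = 0, where 1/z blows up as e tends to 0: the
    Lipschitz bound at s0 keeps the quotient bounded there, and away from 0 uniform continuity gives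
    a modulus independent of e. On the arithmetic side, primes of a given norm are counted without
    factorization of ideals: everything rests on integer relations with some coefficient prime to
    p. *)

Lemma is_derive_ext f g x (df dg : R) :
  is_derive x (1 : R) f df -> f =1 g -> df = dg -> is_derive x (1 : R) g dg.
Proof. by move=> h /funext <- <-. Qed.

Lemma der_cst x c : is_derive x (1 : R) (fun _ => c : R) (0 : R).
Proof. exact: is_derive_cst. Qed.

Lemma der_id x : is_derive x (1 : R) (fun t : R => t) (1 : R).
Proof. exact: is_derive_id. Qed.

Lemma derD f g x (df dg : R) : is_derive x (1 : R) f df ->
  is_derive x (1 : R) g dg ->
  is_derive x (1 : R) (fun t => f t + g t) (df + dg).
Proof. by move=> hf hg; apply: (is_derive_ext (is_deriveD hf hg)). Qed.

Lemma derB f g x (df dg : R) : is_derive x (1 : R) f df ->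
  is_derive x (1 : R) g dg ->
  is_derive x (1 : R) (fun t => f t - g t) (df - dg).
Proof. by move=> hf hg; apply: (is_derive_ext (is_deriveB hf hg)). Qed.

Lemma derN f x (df : R) : is_derive x (1 : R) f df ->
  is_derive x (1 : R) (fun t => - f t) (- df).
Proof. by move=> hf; apply: (is_derive_ext (is_deriveN hf)). Qed.

Lemma derM f g x (df dg : R) : is_derive x (1 : R) f df ->
  is_derive x (1 : R) g dg ->
  is_derive x (1 : R) (fun t => f t * g t) (df * g x + f x * dg).
Proof.
move=> hf hg; apply: (is_derive_ext (is_deriveM hf hg)) => //.
by rewrite addrC /GRing.scale /= mulrC.
Qed.

Lemma der_comp f g x (df dg : R) : is_derive (g x) (1 : R) f df ->
  is_derive x (1 : R) g dg ->
  is_derive x (1 : R) (fun t => f (g t)) (df * dg).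
Proof. by move=> hf hg; apply: (is_derive_ext (is_derive1_comp hf hg)). Qed.

Lemma derV f x (df : R) : f x != 0 -> is_derive x (1 : R) f df ->
  is_derive x (1 : R) (fun t => (f t)^-1) (- (f x) ^- 2 * df).
Proof.
by move=> h hf; apply: (is_derive_ext (is_deriveV h hf)).
Qed.

Lemma der_exp f x (df : R) : is_derive x (1 : R) f df ->
  is_derive x (1 : R) (fun t => expR (f t)) (expR (f x) * df).
Proof. by move=> hf; apply: der_comp => //; exact: is_derive_expR. Qed.

Lemma der_sin f x (df : R) : is_derive x (1 : R) f df ->
  is_derive x (1 : R) (fun t => sin (f t)) (cos (f x) * df).
Proof. by move=> hf; apply: der_comp => //; exact: is_derive_sin. Qed.

Lemma der_cos f x (df : R) : is_derive x (1 : R) f df ->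
  is_derive x (1 : R) (fun t => cos (f t)) (- sin (f x) * df).
Proof. by move=> hf; apply: der_comp => //; exact: is_derive_cos. Qed.

Lemma derZ c f x (df : R) : is_derive x (1 : R) f df ->
  is_derive x (1 : R) (fun t => c * f t) (c * df).
Proof. by move=> hf; apply: (is_derive_ext (derM (der_cst x c) hf)); rewrite // mul0r add0r. Qed.

Lemma der_atan x : is_derive x (1 : R) (@atan R) (1 + x ^+ 2)^-1.
Proof. exact: is_derive1_atan. Qed.

Lemma der_continuous f x (df : R) : is_derive x (1 : R) f df -> {for x, continuous f}.
Proof. by move=> [h _]; apply/differentiable_continuous/derivable1_diffP. Qed.

(** Both g - f and g + f have nonnegative derivative. The bounds on [kernel] below integrate a bound
    on its derivative in this form, g being an explicit primitive. *)
Lemma le_increment_of_derive f g (f' g' : R -> R) a b : a <= b ->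
  (forall x, a <= x <= b -> is_derive x (1 : R) f (f' x)) ->
  (forall x, a <= x <= b -> is_derive x (1 : R) g (g' x)) ->
  (forall x, a <= x <= b -> `|f' x| <= g' x) ->
  `|f b - f a| <= g b - g a.
Proof.
move=> ab hf hg hfg.
have key (h : R -> R) (h' : R -> R) :
   (forall x, a <= x <= b -> is_derive x (1 : R) h (h' x)) ->
   (forall x, a <= x <= b -> 0 <= h' x) -> h a <= h b.
  move=> dh h0.
  have [||c] := @MVT_segment R h h' a b ab.
  - by move=> x; rewrite in_itv /= => /andP[xa xb]; apply: dh; rewrite !ltW.
  - apply: derivable_within_continuous => x; rewrite in_itv /= => hx.
    by have [] := dh x hx.
  - rewrite in_itv /= => hc e.
    by rewrite -subr_ge0 e mulr_ge0 ?h0 ?subr_ge0.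
have h1 : g a - f a <= g b - f b.
  apply: (key (fun t => g t - f t) (fun t => g' t - f' t)) => x hx.
    by apply: derB; [exact: hg|exact: hf].
  by rewrite subr_ge0 (le_trans (ler_norm _)) ?hfg.
have h2 : g a + f a <= g b + f b.
  apply: (key (fun t => g t + f t) (fun t => g' t + f' t)) => x hx.
    by apply: derD; [exact: hg|exact: hf].
  have := hfg x hx; have := ler_norm (- f' x); rewrite normrN; lra.
rewrite ler_norml; lra.
Qed.

Definition itg a b f := (\int[lebesgue_measure]_(t in `[a, b]) f t)%R.

Lemma cont_integrable a b f : continuous f ->
  lebesgue_measure.-integrable `[a, b] (EFin \o f).
Proof.
move=> cf; apply: continuous_compact_integrable; first exact: segment_compact.
exact: continuous_subspaceT.
Qed.

Lemma itgD a b f g : continuous f -> continuous g ->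
  itg a b (fun t => f t + g t) = itg a b f + itg a b g.
Proof. by move=> cf cg; apply: RintegralD => //; exact: cont_integrable. Qed.

Lemma itgB a b f g : continuous f -> continuous g ->
  itg a b (fun t => f t - g t) = itg a b f - itg a b g.
Proof. by move=> cf cg; apply: RintegralB => //; exact: cont_integrable. Qed.

Lemma itgZ a b c f : continuous f -> itg a b (fun t => c * f t) = c * itg a b f.
Proof. by move=> cf; apply: RintegralZl => //; exact: cont_integrable. Qed.

Lemma itg_ext a b f g : (forall t, a <= t <= b -> f t = g t) -> itg a b f = itg a b g.
Proof.
move=> h; apply: eq_Rintegral => t; rewrite inE /= in_itv /= => ht; exact: h.
Qed.

Lemma itg_le a b f g : continuous f -> continuous g ->
  (forall t, a <= t <= b -> f t <= g t) -> itg a b f <= itg a b g.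
Proof.
move=> cf cg h; apply: le_Rintegral => //; try exact: cont_integrable.
Qed.

Lemma cst_continuous_fun (c : R) : continuous (fun _ : R => c).
Proof. by move=> x; exact: cst_continuous. Qed.

Lemma itg_cst a b c : a <= b -> itg a b (fun _ => c) = c * (b - a).
Proof.
move=> ab; rewrite /itg Rintegral_cst //; congr (c * _).
have := @lebesgue_measure_itv R `[a, b]; rewrite /= lte_fin => ->.
by case: ltP => //= ba; rewrite (_ : a = b) ?subrr //; apply/le_anti/andP.
Qed.

Lemma itg_abs_le a b f M : a <= b -> continuous f ->
  (forall t, a <= t <= b -> `|f t| <= M) -> `|itg a b f| <= M * (b - a).
Proof.
move=> ab cf h; have hc := cst_continuous_fun.
rewrite ler_norml -mulNr -!(itg_cst _ ab); apply/andP; split; apply: itg_le => // t ht;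
have := h t ht; rewrite ler_norml => /andP[]//.
Qed.

Lemma itg_split a c b f : a <= c -> c <= b -> continuous f ->
  itg a b f = itg a c f + itg c b f.
Proof.
move=> ac cb cf.
have := @Rintegral_itvB R f (BLeft a) (BRight b) c (cont_integrable a b cf).
rewrite !bnd_simp => /(_ ac cb); rewrite Rintegral_itv_obnd_cbnd; last first.
  apply: integrableS (cont_integrable c b cf) => //.
  by apply: subset_itv; rewrite bnd_simp.
by rewrite /itg => <-; rewrite addrC subrK.
Qed.

Lemma itg_FTC a b f (F : R -> R) : a <= b -> continuous f ->
  (forall x, is_derive x (1 : R) F (f x)) -> itg a b f = F b - F a.
Proof.
rewrite le_eqVlt => /orP[/eqP<-|ab] cf dF.
  by rewrite subrr /itg set_itv1 Rintegral_set1.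
rewrite /itg /Rintegral (@continuous_FTC2 _ f F) //.
- exact: continuous_subspaceT.
- split => [x _|  |]; first by have [] := dF x.
  + by apply: cvg_at_right_filter; exact: der_continuous (dF a).
  + by apply: cvg_at_left_filter; exact: der_continuous (dF b).
- by move=> x _; rewrite derive1E; have [_ ->] := dF x.
Qed.

(** The majorant is local in u because the one available for [kernel] grows exponentially with
    |u|. *)
Lemma itg_under a b (f f' : R -> R -> R) (M x : R) : a <= b ->
  (forall u, continuous (f u)) ->
  (forall u t, is_derive u (1 : R) (f^~ t) (f' u t)) ->
  (forall u t, a <= t <= b -> `|u - x| < 1 -> `|f' u t| <= M) ->
  is_derive x (1 : R) (fun u => itg a b (f u)) (itg a b (f' x)).
Proof.
move=> ab cf df hM.
have M0 : 0 <= M by apply: le_trans (hM x a _ _); rewrite ?lexx ?ab ?subrr ?normr0.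
have Ix : `]x - 1, x + 1[%classic x by rewrite /= in_itv /=; lra.
have h1 : forall u, `]x - 1, x + 1[%classic u ->
   lebesgue_measure.-integrable `[a, b] (EFin \o f u).
  by move=> u _; exact: cont_integrable.
have h2 : forall u t, `]x - 1, x + 1[%classic u -> `[a, b]%classic t -> derivable (f^~ t) u 1.
  by move=> u t _ _; have [] := df u t.
have d1E u t : partial1of2 f u t = f' u t by rewrite partial1of2E; have [_ ->] := df u t.
have h3 : forall u t, `]x - 1, x + 1[%classic u -> `[a, b]%classic t -> `|partial1of2 f u t| <= M.
  move=> u t /=; rewrite !in_itv /= d1E => ux tb; apply: hM => //.
  by rewrite ltr_norml; lra.
have h4 : forall t : R, 0 <= (fun=> M) t by [].
have h5 := cont_integrable a b (@cst_continuous_fun M).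
have mab : measurable (`[a, b]%classic : set (measurableTypeR R)) by [].
split.
  exact: (@derivable_under_integral R _ _ lebesgue_measure f _ mab x _ _ Ix h1 h2 _ h4 h5 h3).
rewrite -derive1E (@differentiation_under_integral R _ _ lebesgue_measure f _ mab x _ _ Ix h1 h2 _ h4 h5 h3).
by apply: itg_ext => t _; rewrite d1E.
Qed.

End RealDerivatives.

(** * Continuity of explicit real functions *)

Section Continuity.
Variable R : realType.
Implicit Types f g : R -> R.

Lemma cfC (c : R) : continuous (fun _ : R => c).
Proof. exact: cst_continuous_fun. Qed.

Lemma cfI : continuous (fun t : R => t).
Proof. by move=> x; exact: cvg_id. Qed.

Lemma cfD f g : continuous f -> continuous g -> continuous (fun t => f t + g t).
Proof. by move=> cf cg x; exact: cvgD (cf x) (cg x). Qed.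

Lemma cfN f : continuous f -> continuous (fun t => - f t).
Proof. by move=> cf x; exact: cvgN (cf x). Qed.

Lemma cfM f g : continuous f -> continuous g -> continuous (fun t => f t * g t).
Proof. by move=> cf cg x; exact: cvgM (cf x) (cg x). Qed.

Lemma cfX f n : continuous f -> continuous (fun t => f t ^+ n).
Proof.
move=> cf; elim: n => [|n IH]; first by under eq_fun do rewrite expr0; exact: cfC.
by under eq_fun do rewrite exprS; apply: cfM.
Qed.

Lemma cfV f : (forall t, f t != 0) -> continuous f -> continuous (fun t => (f t)^-1).
Proof. by move=> h cf x; exact: cvgV (h x) (cf x). Qed.

Lemma cf_exp f : continuous f -> continuous (fun t => expR (f t)).
Proof. by move=> cf x; apply: (continuous_comp (cf x)); exact: continuous_expR. Qed.

Lemma cf_cos f : continuous f -> continuous (fun t => cos (f t)).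
Proof. by move=> cf x; apply: (continuous_comp (cf x)); exact: continuous_cos. Qed.

Lemma cf_sin f : continuous f -> continuous (fun t => sin (f t)).
Proof. by move=> cf x; apply: (continuous_comp (cf x)); exact: continuous_sin. Qed.

End Continuity.

(** Recursion on the syntax of the function. Inverses are left as goals, since [cfV] asks for a
    proof of nonvanishing. *)
Ltac cf := lazymatch goal with
  | |- forall x, @continuous_at _ _ x ?f =>
    lazymatch f with
    | (fun t => t) => exact: cfI
    | (fun _ => ?c) => exact: cfC
    | (fun t => @GRing.add _ (@?a t) (@?b t)) => apply: (@cfD _ a b); cf
    | (fun t => @GRing.opp _ (@?a t)) => apply: (@cfN _ a); cf
    | (fun t => @GRing.exp _ (@?a t) ?n) => apply: (@cfX _ a n); cf
    | (fun t => @GRing.mul _ (@?a t) (@?b t)) => apply: (@cfM _ a b); cf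
    | (fun t => @expR _ (@?a t)) => apply: (@cf_exp _ a); cf
    | (fun t => @cos _ (@?a t)) => apply: (@cf_cos _ a); cf
    | (fun t => @sin _ (@?a t)) => apply: (@cf_sin _ a); cf
    | _ => idtac
    end
  | _ => idtac
  end.

(** * The Tauberian kernel *)

Section Kernel.
Variable R : realType.
Implicit Types (e u t : R).

Let pi_le4 : pi <= 4 :> R.
Proof. by have := pihalf_lt2 R; lra. Qed.

Let pi_0 : 0 <= pi :> R.
Proof. exact: pi_ge0. Qed.

(** Half the Fourier transform of the even weight 1 + cos t on [-pi, pi]. *)
Definition kernel_hat u := itg 0 pi (fun t => (1 + cos t) * cos (t * u)).

Definition kernel_integrand e u t :=
  (1 + cos t) / (e ^+ 2 + t ^+ 2) *
  (expR (- (e * u)) * (e * cos (t * u) - t * sin (t * u))).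

(* The real part of the integral of (1 + cos t) exp(-(e + it) u) / (e + it); its
   derivative in u is - exp(-e u) [kernel_hat u]. *)
Definition kernel e u := itg 0 pi (kernel_integrand e u).

Lemma cos_abs_le1 t : `|cos t| <= 1.
Proof. by rewrite ler_norml cos_geN1 cos_le1. Qed.

Lemma sin_abs_le1 t : `|sin t| <= 1.
Proof. by rewrite ler_norml sin_geN1 sin_le1. Qed.

Lemma one_cos_bounds t : 0 <= 1 + cos t <= 2.
Proof. by have := cos_geN1 t; have := cos_le1 t; lra. Qed.

Let one_cos_abs t : `|1 + cos t| <= 2.
Proof. by have /andP[h1 h2] := one_cos_bounds t; rewrite ger0_norm. Qed.

Lemma sqD_neq0 e t : 0 < e -> e ^+ 2 + t ^+ 2 != 0.
Proof. by move=> e0; rewrite gt_eqF // ltr_pwDl ?sqr_ge0 // exprn_gt0. Qed.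

Lemma kernel_integrand_cont e u : 0 < e -> continuous (kernel_integrand e u).
Proof.
move=> e0; rewrite /kernel_integrand; cf.
apply: cfV => [t|]; first exact: sqD_neq0.
cf.
Qed.

Lemma kernel_hat_le8 u : `|kernel_hat u| <= 8.
Proof.
have h : `|kernel_hat u| <= 2 * (pi - 0).
  apply: itg_abs_le => //; first cf.
  move=> t _; rewrite normrM -[2]mulr1 ler_pM // ?cos_abs_le1 //.
by apply: le_trans h _; rewrite subr0; have := pi_le4; lra.
Qed.

Lemma kernel_hatN u : kernel_hat (- u) = kernel_hat u.
Proof. by apply: itg_ext => t _; rewrite mulrN cosN. Qed.

(** The sines at u, u + 1 and u - 1 agree up to sign at t = pi, and 1/u - (1/(u + 1) + 1/(u - 1))/2
    = -1/(u (u^2 - 1)). This cancellation is the cubic decay; 2 <= u stays away from the removable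
    pole at 1. *)
Lemma kernel_hatE u : 2 <= u -> kernel_hat u = - sin (pi * u) / (u * (u ^+ 2 - 1)).
Proof.
move=> u2.
have u0 : u != 0 by rewrite gt_eqF; lra.
have um : u - 1 != 0 by rewrite gt_eqF; lra.
have up : u + 1 != 0 by rewrite gt_eqF; lra.
pose F t := u^-1 * sin (t * u) +
  2^-1 * ((u + 1)^-1 * sin (t * (u + 1)) + (u - 1)^-1 * sin (t * (u - 1))).
have dF t : is_derive t (1 : R) F ((1 + cos t) * cos (t * u)).
  have dm c : is_derive t (1 : R) (fun s => sin (s * c)) (cos (t * c) * c).
    apply: (is_derive_ext (der_sin (derM (der_id t) (der_cst t c)))) => //.
    by ring.
  apply: (is_derive_ext (derD (derZ u^-1 (dm u)) (derZ 2^-1 (derD (derZ (u + 1)^-1 (dm (u + 1)))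
    (derZ (u - 1)^-1 (dm (u - 1))))))) => //.
  have -> : t * (u + 1) = t * u + t by ring.
  have -> : t * (u - 1) = t * u - t by ring.
  rewrite cosD cosB; field.
  by rewrite u0 um up.
rewrite /kernel_hat (itg_FTC _ _ dF) //; last by cf.
rewrite /F !mul0r sin0 !(mulr0, addr0, subr0).
have -> : pi * (u + 1) = pi * u + pi by ring.
have -> : pi * (u - 1) = pi * u - pi by ring.
rewrite sinD sinB cospi sinpi.
by field; rewrite u0 um up /= gt_eqF //; nra.
Qed.

Lemma kernel_hat_le u : 0 <= u -> `|kernel_hat u| <= 216 / (1 + u) ^+ 3.
Proof.
move=> u0; have p0 : 0 < (1 + u) ^+ 3 by rewrite exprn_gt0 //; lra.
(* For u <= 2 the trivial bound 8 is used together with (1 + u)^3 <= 27, whence 216 = 8 * 27. *)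
have [u2|u2] := leP u 2.
  apply: le_trans (kernel_hat_le8 u) _; rewrite ler_pdivlMr //.
  have h : (1 + u) ^+ 3 <= 3 ^+ 3 by rewrite lerXn2r ?nnegrE; lra.
  by apply: le_trans (_ : 8 * 3 ^+ 3 <= _); lra.
have q0 : 0 < u * (u ^+ 2 - 1) by nra.
rewrite kernel_hatE ?(ltW u2) // normrM normrN normfV (gtr0_norm q0).
apply: le_trans (_ : 1 / (u * (u ^+ 2 - 1)) <= _).
  by rewrite ler_pM2r ?invr_gt0 ?sin_abs_le1.
rewrite ler_pdivlMr // mulrAC ler_pdivrMr // mul1r.
have -> : (1 + u) ^+ 3 = (1 + u) * (1 + u) ^+ 2 by ring.
have -> : 216 * (u * (u ^+ 2 - 1)) = (1 + u) * (216 * (u * (u - 1))) by ring.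
by rewrite ler_pM2l; nra.
Qed.

(** Differentiating in u brings down the factor -(e + it), which cancels the denominator of the
    integrand. *)
Lemma kernel_derive e u : 0 < e ->
  is_derive u (1 : R) (kernel e) (- (expR (- (e * u)) * kernel_hat u)).
Proof.
move=> e0.
pose f' v t := - (expR (- (e * v)) * ((1 + cos t) * cos (t * v))).
have -> : - (expR (- (e * u)) * kernel_hat u) = itg 0 pi (f' u).
  rewrite /f' /kernel_hat -mulNr -itgZ; last by cf.
  by apply: itg_ext => t _; rewrite mulNr.
apply: (@itg_under R 0 pi (kernel_integrand e) f' (expR (e * (1 + `|u|)) * 2)) => //.
- by move=> v; exact: kernel_integrand_cont.
- move=> v t; rewrite /kernel_integrand.
  have dl c : is_derive v (1 : R) (fun s => c * s) c.
    by apply: (is_derive_ext (derZ c (der_id v))) => //; rewrite mulr1.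
  apply: (is_derive_ext (derZ _ (derM (der_exp (derN (dl e)))
    (derB (derZ e (der_cos (dl t))) (derZ t (der_sin (dl t))))))) => //.
  by rewrite /f'; field; exact: sqD_neq0.
- move=> v t _ hv; rewrite /f' normrN normrM ger0_norm ?expR_ge0 //.
  apply: ler_pM; rewrite ?expR_ge0 ?normr_ge0 //.
    rewrite ler_expR -mulrN ler_pM2l //.
    have := ler_norm (- v); rewrite normrN => h1.
    by have := ler_normD (v - u) u; rewrite subrK; lra.
  by rewrite normrM -[2]mulr1 ler_pM // ?cos_abs_le1.
Qed.

Let inv_sq_derive u : 0 <= u ->
  is_derive u (1 : R) (fun v => - (108 * ((1 + v) ^+ 2)^-1)) (216 / (1 + u) ^+ 3).
Proof.
move=> u0; have h : (1 + u) ^+ 2 != 0 by rewrite gt_eqF // exprn_gt0; lra.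
have d1 := derD (der_cst u 1) (der_id u).
apply: (is_derive_ext (derN (derZ 108 (derV (f := fun v => (1 + v) * (1 + v)) _ (derM d1 d1))))) => //.
by rewrite -expr2; field; rewrite gt_eqF; lra.
Qed.

(** [kernel e] tends to 0 at infinity, so it is controlled by its increment from u to a distant V.
    On that range exp(-e v) <= 1, and the cubic bound on the transform integrates to 108 / (1 +
    u)^2, uniformly in e. *)
Lemma kernel_decay e u : 0 < e -> 0 <= u -> `|kernel e u| <= 108 / (1 + u) ^+ 2.
Proof.
move=> e0 u0; apply/ler_addgt0Pr => eta eta0.
(* In [C] the weight is at most 2, the denominator at least e^2, the bracket at most e + pi, the
   interval has length pi, and pi <= 4. Then V makes C exp(-e V) <= eta through exp(e V) >= 1 + e
   V. *)
pose C := 2 / e ^+ 2 * (e + 4) * 4 : R.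
have C0 : 0 < C by rewrite /C; apply: mulr_gt0 => //; apply: mulr_gt0; [apply: divr_gt0 => //; exact: exprn_gt0|lra].
pose V := u + C / (e * eta).
have Vu : u <= V by rewrite /V lerDl divr_ge0 // ltW // mulr_gt0.
have hV : `|kernel e V| <= eta.
  have E0 := expR_gt0 (- (e * V)).
  have h : `|kernel e V| <= 2 / e ^+ 2 * (expR (- (e * V)) * (e + 4)) * (pi - 0).
    apply: itg_abs_le => //; first exact: kernel_integrand_cont.
    move=> t /andP[t0 tpi]; rewrite /kernel_integrand !normrM normfV.
    rewrite (gtr0_norm E0) (@gtr0_norm _ (e ^+ 2 + t ^+ 2)); last first.
      by rewrite ltr_pwDl ?sqr_ge0 // exprn_gt0.
    apply: ler_pM; rewrite ?mulr_ge0 ?invr_ge0 ?addr_ge0 ?sqr_ge0 ?expR_ge0 //.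
      apply: ler_pM; rewrite ?invr_ge0 ?addr_ge0 ?sqr_ge0 //.
      by rewrite lef_pV2 ?posrE ?exprn_gt0 // ?ltr_pwDl ?sqr_ge0 ?exprn_gt0 // lerDl sqr_ge0.
    rewrite ler_pM2l //; apply: le_trans (ler_normB _ _) _; rewrite !normrM.
    apply: lerD.
      by rewrite gtr0_norm // ler_piMr ?cos_abs_le1 // ltW.
    rewrite ger0_norm // -[4]mulr1; apply: ler_pM; rewrite ?sin_abs_le1 //.
    exact: le_trans pi_le4.
  apply: le_trans h _; rewrite subr0.
  apply: le_trans (_ : C * expR (- (e * V)) <= _).
    rewrite /C [X in _ <= X](_ : _ = 2 / e ^+ 2 * (expR (- (e * V)) * (e + 4)) * 4); last by ring.
    rewrite ler_wpM2l // mulr_ge0 //; first by rewrite divr_ge0 ?sqr_ge0.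
    by rewrite mulr_ge0 ?expR_ge0; lra.
  rewrite expRN ler_pdivrMr ?expR_gt0 //.
  apply: le_trans (_ : eta * (1 + e * V) <= _); last by rewrite ler_pM2l ?expR_ge1Dx.
  have -> : eta * (1 + e * V) = eta * (1 + e * u) + C by rewrite /V; field; rewrite !gt_eqF.
  by rewrite lerDr mulr_ge0 ?addr_ge0 ?mulr_ge0 // ltW.
have := @le_increment_of_derive R (kernel e) (fun v => - (108 * ((1 + v) ^+ 2)^-1))
  (fun v => - (expR (- (e * v)) * kernel_hat v)) (fun v => 216 / (1 + v) ^+ 3) u V Vu.
have H1 : forall x : R, u <= x <= V -> is_derive x (1 : R) (kernel e) (- (expR (- (e * x)) * kernel_hat x)).
  by move=> x _; exact: kernel_derive.
have H2 : forall x : R, u <= x <= V -> is_derive x (1 : R) (fun v => - (108 * ((1 + v) ^+ 2)^-1)) (216 / (1 + x) ^+ 3).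
  by move=> x /andP[ux _]; apply: inv_sq_derive; exact: le_trans ux.
have H3 : forall x : R, u <= x <= V -> `|- (expR (- (e * x)) * kernel_hat x)| <= 216 / (1 + x) ^+ 3.
  move=> x /andP[ux _]; have x0 : 0 <= x by exact: le_trans ux.
  rewrite normrN normrM ger0_norm ?expR_ge0 // -[X in _ <= X]mul1r.
  apply: ler_pM; rewrite ?expR_ge0 ?kernel_hat_le //.
  by rewrite expR_le1 oppr_le0 mulr_ge0 // ltW.
move=> /(_ H1 H2 H3) h.
have p : 0 <= 108 * ((1 + V) ^+ 2)^-1 by rewrite mulr_ge0 ?invr_ge0 ?sqr_ge0.
have := ler_normB (kernel e V) (kernel e V - kernel e u); rewrite opprB addrC subrK.
by lra.
Qed.

Let expR_leE x : x <= 1 -> expR x <= expR 1 :> R.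
Proof. by rewrite ler_expR. Qed.

(* For u <= 0 and e = 1/T the factor exp(-e v) stays below exp 1 on [-T, u]. *)
Lemma kernel_near_plateau (T u : R) : 0 < T -> - T <= u <= 0 ->
  `|kernel T^-1 u - kernel T^-1 (- T)| <= expR 1 * 108 / (1 - u) ^+ 2.
Proof.
move=> T0 /andP[Tu u0]; have e0 : 0 < T^-1 by rewrite invr_gt0.
have d2 (x : R) : x <= 0 -> is_derive x (1 : R) (fun v => expR 1 * (108 * ((1 - v) ^+ 2)^-1))
    (expR 1 * (216 / (1 - x) ^+ 3)).
  move=> x0; have x0' : 0 <= - x by lra.
  have h := der_comp (inv_sq_derive x0') (derN (der_id x)).
  by apply: (is_derive_ext (derZ (- expR 1) h)); [move=> v /=; ring|ring].
have := @le_increment_of_derive R (kernel T^-1) (fun v => expR 1 * (108 * ((1 - v) ^+ 2)^-1))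
  (fun v => - (expR (- (T^-1 * v)) * kernel_hat v)) (fun v => expR 1 * (216 / (1 - v) ^+ 3)) (- T) u Tu.
have H1 : forall x : R, - T <= x <= u -> is_derive x (1 : R) (kernel T^-1) (- (expR (- (T^-1 * x)) * kernel_hat x)).
  by move=> x _; exact: kernel_derive.
have H2 : forall x : R, - T <= x <= u -> is_derive x (1 : R) (fun v => expR 1 * (108 * ((1 - v) ^+ 2)^-1))
    (expR 1 * (216 / (1 - x) ^+ 3)).
  by move=> x /andP[_ xu]; apply: d2; exact: le_trans u0.
have H3 : forall x : R, - T <= x <= u -> `|- (expR (- (T^-1 * x)) * kernel_hat x)| <= expR 1 * (216 / (1 - x) ^+ 3).
  move=> x /andP[Tx xu]; have x0 : 0 <= - x by lra.
  rewrite normrN normrM ger0_norm ?expR_ge0 //.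
  apply: ler_pM; rewrite ?expR_ge0 //; last by rewrite -kernel_hatN; exact: kernel_hat_le.
  by apply: expR_leE; rewrite -mulrN mulrC ler_pdivrMr // mul1r; lra.
move=> /(_ H1 H2 H3) h; apply: le_trans h _.
rewrite -mulrA lerBlDr lerDl opprK mulr_ge0 ?expR_ge0 // mulr_ge0 ?invr_ge0 ?sqr_ge0 //.
Qed.

(** At u = 0 the integrand is the nonnegative Poisson-type function e (1 + cos t) / (e^2 + t^2). On
    [0, e] it is at least 1 / (2 e), because t <= e and cos t >= 0; that piece alone gives 1/2. *)
Lemma kernel0_ge e : 0 < e -> e <= 1 -> 1 / 2 <= kernel e 0.
Proof.
move=> e0 e1; have pi2 := pi_ge2 R; have cK := @kernel_integrand_cont e 0 e0.
have KE t : kernel_integrand e 0 t = (1 + cos t) / (e ^+ 2 + t ^+ 2) * e.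
  by rewrite /kernel_integrand !mulr0 oppr0 expR0 cos0 sin0 mul1r mulr1 mulr0 subr0.
have p t : 0 <= kernel_integrand e 0 t.
  rewrite KE; have /andP[h _] := one_cos_bounds t.
  by apply: mulr_ge0; [apply: divr_ge0 => //; rewrite addr_ge0 ?sqr_ge0|exact: ltW].
rewrite /kernel (@itg_split R 0 e pi) //; [|exact: ltW|lra].
have h1 : 0 * (pi - e) <= itg e pi (kernel_integrand e 0).
  by rewrite -itg_cst; [apply: itg_le => //; exact: cfC|lra].
have h2 : (2 * e)^-1 * (e - 0) <= itg 0 e (kernel_integrand e 0).
  rewrite -itg_cst; last exact: ltW.
  apply: itg_le => //; first exact: cfC.
  move=> t /andP[t0 te]; rewrite KE.
  have c0 : 0 <= cos t by apply: cos_ge0_pihalf; have := pihalf_ge1 R; lra.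
  have q : 0 < e ^+ 2 + t ^+ 2 by rewrite ltr_pwDl ?sqr_ge0 // exprn_gt0.
  rewrite mulrAC ler_pdivlMr // mulrC ler_pdivrMr ?mulr_gt0 //.
  apply: le_trans (_ : 2 * e ^+ 2 <= _).
    by rewrite mulrDl mul1r lerD2l ler_pXn2r ?nnegrE // ltW.
  by nra.
have : (2 * e)^-1 * (e - 0) = 1 / 2 by field; rewrite gt_eqF.
by lra.
Qed.

(** The transform is even, so the derivative of K(-u) + K(u) is (exp(e u) - exp(-e u)) times the
    transform, of size e u / (1 + u)^3. Hence K(-T) + K(T) differs from 2 K(0) >= 1 by O(e), while
    K(T) is itself O(e). *)
Lemma kernel_plateau_ge : exists T0 : R, 1 <= T0 /\
  forall T, T0 <= T -> 1 / 2 <= kernel T^-1 (- T).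
Proof.
(* 432 = 2 * 216: the transform gives 216, the difference of exponentials is at most (expR 1 + expR
   1) e x, and x / (1 + x)^3 <= 2 / (1 + x)^2. *)
pose C := 432 * (expR 1 + expR 1) : R.
have E0 : 0 < expR 1 :> R := expR_gt0 _.
exists (1 + 4 * (C + 108)); split; first by rewrite /C; lra.
move=> T hT; have T1 : 1 <= T by apply: le_trans hT; rewrite /C; lra.
have T0 : 0 < T by lra.
set e := T^-1; have e0 : 0 < e by rewrite invr_gt0.
have e1 : e <= 1 by rewrite invf_le1.
have K0 := kernel0_ge e0 e1.
have KT := kernel_decay e0 (ltW T0).
pose f' u := expR (e * u) * kernel_hat u - expR (- (e * u)) * kernel_hat u.
have H1 : forall x : R, 0 <= x <= T -> is_derive x (1 : R) (fun u => kernel e (- u) + kernel e u) (f' x).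
  move=> x _.
  apply: (is_derive_ext (derD (der_comp (kernel_derive (- x) e0) (derN (der_id x))) (kernel_derive x e0))) => //.
  have -> : - (e * - x) = e * x by ring.
  by rewrite /f' kernel_hatN; ring.
have d1 (x : R) : 0 <= x -> is_derive x (1 : R) (fun v => - (C * e * (1 + v)^-1)) (C * e / (1 + x) ^+ 2).
  move=> x0.
  have h := derD (der_cst x 1) (der_id x); have hx : 1 + x != 0 by rewrite gt_eqF; lra.
  apply: (is_derive_ext (derN (derZ (C * e) (derV (f := fun v => 1 + v) hx h)))) => //.
  by field.
have H2 : forall x : R, 0 <= x <= T -> is_derive x (1 : R) (fun v => - (C * e * (1 + v)^-1)) (C * e / (1 + x) ^+ 2).
  by move=> x /andP[x0 _]; exact: d1.
have H3 : forall x : R, 0 <= x <= T -> `|f' x| <= C * e / (1 + x) ^+ 2.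
  move=> x /andP[x0 xT]; rewrite /f' -mulrBl normrM.
  have ex1 : e * x <= 1 by rewrite /e mulrC ler_pdivrMr // mul1r.
  have ex0 : 0 <= e * x by rewrite mulr_ge0 // ltW.
  have hh : `|expR (e * x) - expR (- (e * x))| <= (expR 1 + expR 1) * (e * x).
    have g1 : 1 <= expR (e * x) by rewrite -expR0 ler_expR.
    have g2 : expR (- (e * x)) <= 1 by rewrite -expR0 ler_expR oppr_le0.
    rewrite ger0_norm; last by lra.
    have g3 := expR_ge1Dx (- (e * x)).
    have g4 : expR (e * x) <= expR 1 by rewrite ler_expR.
    have g5 : expR (e * x) - 1 <= expR (e * x) * (e * x).
      have -> : expR (e * x) - 1 = expR (e * x) * (1 - expR (- (e * x))).
        by rewrite mulrBr mulr1 expRN divff // gt_eqF ?expR_gt0.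
      by rewrite ler_pM2l ?expR_gt0 //; lra.
    have g6 : 1 <= expR 1 :> R by rewrite -expR0 ler_expR.
    by nra.
  have p3 : 0 < (1 + x) ^+ 3 by rewrite exprn_gt0 //; lra.
  apply: le_trans (ler_pM (normr_ge0 _) (normr_ge0 _) hh (kernel_hat_le x0)) _.
  rewrite /C [X in X <= _](_ : _ = (216 * (expR 1 + expR 1) * e) * (x / (1 + x) ^+ 3)); last by ring.
  rewrite [X in _ <= X](_ : _ = (216 * (expR 1 + expR 1) * e) * (2 / (1 + x) ^+ 2)); last by ring.
  rewrite ler_wpM2l //; first by apply: mulr_ge0; [clear - pi_le4 pi_0 one_cos_abs E0; lra|exact: ltW].
  rewrite ler_pdivrMr // (_ : 2 / (1 + x) ^+ 2 * (1 + x) ^+ 3 = 2 * (1 + x)); first by lra.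
  by field; rewrite gt_eqF; lra.
have h := le_increment_of_derive (ltW T0) H1 H2 H3.
have q : 0 <= C * e * (1 + T)^-1.
  by apply: mulr_ge0; [apply: mulr_ge0; [rewrite /C; lra|exact: ltW]|rewrite invr_ge0; lra].
have Ce : (C + 108) * e <= 1 / 4.
  by rewrite /e ler_pdivrMr //; move: hT; lra.
have KT' : `|kernel e T| <= 108 * e.
  apply: le_trans KT _; rewrite ler_pM2l // /e lef_pV2 ?posrE ?exprn_gt0 //; try lra; nra.
move: h KT'; rewrite oppr0 !addr0 invr1 mulr1 !ler_norml => /andP[a1 a2] /andP[a3 a4].
by lra.
Qed.

End Kernel.

(** * Complex numbers and the exponential *)

Section ComplexBasics.
Variable R : realType.
Local Notation C := R[i].
Local Notation Re := complex.Re.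
Local Notation Im := complex.Im.
Implicit Types (z w : C) (x y : R).

(** The norm of R[i] takes its values in R[i]; a modulus in R makes real order arithmetic
    available. *)
Definition nrm (z : C) : R := Normc.normc z.

Lemma complexP z w : Re z = Re w -> Im z = Im w -> z = w.
Proof. by case: z; case: w => a b c d /= -> ->. Qed.

Lemma ReD z w : Re (z + w) = Re z + Re w. Proof. by case: z; case: w. Qed.
Lemma ImD z w : Im (z + w) = Im z + Im w. Proof. by case: z; case: w. Qed.
Lemma ReN z : Re (- z) = - Re z. Proof. by case: z. Qed.
Lemma ImN z : Im (- z) = - Im z. Proof. by case: z. Qed.
Lemma ReM z w : Re (z * w) = Re z * Re w - Im z * Im w. Proof. by case: z; case: w. Qed.
Lemma ImM z w : Im (z * w) = Re z * Im w + Im z * Re w. Proof. by case: z; case: w. Qed.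
Lemma Re_sum (I : Type) (r : seq I) (P : pred I) (f : I -> C) :
  Re (\sum_(i <- r | P i) f i) = \sum_(i <- r | P i) Re (f i).
Proof. by elim/big_rec2: _ => [|i y z _ <-]; rewrite ?ReD. Qed.
Lemma Im_sum (I : Type) (r : seq I) (P : pred I) (f : I -> C) :
  Im (\sum_(i <- r | P i) f i) = \sum_(i <- r | P i) Im (f i).
Proof. by elim/big_rec2: _ => [|i y z _ <-]; rewrite ?ImD. Qed.

Lemma nrmE z : nrm z = Num.sqrt (Re z ^+ 2 + Im z ^+ 2).
Proof. by case: z. Qed.
Lemma normE z : `|z| = (nrm z)%:C. Proof. by []. Qed.
Lemma nrm_sqr z : nrm z ^+ 2 = Re z ^+ 2 + Im z ^+ 2.
Proof. by rewrite nrmE sqr_sqrtr // addr_ge0 ?sqr_ge0. Qed.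
Lemma nrm_ge0 z : 0 <= nrm z. Proof. by rewrite nrmE sqrtr_ge0. Qed.
Lemma nrm0 : nrm 0 = 0. Proof. exact: Normc.normc0. Qed.
Lemma nrm1 : nrm 1 = 1. Proof. exact: Normc.normc1. Qed.
Lemma nrmM z w : nrm (z * w) = nrm z * nrm w. Proof. exact: Normc.normcM. Qed.
Lemma nrmV z : nrm z^-1 = (nrm z)^-1. Proof. exact: Normc.normcV. Qed.
Lemma nrmN z : nrm (- z) = nrm z. Proof. exact: normcN. Qed.
Lemma nrmD z w : nrm (z + w) <= nrm z + nrm w. Proof. exact: le_normcD. Qed.
Lemma nrmB z w : nrm (z - w) <= nrm z + nrm w. Proof. by rewrite -(nrmN w) nrmD. Qed.
Lemma nrmC z w : nrm (z - w) = nrm (w - z). Proof. by rewrite -nrmN opprB. Qed.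
Lemma nrm_tri w z v : nrm (z - v) <= nrm (z - w) + nrm (w - v).
Proof. by apply: le_trans (nrmD _ _); rewrite addrA subrK. Qed.
Lemma nrm_eq0 z : (nrm z == 0) = (z == 0).
Proof. by apply/eqP/eqP => [/Normc.eq0_normc//|->]; exact: nrm0. Qed.
Lemma nrm_gt0 z : (0 < nrm z) = (z != 0).
Proof. by rewrite lt_def nrm_ge0 andbT nrm_eq0. Qed.
Lemma nrmR x : nrm (x%:C) = `|x|.
Proof. by rewrite nrmE /= expr0n addr0 sqrtr_sqr. Qed.
Lemma Re_le_nrm z : `|Re z| <= nrm z.
Proof. by rewrite nrmE -sqrtr_sqr ler_wsqrtr // lerDl sqr_ge0. Qed.
Lemma Im_le_nrm z : `|Im z| <= nrm z.
Proof. by rewrite nrmE -sqrtr_sqr ler_wsqrtr // lerDr sqr_ge0. Qed.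
Lemma nrm_le z : nrm z <= `|Re z| + `|Im z|.
Proof.
rewrite -(@ler_pXn2r _ 2) ?nnegrE ?nrm_ge0 ?addr_ge0 ?normr_ge0 //.
rewrite nrm_sqr sqrrD !real_normK ?num_real //.
by rewrite -addrA addrCA lerDr mulrn_wge0 // mulr_ge0.
Qed.
Lemma nrm_dist z w : `|nrm z - nrm w| <= nrm (z - w).
Proof.
rewrite ler_norml; apply/andP; split.
  by have := nrmD (w - z) z; rewrite subrK (nrmC w z); lra.
by have := nrmD (z - w) w; rewrite subrK; lra.
Qed.
Lemma nrm_sum (I : Type) (r : seq I) (P : pred I) (f : I -> C) :
  nrm (\sum_(i <- r | P i) f i) <= \sum_(i <- r | P i) nrm (f i).
Proof.
elim/big_rec2: _ => [|i y z _ h]; first by rewrite nrm0.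
by apply: le_trans (nrmD _ _) _; rewrite lerD2l.
Qed.

Lemma cexpD z w : cexp (z + w) = cexp z * cexp w.
Proof.
apply: complexP; rewrite ?ReM ?ImM /= ?ReD ?ImD expRD ?cosD ?sinD; ring.
Qed.
Lemma cexp0 : cexp 0 = 1 :> C.
Proof. by apply: complexP; rewrite /= expR0 ?cos0 ?sin0 ?mulr1 ?mulr0. Qed.
Lemma cexpNM z : cexp z * cexp (- z) = 1.
Proof. by rewrite -cexpD subrr cexp0. Qed.
Lemma cexp_neq0 z : cexp z != 0.
Proof. by apply/eqP => h; have := cexpNM z; rewrite h mul0r => /esym/eqP; rewrite oner_eq0. Qed.
Lemma cexpN z : cexp (- z) = (cexp z)^-1.
Proof. by apply: (mulfI (cexp_neq0 z)); rewrite cexpNM divff ?cexp_neq0. Qed.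
Lemma cexpB z w : cexp (z - w) = cexp z / cexp w.
Proof. by rewrite cexpD cexpN. Qed.
Lemma nrm_cexp z : nrm (cexp z) = expR (Re z).
Proof.
rewrite nrmE /= !exprMn -mulrDr cos2Dsin2 mulr1 sqrtr_sqr ger0_norm //; exact: expR_ge0.
Qed.
Lemma cexp_sum (I : Type) (r : seq I) (P : pred I) (f : I -> C) :
  cexp (\sum_(i <- r | P i) f i) = \prod_(i <- r | P i) cexp (f i).
Proof. by elim/big_rec2: _ => [|i y z _ <-]; rewrite ?cexpD ?cexp0. Qed.

Lemma expR_sub1_le x : `|expR x - 1| <= `|x| * expR `|x|.
Proof.
have h1 := expR_ge1Dx x; have h2 := expR_ge1Dx (- x); have E := expR_gt0 x.
have h3 : expR x - 1 <= expR x * x.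
  have -> : expR x - 1 = expR x * (1 - expR (- x)).
    by rewrite mulrBr mulr1 expRN divff // gt_eqF.
  by rewrite ler_pM2l //; lra.
have [x0|x0] := leP 0 x.
  rewrite ger0_norm ?(ger0_norm x0); lra.
have e1 : expR x < 1 by rewrite expR_lt1.
have e2 : 1 < expR (- x) by rewrite expR_gt1; lra.
by rewrite ltr0_norm ?(ltr0_norm x0); nra.
Qed.

Lemma expR_sub1Dx_le x : `|expR x - 1 - x| <= x ^+ 2 * expR `|x|.
Proof.
have h1 := expR_ge1Dx x; have h2 := expR_ge1Dx (- x); have E := expR_gt0 x.
have h3 : expR x - 1 <= expR x * x.
  have -> : expR x - 1 = expR x * (1 - expR (- x)).
    by rewrite mulrBr mulr1 expRN divff // gt_eqF.
  by rewrite ler_pM2l //; lra.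
rewrite ger0_norm; last by lra.
apply: le_trans (_ : x * (expR x - 1) <= _); first by lra.
apply: le_trans (ler_norm _) _; rewrite normrM -(real_normK (num_real x)) expr2 -mulrA.
by rewrite ler_wpM2l // expR_sub1_le.
Qed.

Let sin_le_pos y : 0 <= y -> `|sin y| <= y.
Proof.
move=> y0.
have := @le_increment_of_derive R (@sin R) (fun t => t) (@cos R) (fun=> 1) 0 y y0
 (fun t _ => is_derive_sin t) (fun t _ => der_id t) (fun t _ => cos_abs_le1 t).
by rewrite sin0 !subr0.
Qed.

Let sqr_der x : is_derive x (1 : R) (fun t : R => t * t) (2 * x).
Proof. by apply: (is_derive_ext (derM (der_id x) (der_id x))) => //; ring. Qed.

Let cos_le_pos y : 0 <= y -> `|cos y - 1| <= y ^+ 2.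
Proof.
move=> y0.
have := @le_increment_of_derive R (@cos R) (fun t => t * t) (fun t => - sin t) (fun t => 2 * t) 0 y y0
 (fun t _ => is_derive_cos t) (fun t _ => sqr_der t).
rewrite cos0 mulr0 subr0 expr2; apply => t /andP[t0 _].
by rewrite normrN; apply: le_trans (sin_le_pos t0) _; lra.
Qed.

Let cos_le1_pos y : 0 <= y -> `|cos y - 1| <= 2 * y.
Proof.
move=> y0.
have := @le_increment_of_derive R (@cos R) (fun t => 2 * t) (fun t => - sin t) (fun t => 2 * 1) 0 y y0
 (fun t _ => is_derive_cos t) (fun t _ => derZ 2 (der_id t)).
rewrite cos0 mulr0 subr0; apply => t _.
by rewrite normrN; have := sin_abs_le1 t; lra.
Qed.

Let sinB_le_pos y : 0 <= y -> `|sin y - y| <= y ^+ 2.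
Proof.
move=> y0.
have := @le_increment_of_derive R (fun t => sin t - t) (fun t => t * t) (fun t => cos t - 1) (fun t => 2 * t) 0 y y0
 (fun t _ => derB (is_derive_sin t) (der_id t)) (fun t _ => sqr_der t).
rewrite sin0 mulr0 !subr0 expr2; apply => t /andP[t0 _]; exact: cos_le1_pos.
Qed.

Lemma cos_sub1_le y : `|cos y - 1| <= y ^+ 2.
Proof.
have [y0|y0] := leP 0 y; first exact: cos_le_pos.
by rewrite -cosN -sqrrN; apply: cos_le_pos; lra.
Qed.

Lemma sin_subx_le y : `|sin y - y| <= y ^+ 2.
Proof.
have [y0|y0] := leP 0 y; first exact: sinB_le_pos.
have : `|sin (- y) - - y| <= (- y) ^+ 2 by apply: sinB_le_pos; lra.
by rewrite sinN opprK sqrrN addrC distrC.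
Qed.

(** Real and imaginary parts of the remainder split into two terms each, every one at most expR r *
    r^2 with r = |z|. *)
Lemma cexp_taylor2 z : nrm (cexp z - 1 - z) <= 4 * expR (nrm z) * nrm z ^+ 2.
Proof.
set x := Re z; set y := Im z; set r := nrm z.
have xr : `|x| <= r := Re_le_nrm z; have yr : `|y| <= r := Im_le_nrm z.
have r0 : 0 <= r := nrm_ge0 z; have E0 := expR_gt0 r.
have Ex : expR `|x| <= expR r by rewrite ler_expR.
have Ex' : expR x <= expR r by rewrite ler_expR (le_trans (ler_norm _)).
have x2 : x ^+ 2 <= r ^+ 2 by rewrite -(real_normK (num_real x)) lerXn2r ?nnegrE.
have y2 : y ^+ 2 <= r ^+ 2 by rewrite -(real_normK (num_real y)) lerXn2r ?nnegrE.
have -> : cexp z - 1 - z = (expR x * (cos y - 1) + (expR x - 1 - x))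
   +i* (expR x * (sin y - y) + (expR x - 1) * y).
  by apply: complexP; rewrite !(ReD, ImD, ReN, ImN) /= -/x -/y; ring.
apply: le_trans (nrm_le _) _ => /=.
have b1 : `|expR x * (cos y - 1)| <= expR r * r ^+ 2.
  rewrite normrM (gtr0_norm (expR_gt0 _)); apply: ler_pM; rewrite ?expR_ge0 //.
  exact: le_trans (cos_sub1_le _) y2.
have b2 : `|expR x - 1 - x| <= expR r * r ^+ 2.
  apply: le_trans (expR_sub1Dx_le _) _; rewrite mulrC; by apply: ler_pM; rewrite ?expR_ge0 ?sqr_ge0.
have b3 : `|expR x * (sin y - y)| <= expR r * r ^+ 2.
  rewrite normrM (gtr0_norm (expR_gt0 _)); apply: ler_pM; rewrite ?expR_ge0 //.
  exact: le_trans (sin_subx_le _) y2.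
have b4 : `|(expR x - 1) * y| <= expR r * r ^+ 2.
  rewrite normrM expr2 mulrA; apply: ler_pM => //.
  apply: le_trans (expR_sub1_le _) _; by rewrite mulrC; apply: ler_pM; rewrite ?expR_ge0.
have := ler_normD (expR x * (cos y - 1)) (expR x - 1 - x).
have := ler_normD (expR x * (sin y - y)) ((expR x - 1) * y).
by lra.
Qed.

Lemma expR1_le4 : expR 1 <= 4 :> R.
Proof.
have h : expR (1 / 2) <= 2 :> R.
  have := expR_ge1Dx (- (1 / 2) : R); rewrite expRN => h.
  rewrite -[expR _]invrK -[X in _ <= X]invrK lef_pV2 ?posrE ?invr_gt0 ?expR_gt0 //.
  by apply: le_trans h; lra.
have -> : 1 = 1 / 2 + 1 / 2 :> R by lra.
by rewrite expRD; have := expR_gt0 (1 / 2 : R); nra.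
Qed.

(** For r = |z| <= 1/32 the Taylor remainder is at most 16 r^2 <= r / 2. This is how a logarithm is
    recovered from its exponential. *)
Lemma cexp_sub1_lower z : nrm z <= 1 / 32 -> nrm z <= 2 * nrm (cexp z - 1).
Proof.
move=> h; have r0 := nrm_ge0 z.
have E : expR (nrm z) <= 4.
  by apply: le_trans expR1_le4; rewrite ler_expR; lra.
have h1 := cexp_taylor2 z; have h2 := nrmB (cexp z - 1) (cexp z - 1 - z).
have e : cexp z - 1 - (cexp z - 1 - z) = z by ring.
move: h2; rewrite e => h2.
have : 4 * expR (nrm z) * nrm z ^+ 2 <= 1 / 2 * nrm z.
  rewrite expr2 mulrA ler_wpM2r //.
  have := expR_gt0 (nrm z); nra.
by lra.
Qed.

Lemma cexp_sub1_upper z : nrm z <= 1 -> nrm (cexp z - 1) <= 17 * nrm z.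
Proof.
move=> h; have r0 := nrm_ge0 z.
have E : expR (nrm z) <= 4.
  by apply: le_trans expR1_le4; rewrite ler_expR; lra.
have h1 := cexp_taylor2 z; have h2 := nrmD (cexp z - 1 - z) z.
move: h2; rewrite subrK => h2.
have : 4 * expR (nrm z) * nrm z ^+ 2 <= 16 * nrm z.
  rewrite expr2 mulrA ler_wpM2r //.
  have := expR_gt0 (nrm z); nra.
by lra.
Qed.

Lemma lipschitz_cont (f : R -> R) K : (forall s t, `|f s - f t| <= K * `|s - t|) -> continuous f.
Proof.
move=> h t; apply/cvgrPdist_le => e e0.
have K0 : 0 <= K by have := h 1 0; rewrite subr0 normr1 mulr1; apply: le_trans.
near=> s; apply: le_trans (h _ _) _.
have : `|t - s| <= e / (K + 1) by near: s; apply: cvgr_dist_le => //; rewrite divr_gt0 //; lra.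
rewrite ler_pdivlMr; last lra.
by have := normr_ge0 (t - s); nra.
Unshelve. all: by end_near. Qed.

(* By continuity the path cannot leave the disc in which [cexp_sub1_lower]
   applies, so no branch of the logarithm is needed. *)
Lemma cexp_path_small (phi : R -> C) K e : e < 1 / 64 -> phi 0 = 0 ->
  (forall s t, 0 <= s <= 1 -> 0 <= t <= 1 -> nrm (phi s - phi t) <= K * `|s - t|) ->
  (forall t, 0 <= t <= 1 -> nrm (cexp (phi t) - 1) <= e) ->
  nrm (phi 1) <= 2 * e.
Proof.
move=> he p0 hK hphi.
suff h : nrm (phi 1) <= 1 / 32.
  by apply: le_trans (cexp_sub1_lower h) _; rewrite ler_pM2l // hphi // lexx ler01.
rewrite leNgt; apply/negP => h.
(* Clamping to [0, 1] extends the path to a globally continuous one, as wanted for the intermediate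
   value theorem. *)
pose cl t : R := Num.max 0 (Num.min t 1).
have clE t : [\/ t <= 0 /\ cl t = 0, 0 <= t <= 1 /\ cl t = t | 1 <= t /\ cl t = 1].
  rewrite /cl; have [t0|t0] := leP t 0.
    by apply: Or31; rewrite min_l ?max_l //; lra.
  have [t1|t1] := leP t 1.
    by apply: Or32; rewrite max_r //; lra.
  by apply: Or33; rewrite max_r //; lra.
have clb t : 0 <= cl t <= 1 by case: (clE t) => -[h1 ->]; lra.
have clL s t : `|cl s - cl t| <= `|s - t|.
  have := ler_norm (s - t); have := ler_norm (- (s - t)); rewrite normrN ler_norml.
  by case: (clE s) => -[h1 ->]; case: (clE t) => -[h2 ->]; lra.
have K0 : 0 <= K by have := hK 1 0; rewrite subr0 normr1 mulr1 !lexx ler01 => /(_ isT isT); apply: le_trans; exact: nrm_ge0.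
pose f t := nrm (phi (cl t)).
have cf : continuous f.
  apply: (@lipschitz_cont f K) => s t; apply: le_trans (nrm_dist _ _) _.
  by apply: le_trans (hK _ _ (clb s) (clb t)) _; rewrite ler_wpM2l.
have cl0 : cl 0 = 0 by case: (clE 0) => -[h1 ->]; lra.
have cl1 : cl 1 = 1 by case: (clE 1) => -[h1 ->]; lra.
(* Where the modulus equals 1/32 the lower bound yields 1/32 <= 2 e, against e < 1/64. *)
have [||t] := @IVT R f 0 1 (1 / 32) ler01.
- exact: continuous_subspaceT.
- rewrite /f cl0 cl1 p0 nrm0 min_l ?max_r; lra.
rewrite in_itv /= => _ ft.
have g : nrm (phi (cl t)) <= 1 / 32 by rewrite -/(f t) ft.
have := cexp_sub1_lower g; have := hphi _ (clb t); rewrite -/(f t) ft; lra.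
Qed.

End ComplexBasics.

(** * The Tauberian theorem *)

Section RiemannLebesgue.
Variable R : realType.

Lemma osc_piece (f psi Psi : R -> R) (a b B w iT : R) : a <= b ->
  continuous f -> continuous psi ->
  (forall t, `|psi t| <= 1) -> (forall t, is_derive t (1 : R) Psi (psi t)) ->
  (forall t, `|Psi t| <= iT) -> `|f a| <= B ->
  (forall t, a <= t <= b -> `|f t - f a| <= w) ->
  `|itg a b (fun t => f t * psi t)| <= w * (b - a) + 2 * B * iT.
Proof.
move=> ab cf cpsi p1 dP PT fB fw.
have -> : itg a b (fun t => f t * psi t) =
   itg a b (fun t => (f t - f a) * psi t) + f a * itg a b psi.
  rewrite -itgZ // -itgD; [|apply: cfM => //; apply: cfD => //; exact: cfC|apply: cfM => //; exact: cfC].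
  by apply: itg_ext => t _; ring.
apply: le_trans (ler_normD _ _) _; apply: lerD.
  apply: itg_abs_le => //; first by apply: cfM => //; apply: cfD => //; exact: cfC.
  move=> t tab; rewrite normrM -[w]mulr1; apply: ler_pM => //; exact: fw.
rewrite normrM (itg_FTC ab cpsi dP).
apply: le_trans (_ : B * (iT + iT) <= _); last by lra.
apply: ler_pM => //; apply: le_trans (ler_normB _ _) _; exact: lerD.
Qed.

(** Near 0 only boundedness of f is exploited, because the function to which this applies has a
    factor 1 / (e + it) whose variation there is not uniform in e. The rest, [eta, pi], is cut into
    N pieces. *)
Lemma riemann_lebesgue_bound (f psi Psi : R -> R) (B w iT eta : R) (N : nat) :
  (0 < N)%N -> 0 < eta <= pi ->
  continuous f -> continuous psi ->
  (forall t, `|psi t| <= 1) -> (forall t, is_derive t (1 : R) Psi (psi t)) ->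
  (forall t, `|Psi t| <= iT) -> (forall t, 0 <= t <= pi -> `|f t| <= B) ->
  (forall s t, eta <= s <= pi -> eta <= t <= pi -> `|s - t| <= pi / N%:R -> `|f s - f t| <= w) ->
  `|itg 0 pi (fun t => f t * psi t)| <= B * eta + w * pi + N%:R * (2 * B * iT).
Proof.
move=> N0 /andP[eta0 etapi] cf cpsi p1 dP PT fB fw.
have cfp : continuous (fun t => f t * psi t) by exact: cfM.
have N0' : 0 < N%:R :> R by rewrite ltr0n.
pose h := (pi - eta) / N%:R.
have h0 : 0 <= h by rewrite divr_ge0 // subr_ge0.
have hpi : h <= pi / N%:R by rewrite ler_pM2r ?invr_gt0 // lerBlDr lerDl ltW.
have Nh : N%:R * h = pi - eta by rewrite /h mulrC divfK // gt_eqF.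
have w0 : 0 <= w.
  have := fw pi pi; rewrite etapi lexx subrr normr0 divr_ge0 ?pi_ge0 // => /(_ isT isT isT).
  by apply: le_trans.
rewrite (@itg_split R 0 eta pi) //; last exact: ltW.
apply: le_trans (ler_normD _ _) _; rewrite -addrA; apply: lerD.
  rewrite -[X in B * X]subr0; apply: itg_abs_le => //; first exact: ltW.
  move=> t /andP[t0 te]; rewrite normrM -[B]mulr1; apply: ler_pM => //.
  by apply: fB; rewrite t0 (le_trans te).
have key k : (k <= N)%N ->
   `|itg eta (eta + k%:R * h) (fun t => f t * psi t)| <= k%:R * (w * h + 2 * B * iT).
  elim: k => [|k IH] kN.
    by rewrite !mul0r addr0 /itg set_itv1 Rintegral_set1 normr0.
  have kN' : k%:R + 1 <= N%:R :> R by rewrite natr1 ler_nat.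
  have k0 : 0 <= k%:R :> R by [].
  have q1 : 0 <= k%:R * h by rewrite mulr_ge0.
  have q2 : (k%:R + 1) * h <= pi - eta by rewrite -Nh ler_wpM2r.
  rewrite -natr1 (@itg_split R eta (eta + k%:R * h)) //; [|lra..].
  apply: le_trans (ler_normD _ _) _; rewrite [X in _ <= X]mulrDl mul1r; apply: lerD.
    by apply: IH; exact: ltnW.
  set a := eta + k%:R * h; set b := eta + _.
  have ba : b - a = h by rewrite /a /b; ring.
  rewrite -ba; apply: osc_piece (PT) _ _ => //; first lra.
    by apply: fB; rewrite /a; lra.
  move=> t /andP[ta tb]; apply: fw; rewrite ?ger0_norm; rewrite /a /b in ta tb *; lra.
have e : eta + (pi - eta) = pi by lra.
have := key N (leqnn _); rewrite Nh e => /le_trans; apply.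
rewrite mulrDr lerD2r mulrCA Nh ler_wpM2l //; lra.
Qed.

End RiemannLebesgue.

(** * Sums over the points lam ln n *)

Section WeightedSum.
Variable R : realType.

Lemma ln_step (n : nat) : (1 < n)%N -> n%:R^-1 <= ln n%:R - ln n.-1%:R :> R.
Proof.
case: n => [|[|m]] // _; rewrite /= -ln_div ?posrE ?ltr0n //.
have p : 0 < m.+2%:R :> R by []. have q : 0 < m.+1%:R :> R by [].
rewrite -[X in _ <= X]opprK -lnV ?posrE ?divr_gt0 // invf_div lerNr.
have -> : m.+1%:R / m.+2%:R = 1 + - m.+2%:R^-1 :> R.
  by rewrite -[m.+1%:R](addrK 1) natr1 mulrBl divff ?mul1r // gt_eqF.
by apply: le_ln1Dx; rewrite ltrN2 invf_lt1 // ltr1n.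
Qed.

Lemma ln_step_le (n : nat) : (1 < n)%N -> ln n%:R - ln n.-1%:R <= n.-1%:R^-1 :> R.
Proof.
case: n => [|[|m]] // _; rewrite /= -ln_div ?posrE ?ltr0n //.
have -> : m.+2%:R / m.+1%:R = 1 + m.+1%:R^-1 :> R.
  by rewrite -[m.+2%:R]natr1 mulrDl divff ?mul1r // gt_eqF.
apply: le_ln1Dx; apply: lt_le_trans (_ : 0 <= _); first by rewrite oppr_lt0.
by rewrite invr_ge0.
Qed.

(* Each term is at most 3/lam times the increment of atan(lam ln x - T) over
   [n-1, n], so the sum telescopes; the finitely many n with lam > n - 1 are
   negligible because lam ln n - T is then of order T. *)
Lemma log_window_sum (lam : R) : 1 <= lam -> exists T0 : R, forall T, T0 <= T -> forall N : nat,
  \sum_(1 <= n < N) (n%:R * (1 + (lam * ln n%:R - T) ^+ 2))^-1 <= 13 / lam.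
Proof.
move=> lam1; have lam0 : 0 < lam by lra.
(* From n0 on, lam <= n - 1, so consecutive points lam ln n are at distance at most 1. *)
pose n0 := (Num.truncn lam).+2.
have n0lam : lam <= n0.-1%:R by rewrite /n0 /= ltW // truncnS_gt.
have n01 : (1 < n0)%N by [].
pose L := lam * ln n0%:R.
have L0 : 0 <= L by rewrite /L mulr_ge0 ?ln_ge0 ?ler1n // ltW.
(* T >= 2 L puts the points before n0 at distance at least T / 2 from T, and T >= 4 n0 lam makes
   each of their terms at most 1 / (n0 lam); together they contribute at most 1 / lam. *)
exists (2 * L + 4 * n0%:R * lam) => T hT N.
have n0R : 2 <= n0%:R :> R by rewrite ler_nat.
have T8 : 8 * lam <= T by nra.
pose b n : R := (1 + (lam * ln n%:R - T) ^+ 2)^-1.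
have b_ge0 n : 0 <= b n by rewrite invr_ge0 addr_ge0 ?sqr_ge0.
have bE (n : nat) : (n%:R * (1 + (lam * ln n%:R - T) ^+ 2))^-1 = n%:R^-1 * b n by rewrite /b invfM.
under eq_bigr do rewrite bE.
have pos n : 0 <= n%:R^-1 * b n by rewrite mulr_ge0.
have small n : (1 <= n < n0)%N -> n%:R^-1 * b n <= (n0%:R * lam)^-1.
  move=> /andP[n1 nn0]; have nR : 1 <= n%:R :> R by rewrite ler1n.
  apply: le_trans (_ : b n <= _); first by rewrite ler_piMl // invf_le1 //; lra.
  have ln_le : lam * ln n%:R <= L.
    by rewrite /L ler_pM2l // ler_ln ?posrE ?ltr0n // ler_nat ltnW.
  have ln_0 : 0 <= lam * ln n%:R by rewrite mulr_ge0 ?ln_ge0 // ltW.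
  rewrite /b lef_pV2 ?posrE; last 2 first.
  - by rewrite ltr_pwDl ?sqr_ge0.
  - by rewrite mulr_gt0 //; lra.
  have h : T / 2 <= T - lam * ln n%:R by nra.
  have h2 : (T / 2) ^+ 2 <= (lam * ln n%:R - T) ^+ 2.
    by rewrite -[X in _ <= X]sqrrN opprB lerXn2r ?nnegrE; lra.
  have h3 : 4 * (n0%:R * lam) <= T by rewrite mulrA; lra.
  have h4 : 1 <= T by lra.
  nra.
pose at_ n : R := atan (lam * ln n%:R - T).
have big n : (n0 <= n)%N -> n%:R^-1 * b n <= 3 / lam * (at_ n - at_ n.-1).
  move=> n0n; have n1 : (1 < n)%N by apply: leq_trans n0n.
  have s1 := ln_step n1; have s2 := ln_step_le n1.
  set x := lam * ln n%:R - T; set y := lam * ln n.-1%:R - T.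
  have yx : y < x.
    rewrite /x /y ltrD2r ltr_pM2l // -subr_gt0; apply: lt_le_trans s1.
    by rewrite invr_gt0 ltr0n ltnW.
  have xy1 : x - y <= 1.
    have -> : x - y = lam * (ln n%:R - ln n.-1%:R) by rewrite /x /y; ring.
    apply: le_trans (_ : lam * n.-1%:R^-1 <= _); first by rewrite ler_pM2l.
    have n1' : 0 < n.-1%:R :> R by rewrite ltr0n; case: (n) n1 => [|[]].
    rewrite ler_pdivrMr // mul1r; apply: le_trans n0lam _.
    by rewrite ler_nat; move: n0n; case: (n) n1.
  have [z] := @MVT R (@atan R) (fun t => (1 + t ^+ 2)^-1) y x yx
    (fun t _ => der_atan t) (continuous_subspaceT (@continuous_atan R)).
  rewrite in_itv /= => /andP[yz zx] e; rewrite /at_ -/x -/y e.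
  have -> : 3 / lam * ((1 + z ^+ 2)^-1 * (x - y)) = (3 * (1 + z ^+ 2)^-1) * (ln n%:R - ln n.-1%:R).
    by rewrite /x /y; field; rewrite !gt_eqF // ltr_pwDl ?sqr_ge0.
  rewrite mulrC; apply: ler_pM => //.
  have z2 : 0 < 1 + z ^+ 2 by rewrite ltr_pwDl ?sqr_ge0.
  have x2 : 0 < 1 + x ^+ 2 by rewrite ltr_pwDl ?sqr_ge0.
  (* The mean value point z is within 1 of x, hence 1 + z^2 <= 3 (1 + x^2); [k2] is the
     parallelogram law behind it. *)
  have k1 : (x - z) ^+ 2 <= 1 by rewrite expr_le1 //; lra.
  have k2 : z ^+ 2 = 2 * x ^+ 2 + 2 * (x - z) ^+ 2 - (2 * x - z) ^+ 2 by ring.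
  have k3 := sqr_ge0 (2 * x - z); have k4 := sqr_ge0 x.
  rewrite /b -/x ler_pdivlMr // mulrC ler_pdivrMr // k2; lra.
have sum_small m : (m <= n0)%N -> \sum_(1 <= n < m) n%:R^-1 * b n <= lam^-1.
  move=> mn0; apply: le_trans (_ : \sum_(1 <= n < m) (n0%:R * lam)^-1 <= _).
    by apply: ler_sum_nat => n /andP[n1 nm]; apply: small; rewrite n1 (leq_trans nm).
  rewrite sumr_const_nat -[X in X <= _]mulr_natl invfM mulrA ler_piMl ?invr_ge0 ?(ltW lam0) // ler_pdivrMr ?ltr0n // mul1r ler_nat.
  by rewrite leq_subLR (leq_trans mn0) // leq_addl.
have [Nn0|Nn0] := leqP N n0.
  apply: le_trans (sum_small _ Nn0) _; rewrite -[X in X <= _]mul1r ler_pM2r ?invr_gt0 //; lra.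
rewrite (big_cat_nat (n := n0)) //=; last exact: ltnW.
(* 1 / lam pays for the indices below n0; 12 = 3 * 4 pays for the rest, the total variation of atan
   being pi <= 4. *)
have -> : 13 / lam = lam^-1 + 12 / lam by rewrite -[X in X + _]mul1r -mulrDl; congr (_ / _); ring.
apply: lerD; first exact: sum_small.
apply: le_trans (_ : \sum_(n0 <= n < N) 3 / lam * (at_ n - at_ n.-1) <= _).
  by apply: ler_sum_nat => n /andP[n0n _]; exact: big.
rewrite -mulr_sumr.
have -> : \sum_(n0 <= n < N) (at_ n - at_ n.-1) = at_ N.-1 - at_ n0.-1.
  have := @telescope_sumr_eq R n0 N (fun n => at_ n.-1) (fun n => at_ n - at_ n.-1).
  by apply => //; exact: ltnW.
have -> : 12 / lam = 3 / lam * 4 by ring.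
rewrite ler_wpM2l ?divr_ge0 // ?(ltW lam0) //.
have := atan_ltpi2 (lam * ln N.-1%:R - T); have := atan_gtNpi2 (lam * ln n0.-1%:R - T).
by rewrite -/(at_ _) -/(at_ _); have := pihalf_lt2 R; lra.
Qed.

End WeightedSum.

(** * Continuity of complex-valued functions of a real variable *)

Section ComplexPaths.
Variable R : realType.
Local Notation C := R[i].
Local Notation Re := complex.Re.
Local Notation Im := complex.Im.

Definition ccont (f : R -> C) :=
  continuous (fun t => Re (f t)) /\ continuous (fun t => Im (f t)).

Lemma ccont_cst (z : C) : ccont (fun=> z).
Proof. by split; exact: cfC. Qed.

Lemma ccontD (f g : R -> C) : ccont f -> ccont g -> ccont (fun t => f t + g t).
Proof.
move=> [f1 f2] [g1 g2]; split.
  by under eq_fun do rewrite ReD; apply: cfD.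
by under eq_fun do rewrite ImD; apply: cfD.
Qed.

Lemma ccontM (f g : R -> C) : ccont f -> ccont g -> ccont (fun t => f t * g t).
Proof.
move=> [f1 f2] [g1 g2]; split.
  by under eq_fun do rewrite ReM; apply: cfD; [apply: cfM|apply: cfN; apply: cfM].
by under eq_fun do rewrite ImM; apply: cfD; apply: cfM.
Qed.

Lemma ccontR (f : R -> R) : continuous f -> ccont (fun t => (f t)%:C).
Proof. by move=> cf; split => //=; exact: cfC. Qed.

Lemma ccont_modulus (f : R -> C) :
  (forall t e, 0 < e -> exists2 d, 0 < d & forall s, `|t - s| < d -> nrm (f t - f s) <= e) ->
  ccont f.
Proof.
move=> h; split => t; apply/cvgrPdist_le => e e0; have [d d0 hd] := h t e e0;
  near=> s; have ts : `|t - s| < d by near: s; exact: cvgr_dist_lt.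
- by rewrite -ReN -ReD; apply: le_trans (Re_le_nrm _) (hd s ts).
- by rewrite -ImN -ImD; apply: le_trans (Im_le_nrm _) (hd s ts).
Unshelve. all: by end_near. Qed.

Lemma complexV (a b : R) : a ^+ 2 + b ^+ 2 != 0 ->
  (a +i* b)^-1 = (a / (a ^+ 2 + b ^+ 2)) +i* (- b / (a ^+ 2 + b ^+ 2)).
Proof.
move=> h.
have h' : a +i* b != 0.
  by apply: contraNneq h => -[-> ->]; rewrite !expr0n addr0.
apply: (mulfI h'); rewrite divff //.
by apply: complexP; rewrite ?ReM ?ImM /=; field.
Qed.

Lemma ccont_line_inv (e : R) : 0 < e -> ccont (fun t => (e +i* t)^-1).
Proof.
move=> e0; have h t := sqD_neq0 t e0.
have -> : (fun t => (e +i* t)^-1) =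
  fun t => (e / (e ^+ 2 + t ^+ 2)) +i* (- t / (e ^+ 2 + t ^+ 2)).
  by apply/funext => t; rewrite complexV.
split => /=; cf; apply: cfV => //; cf.
Qed.

Lemma ccont_comp_opp (f : R -> C) : ccont f -> ccont (fun t => f (- t)).
Proof.
move=> [f1 f2]; have c : continuous (fun t : R => - t) by cf; exact: cfI.
split => t; [exact: (continuous_comp (c t) (f1 _))|exact: (continuous_comp (c t) (f2 _))].
Qed.

End ComplexPaths.

(** * The test integrand and the quotient (F - A) / z *)

Section TestIntegrand.
Variable R : realType.
Local Notation C := R[i].
Local Notation Re := complex.Re.
Local Notation Im := complex.Im.

Lemma nrm_ge_Re (z : C) : Re z <= nrm z.
Proof. exact: le_trans (ler_norm _) (Re_le_nrm z). Qed.

(** A real part written as half a sum over conjugate points. In this form it is linear over the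
    complex coefficients of the Dirichlet series. *)
Lemma kernel_integrandE (e u t : R) : 0 < e ->
  (kernel_integrand e u t)%:C = ((1 + cos t) / 2)%:C *
   (cexp (- ((e +i* t) * u%:C)) / (e +i* t) + cexp (- ((e +i* (- t)) * u%:C)) / (e +i* (- t))).
Proof.
move=> e0; have h := sqD_neq0 t e0.
rewrite !complexV ?sqrrN //.
apply: complexP; rewrite !(ReM, ImM, ReD, ImD, ReN, ImN) /=.
  rewrite /kernel_integrand !(mulr0, mul0r, subr0, addr0, add0r, mulNr, opprK) cosN sinN.
  by field.
rewrite !(mulr0, mul0r, subr0, addr0, add0r, mulNr, opprK, mulrN, oppr0) cosN sinN.
by field.
Qed.

(* The two summands are the contributions of the conjugate points e + it and
   e - it, so that 0 <= t <= pi accounts for the whole interval [-pi, pi]. *)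
Definition test_integrand (G : C -> C) (A : C) (e T t : R) : C :=
  ((1 + cos t) / 2)%:C *
   (cexp ((e +i* t) * T%:C) * (G (e +i* t) - A) / (e +i* t) +
    cexp ((e +i* (- t)) * T%:C) * (G (e +i* (- t)) - A) / (e +i* (- t))).

(** The shift by T factors out as exp(z T). The constant A behaves like a term with x = 0, hence its
    weight at -T. *)
Lemma kernel_sumE (c : nat -> C) (x : nat -> R) (A : C) (e T t : R) (N : nat) : 0 < e ->
  \sum_(0 <= n < N) c n * (kernel_integrand e (x n - T) t)%:C - A * (kernel_integrand e (- T) t)%:C =
  test_integrand (fun z => \sum_(0 <= n < N) c n * cexp (- (z * (x n)%:C))) A e T t.
Proof.
move=> e0.
have sh z y : cexp (- (z * (y - T)%:C)) = cexp (z * T%:C) * cexp (- (z * y%:C)).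
  rewrite -cexpD; congr cexp; rewrite rmorphB /=; ring.
have sh0 z : cexp (- (z * (- T)%:C)) = cexp (z * T%:C).
  by congr cexp; rewrite rmorphN /=; ring.
rewrite /test_integrand kernel_integrandE // !sh0.
under eq_bigr do rewrite kernel_integrandE // !sh.
set w := _%:C; set a := cexp _; set b := cexp _; set z := e +i* t; set z' := e +i* - t.
rewrite (eq_bigr (fun n => w * a / z * (c n * cexp (- (z * (x n)%:C))) +
  w * b / z' * (c n * cexp (- (z' * (x n)%:C))))); last by move=> n _; ring.
by rewrite big_split /= -!mulr_sumr; ring.
Qed.

Lemma nrm_line_ge (e t : R) : 0 < e -> e <= nrm (e +i* t) /\ `|t| <= nrm (e +i* t).
Proof. by move=> e0; split; [exact: nrm_ge_Re (e +i* t)|exact: Im_le_nrm (e +i* t)]. Qed.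

Lemma nrm_weight (t : R) : nrm ((1 + cos t) / 2)%:C <= 1.
Proof.
rewrite nrmR; have /andP[h1 h2] := one_cos_bounds t.
by rewrite ger0_norm; lra.
Qed.

(** The loss of 1 / e is harmless: G is a partial sum of the series, and its length is chosen after
    e. *)
Lemma test_integrand_dist (G G' : C -> C) (A : C) (e T t d : R) : 0 < e ->
  (forall s, nrm (G (e +i* s) - G' (e +i* s)) <= d) ->
  nrm (test_integrand G A e T t - test_integrand G' A e T t) <= 2 * (expR (e * T) * d / e).
Proof.
move=> e0 h.
have piece s : nrm (cexp ((e +i* s) * T%:C) * (G (e +i* s) - G' (e +i* s)) / (e +i* s)) <= expR (e * T) * d / e.
  rewrite !nrmM nrmV nrm_cexp ReM /= mulr0 subr0.
  have [k _] := nrm_line_ge s e0.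
  apply: ler_pM; rewrite ?mulr_ge0 ?expR_ge0 ?nrm_ge0 ?invr_ge0 ?nrm_ge0 //.
    by rewrite ler_pM2l ?expR_gt0.
  by rewrite lef_pV2 // posrE //; exact: lt_le_trans k.
have -> : test_integrand G A e T t - test_integrand G' A e T t = ((1 + cos t) / 2)%:C *
  (cexp ((e +i* t) * T%:C) * (G (e +i* t) - G' (e +i* t)) / (e +i* t) +
    cexp ((e +i* (- t)) * T%:C) * (G (e +i* (- t)) - G' (e +i* (- t))) / (e +i* (- t))).
  by rewrite /test_integrand; ring.
rewrite nrmM -[X in _ <= X]mul1r; apply: ler_pM; rewrite ?nrm_ge0 ?nrm_weight //.
apply: le_trans (nrmD _ _) _; have := piece t; have := piece (- t); lra.
Qed.

Variables (F : C -> C) (A : C).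

(** The line Re z = 0 is excluded, yet the modulus of continuity does not degenerate on approaching
    it. This stands in for a continuous extension of F. *)
Definition strip_unif_cont := forall La e : R, 0 < e -> exists2 d, 0 < d &
  forall z w : C, 0 < Re z <= 1 -> 0 < Re w <= 1 -> `|Im z| <= La -> `|Im w| <= La ->
  nrm (z - w) < d -> nrm (F z - F w) <= e.

(** A plays the part of the value of F at z = 0; the estimate compensates the pole of 1 / z. *)
Definition boundary_lipschitz := forall La : R, exists K : R, forall z : C,
  0 < Re z <= 1 -> `|Im z| <= La -> nrm (F z - A) <= K * nrm z.

Hypothesis hUC : strip_unif_cont.
Hypothesis hLip : boundary_lipschitz.

Lemma scale_line (lam e t : R) : lam%:C * (e +i* t) = (lam * e) +i* (lam * t).
Proof. by apply: complexP; rewrite ?ReM ?ImM /= ?mul0r ?subr0 ?addr0. Qed.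

Lemma scale_line_dist (lam e s t : R) : 0 < lam ->
  nrm (lam%:C * (e +i* s) - lam%:C * (e +i* t)) = lam * `|s - t|.
Proof.
move=> lam0; have -> : lam%:C * (e +i* s) - lam%:C * (e +i* t) = lam%:C * 'i%C * (s - t)%:C.
  by apply: complexP; rewrite !(ReM, ImM, ReD, ImD, ReN, ImN) /=; ring.
by rewrite !nrmM !nrmR gtr0_norm // nrmE /= expr0n expr1n add0r sqrtr1 mulr1.
Qed.

Lemma ccont_F (lam e : R) : 0 < lam -> 0 < lam * e <= 1 -> ccont (fun t => F (lam%:C * (e +i* t))).
Proof.
move=> lam0 he; apply: ccont_modulus => t eta eta0.
have [d d0 hd] := hUC (lam * (`|t| + 1)) eta0.
exists (Num.min 1 (d / lam)) => [|s]; first by rewrite lt_min ltr01 divr_gt0.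
rewrite lt_min => /andP[ts1 tsd]; apply: hd; rewrite ?scale_line_dist // ?scale_line //= ?normrM ?(gtr0_norm lam0) //.
- by rewrite ler_pM2l //; have := normr_ge0 t; lra.
- rewrite ler_pM2l //; have := ler_normB t (t - s); rewrite opprB addrC subrK; lra.
- by rewrite mulrC -ltr_pdivlMr.
Qed.

Definition line_quotient (lam e t : R) : C := ((1 + cos t) / 2)%:C * ((F (lam%:C * (e +i* t)) - A) / (e +i* t)).

Lemma line_quotient_cont (lam e : R) : 0 < lam -> 0 < e -> lam * e <= 1 -> ccont (line_quotient lam e).
Proof.
move=> lam0 e0 le1; apply: ccontM; first by apply: ccontR; cf.
apply: ccontM; last exact: ccont_line_inv.
apply: ccontD; last exact: ccont_cst.
by apply: ccont_F => //; rewrite le1 mulr_gt0.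
Qed.

(** The Lipschitz bound cancels |e + it|, so B depends on lam but not on e. *)
Lemma line_quotient_bound (lam : R) : 0 < lam -> exists2 B, 0 < B & forall e t : R, 0 < e -> lam * e <= 1 ->
  `|t| <= pi -> nrm (line_quotient lam e t) <= B.
Proof.
move=> lam0; have [K hK] := hLip (lam * pi).
exists (`|K| * lam + 1) => [|e t e0 le1 tpi]; first by rewrite ltr_wpDl // mulr_ge0 // ltW.
have [k _] := nrm_line_ge t e0; have k0 := lt_le_trans e0 k.
have h : nrm (F (lam%:C * (e +i* t)) - A) <= `|K| * lam * nrm (e +i* t).
  have hz : nrm (F (lam%:C * (e +i* t)) - A) <= K * nrm (lam%:C * (e +i* t)).
    apply: hK; rewrite scale_line /= ?le1 ?mulr_gt0 //.
    by rewrite normrM gtr0_norm // ler_pM2l.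
  apply: le_trans hz _; rewrite nrmM nrmR (gtr0_norm lam0) -mulrA ler_wpM2r ?mulr_ge0 ?(ltW lam0) ?nrm_ge0 //.
  exact: ler_norm.
rewrite /line_quotient !nrmM nrmV; apply: le_trans (_ : 1 * (`|K| * lam) <= _); last by lra.
apply: ler_pM; rewrite ?mulr_ge0 ?invr_ge0 ?nrm_ge0 ?nrm_weight //.
by rewrite ler_pdivrMr.
Qed.

Lemma cos_lip (s t : R) : `|cos s - cos t| <= `|s - t|.
Proof.
have h (a b : R) : a <= b -> `|cos b - cos a| <= b - a.
  move=> ab.
  have := @le_increment_of_derive R (@cos R) (fun t => t) (fun t => - sin t) (fun=> 1) a b ab
   (fun t _ => is_derive_cos t) (fun t _ => der_id t).
  by apply => t0 _; rewrite normrN sin_abs_le1.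
have [st|ts] := leP s t.
  by rewrite distrC (distrC s) [X in _ <= X]ger0_norm ?subr_ge0 // h.
by rewrite [X in _ <= X]ger0_norm ?subr_ge0 ?h ?(ltW ts).
Qed.

(** For |t| >= eta the factor 1 / (e + it) is at most 1 / eta in modulus whatever e is, so d can be
    taken independent of e. *)
Lemma line_quotient_modulus (lam eta w : R) : 0 < lam -> 0 < eta -> 0 < w -> exists2 d, 0 < d &
  forall e s t : R, 0 < e -> lam * e <= 1 -> eta <= `|s| <= pi -> eta <= `|t| <= pi ->
  `|s - t| < d -> nrm (line_quotient lam e s - line_quotient lam e t) <= w.
Proof.
move=> lam0 eta0 w0; have [K hK] := hLip (lam * pi).
set K' := `|K| * lam + 1; have K'0 : 0 < K' by rewrite /K' ltr_wpDl // mulr_ge0 // ltW.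
have we : 0 < w * eta / 2 by rewrite divr_gt0 // mulr_gt0.
have [d0 d00 hd0] := hUC (lam * pi) we.
pose q := K' / eta + K'; have q0 : 0 < q by rewrite addr_gt0 // divr_gt0.
exists (Num.min (d0 / lam) (w / 2 / q)) => [|e s t e0 le1 /andP[es spi] /andP[et tpi]].
  by rewrite lt_min !divr_gt0.
rewrite lt_min => /andP[st1 st2].
have [ke kt] := nrm_line_ge t e0; have k0 := lt_le_trans e0 ke.
have [je js] := nrm_line_ge s e0; have j0 := lt_le_trans e0 je.
have z0 : e +i* t != 0 by rewrite -nrm_gt0.
have y0 : e +i* s != 0 by rewrite -nrm_gt0.
have inb u : `|u| <= pi -> `|lam * u| <= lam * pi.
  by move=> h; rewrite normrM gtr0_norm // ler_pM2l.
have hA u : `|u| <= pi -> nrm (F (lam%:C * (e +i* u)) - A) <= K' * nrm (e +i* u).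
  move=> h; have hz : nrm (F (lam%:C * (e +i* u)) - A) <= K * nrm (lam%:C * (e +i* u)).
    by apply: hK; rewrite scale_line /= ?le1 ?mulr_gt0 ?inb.
  apply: le_trans hz _; rewrite nrmM nrmR (gtr0_norm lam0) mulrA ler_wpM2r ?nrm_ge0 //.
  rewrite /K'; have := ler_norm K; nra.
have hF : nrm (F (lam%:C * (e +i* s)) - F (lam%:C * (e +i* t))) <= w * eta / 2.
  apply: hd0; rewrite ?scale_line_dist // ?scale_line //= ?le1 ?mulr_gt0 ?inb //.
  by rewrite mulrC -ltr_pdivlMr.
set a := F _ - F _ in hF.
(* One factor changes at a time: F, then 1 / (e + it), then the weight. The first costs w / 2; the
   last two cost q |s - t| <= w / 2 together. *)
have eqn : line_quotient lam e s - line_quotient lam e t =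
   ((1 + cos s) / 2)%:C * (a / (e +i* s)) +
   (((1 + cos s) / 2)%:C * ((F (lam%:C * (e +i* t)) - A) / (e +i* t)) * ((e +i* t - e +i* s) / (e +i* s)) +
   ((cos s - cos t) / 2)%:C * ((F (lam%:C * (e +i* t)) - A) / (e +i* t))).
  rewrite /line_quotient /a.
  have -> : ((cos s - cos t) / 2)%:C = ((1 + cos s) / 2)%:C - ((1 + cos t) / 2)%:C.
    by rewrite -rmorphB /=; congr (_%:C); field.
  by field; rewrite z0 y0.
rewrite eqn.
have p1 : nrm (((1 + cos s) / 2)%:C * (a / (e +i* s))) <= w / 2.
  rewrite !nrmM nrmV; apply: le_trans (_ : 1 * (w * eta / 2 / nrm (e +i* s)) <= _).
    apply: ler_pM; rewrite ?mulr_ge0 ?invr_ge0 ?nrm_ge0 ?nrm_weight //.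
    by rewrite ler_pM2r ?invr_gt0.
  rewrite mul1r ler_pdivrMr //.
  have := le_trans es js; nra.
have hh : nrm ((F (lam%:C * (e +i* t)) - A) / (e +i* t)) <= K'.
  by rewrite nrmM nrmV ler_pdivrMr // hA.
have dz : nrm (e +i* t - e +i* s) <= `|s - t|.
  have -> : e +i* t - e +i* s = 0 +i* (t - s).
    by apply: complexP; rewrite !(ReD, ImD, ReN, ImN) /=; ring.
  by apply: le_trans (nrm_le _) _; rewrite /= normr0 add0r distrC.
have p2 : nrm (((1 + cos s) / 2)%:C * ((F (lam%:C * (e +i* t)) - A) / (e +i* t)) * ((e +i* t - e +i* s) / (e +i* s)))
   <= K' * (`|s - t| / eta).
  rewrite nrmM; apply: ler_pM; rewrite ?nrm_ge0 //.
    by rewrite nrmM -[X in _ <= X]mul1r; apply: ler_pM; rewrite ?nrm_ge0 ?nrm_weight.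
  rewrite nrmM nrmV; apply: ler_pM; rewrite ?invr_ge0 ?nrm_ge0 //.
  by rewrite lef_pV2 ?posrE //; exact: le_trans js.
have p3 : nrm (((cos s - cos t) / 2)%:C * ((F (lam%:C * (e +i* t)) - A) / (e +i* t))) <= `|s - t| * K'.
  rewrite nrmM; apply: ler_pM; rewrite ?nrm_ge0 // nrmR normrM.
  rewrite (@ger0_norm _ 2^-1) //; have := cos_lip s t; have := normr_ge0 (cos s - cos t); lra.
have p4 : K' * (`|s - t| / eta) + `|s - t| * K' <= w / 2.
  have -> : K' * (`|s - t| / eta) + `|s - t| * K' = `|s - t| * q by rewrite /q; field; rewrite gt_eqF.
  by rewrite -ler_pdivlMr // ltW.
have := nrmD (((1 + cos s) / 2)%:C * (a / (e +i* s))) (((1 + cos s) / 2)%:C * ((F (lam%:C * (e +i* t)) - A) / (e +i* t)) * ((e +i* t - e +i* s) / (e +i* s)) +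
   ((cos s - cos t) / 2)%:C * ((F (lam%:C * (e +i* t)) - A) / (e +i* t))).
have := nrmD (((1 + cos s) / 2)%:C * ((F (lam%:C * (e +i* t)) - A) / (e +i* t)) * ((e +i* t - e +i* s) / (e +i* s)))
   (((cos s - cos t) / 2)%:C * ((F (lam%:C * (e +i* t)) - A) / (e +i* t))).
by lra.
Qed.

End TestIntegrand.

(** * Smallness of the test integral *)

Section TestIntegralDecay.
Variable R : realType.
Local Notation C := R[i].
Local Notation Re := complex.Re.
Local Notation Im := complex.Im.
Variables (F : C -> C) (A : C).
Hypothesis hUC : strip_unif_cont F.
Hypothesis hLip : boundary_lipschitz F A.

Lemma Re_test_integrand (lam e T t : R) :
  Re (test_integrand (fun z => F (lam%:C * z)) A e T t) =
  expR (e * T) * ((Re (line_quotient F A lam e t) + Re (line_quotient F A lam e (- t))) * cos (t * T) +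
    (Im (line_quotient F A lam e (- t)) - Im (line_quotient F A lam e t)) * sin (t * T)).
Proof.
rewrite /test_integrand /line_quotient cosN.
set w := ((1 + cos t) / 2)%:C.
set a := (F (lam%:C * (e +i* t)) - A); set b := (F (lam%:C * (e +i* - t)) - A).
rewrite (_ : w * _ = cexp ((e +i* t) * T%:C) * (w * (a / (e +i* t))) +
   cexp ((e +i* - t) * T%:C) * (w * (b / (e +i* - t)))); last by ring.
set p := w * (a / _); set q := w * (b / _).
rewrite ReD !ReM /= !(mulr0, subr0, add0r) mulNr cosN sinN; ring.
Qed.

(** The integrand changes with T not only in its frequency, but also through e = 1/T. Since the
    bound B and the modulus d do not depend on e, the cut eta and the number N of pieces are fixed
    before T, and the quantitative Riemann-Lebesgue lemma applies uniformly. *)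
Lemma test_integral_small (lam zeta : R) : 0 < lam -> 0 < zeta -> exists T0 : R, forall T, T0 <= T ->
  lam <= T -> 0 < T ->
  continuous (fun t => Re (test_integrand (fun z => F (lam%:C * z)) A T^-1 T t)) /\
  `|itg 0 pi (fun t => Re (test_integrand (fun z => F (lam%:C * z)) A T^-1 T t))| <= zeta.
Proof.
move=> lam0 zeta0; have pi0 := pi_gt0 R; have pi2 := pi_ge2 R; have pi4 := pihalf_lt2 R.
have [B B0 hB] := line_quotient_bound hLip lam0.
(* Budget for each of the cosine and sine integrals: zeta / 24 near 0, at most zeta / 25 from the
   modulus zeta / 100, and zeta / 24 from the N boundary terms. Their sum stays below zeta / 4 and
   absorbs the factor expR 1 <= 4. *)
pose eta := Num.min 1 (zeta / (48 * B)).
have eta0 : 0 < eta by rewrite lt_min ltr01 divr_gt0 // mulr_gt0.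
have eta1 : eta <= 1 by rewrite ge_min lexx.
have etaB : 2 * B * eta <= zeta / 24.
  apply: le_trans (_ : 2 * B * (zeta / (48 * B)) <= _).
    by rewrite ler_pM2l ?mulr_gt0 // ge_min lexx orbT.
  by rewrite le_eqVlt (_ : _ == _) //; apply/eqP; field; rewrite gt_eqF.
have w0 : 0 < zeta / 200 by lra.
have [d d0 hd] := line_quotient_modulus hUC hLip lam0 eta0 w0.
pose N := (Num.truncn (pi / d)).+1.
have N0 : (0 < N)%N by [].
have NR : 0 < N%:R :> R by rewrite ltr0n.
have piN : pi / N%:R < d.
  by rewrite ltr_pdivrMr // mulrC -ltr_pdivrMr // /N truncnS_gt.
exists (96 * N%:R * B / zeta) => T hT lamT T0.
have e0 : 0 < T^-1 by rewrite invr_gt0.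
have lam1 : lam * T^-1 <= 1 by rewrite ler_pdivrMr // mul1r.
have gc := @line_quotient_cont R F A hUC lam T^-1 lam0 e0 lam1.
have gc' := ccont_comp_opp gc.
set gg := line_quotient F A lam T^-1 in gc gc' *.
pose f1 t := Re (gg t) + Re (gg (- t)).
pose f2 t := Im (gg (- t)) - Im (gg t).
have c1 : continuous f1 by exact: cfD gc.1 gc'.1.
have c2 : continuous f2 by exact: cfD gc'.2 (cfN gc.2).
have cc : continuous (fun t : R => cos (t * T)) by cf.
have cs : continuous (fun t : R => sin (t * T)) by cf.
have RE t : Re (test_integrand (fun z => F (lam%:C * z)) A T^-1 T t) =
  expR 1 * (f1 t * cos (t * T) + f2 t * sin (t * T)).
  by rewrite Re_test_integrand mulVf // gt_eqF.
have -> : (fun t => Re (test_integrand (fun z => F (lam%:C * z)) A T^-1 T t)) =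
  (fun t => expR 1 * (f1 t * cos (t * T) + f2 t * sin (t * T))).
  by apply/funext => t; exact: RE.
have ctot : continuous (fun t => f1 t * cos (t * T) + f2 t * sin (t * T)).
  by apply: cfD; apply: cfM.
split; first by apply: cfM => //; exact: cfC.
have gB t : 0 <= t <= pi -> nrm (gg t) <= B /\ nrm (gg (- t)) <= B.
  by move=> /andP[t0 tp]; split; apply: hB => //; rewrite ?normrN ger0_norm.
have gm s t : eta <= s <= pi -> eta <= t <= pi -> `|s - t| <= pi / N%:R ->
    nrm (gg s - gg t) <= zeta / 200 /\ nrm (gg (- s) - gg (- t)) <= zeta / 200.
  move=> /andP[s1 s2] /andP[t1 t2] st; have s0 : 0 <= s by clear - hUC hLip s1 eta0; lra. have t0 : 0 <= t by clear - hUC hLip t1 eta0; lra.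
  split; apply: hd => //; rewrite ?normrN ?(ger0_norm s0) ?(ger0_norm t0) ?s1 ?t1 //.
    exact: le_lt_trans piN.
  by rewrite -opprD normrN; exact: le_lt_trans piN.
have Re_le z := Re_le_nrm (z : C); have Im_le z := Im_le_nrm (z : C).
have b1 t : 0 <= t <= pi -> `|f1 t| <= 2 * B.
  move=> ht; have [h1 h2] := gB t ht; apply: le_trans (ler_normD _ _) _.
  have := Re_le (gg t); have := Re_le (gg (- t)); clear - hUC hLip h1 h2; lra.
have b2 t : 0 <= t <= pi -> `|f2 t| <= 2 * B.
  move=> ht; have [h1 h2] := gB t ht; apply: le_trans (ler_normB _ _) _.
  have := Im_le (gg t); have := Im_le (gg (- t)); clear - hUC hLip h1 h2; lra.
have m1 s t : eta <= s <= pi -> eta <= t <= pi -> `|s - t| <= pi / N%:R -> `|f1 s - f1 t| <= zeta / 100.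
  move=> hs ht hst; have [h1 h2] := gm s t hs ht hst.
  have -> : f1 s - f1 t = Re (gg s - gg t) + Re (gg (- s) - gg (- t)).
    by rewrite /f1 !(ReD, ReN); ring.
  apply: le_trans (ler_normD _ _) _.
  have := Re_le (gg s - gg t); have := Re_le (gg (- s) - gg (- t)); clear - hUC hLip h1 h2; lra.
have m2 s t : eta <= s <= pi -> eta <= t <= pi -> `|s - t| <= pi / N%:R -> `|f2 s - f2 t| <= zeta / 100.
  move=> hs ht hst; have [h1 h2] := gm s t hs ht hst.
  have -> : f2 s - f2 t = Im (gg (- s) - gg (- t)) - Im (gg s - gg t).
    by rewrite /f2 !(ImD, ImN); ring.
  apply: le_trans (ler_normB _ _) _.
  have := Im_le (gg s - gg t); have := Im_le (gg (- s) - gg (- t)); clear - hUC hLip h1 h2; lra.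
have dT t : is_derive t (1 : R) (fun s => s * T) T.
  by apply: (is_derive_ext (derM (der_id t) (der_cst t T))) => //; ring.
have dS t : is_derive t (1 : R) (fun s => T^-1 * sin (s * T)) (cos (t * T)).
  by apply: (is_derive_ext (derZ T^-1 (der_sin (dT t)))) => //; field; rewrite gt_eqF.
have dC t : is_derive t (1 : R) (fun s => - T^-1 * cos (s * T)) (sin (t * T)).
  by apply: (is_derive_ext (derZ (- T^-1) (der_cos (dT t)))) => //; field; rewrite gt_eqF.
have eN : 0 < eta <= pi by rewrite eta0; lra.
have r1 := @riemann_lebesgue_bound R f1 (fun t => cos (t * T)) (fun s => T^-1 * sin (s * T)) (2 * B) (zeta / 100) T^-1 eta N
  N0 eN c1 cc (fun t => cos_abs_le1 _) dS _ b1 m1.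
have r2 := @riemann_lebesgue_bound R f2 (fun t => sin (t * T)) (fun s => - T^-1 * cos (s * T)) (2 * B) (zeta / 100) T^-1 eta N
  N0 eN c2 cs (fun t => sin_abs_le1 _) dC _ b2 m2.
rewrite itgZ // itgD; [|exact: cfM..].
have {}r1 := r1 (fun t => _); have {}r2 := r2 (fun t => _).
have p1 t : `|T^-1 * sin (t * T)| <= T^-1.
  by rewrite normrM gtr0_norm // ler_piMr ?sin_abs_le1 // ltW.
have p2 t : `|- T^-1 * cos (t * T)| <= T^-1.
  by rewrite mulNr normrN normrM (gtr0_norm e0) -[X in _ <= X]mulr1 ler_pM2l // cos_abs_le1.
have {}r1 := r1 p1; have {}r2 := r2 p2.
have last : N%:R * (2 * (2 * B) * T^-1) <= zeta / 24.
  have -> : N%:R * (2 * (2 * B) * T^-1) = (4 * N%:R * B) / T by ring.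
  rewrite ler_pdivrMr //; move: hT; rewrite ler_pdivrMr //.
  have : zeta / 24 * T = (T * zeta) / 24 by ring.
  clear - hUC hLip; lra.
have E4 := expR1_le4 R; have E0 := expR_gt0 (1 : R).
rewrite normrM gtr0_norm //.
have pi_le4 : pi <= 4 :> R by clear - hUC hLip pi4; lra.
have mid : zeta / 100 * pi <= zeta / 25 by have := ler_wpM2l (ltW zeta0) pi_le4; clear - hUC hLip; lra.
set I1 := itg _ _ _ in r1 *; set I2 := itg _ _ _ in r2 *.
have sumI : `|I1 + I2| <= zeta / 4.
  by apply: le_trans (ler_normD _ _) _; clear - hUC hLip zeta0 r1 r2 etaB mid last; lra.
apply: le_trans (_ : 4 * (zeta / 4) <= _); last by clear - hUC hLip; lra.
by apply: ler_pM => //; exact: expR_ge0.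
Qed.

End TestIntegralDecay.

(** * The Tauberian estimate for real parts *)

Section TauberianRealPart.
Variable R : realType.
Local Notation C := R[i].
Local Notation Re := complex.Re.
Local Notation Im := complex.Im.
Variables (F : C -> C) (A : C).
Hypothesis hUC : strip_unif_cont F.
Hypothesis hLip : boundary_lipschitz F A.

Lemma itg_sum (a b : R) (f : nat -> R -> R) (r : nat -> R) (N : nat) :
  (forall n, continuous (f n)) ->
  continuous (fun t => \sum_(0 <= n < N) r n * f n t) /\
  itg a b (fun t => \sum_(0 <= n < N) r n * f n t) = \sum_(0 <= n < N) r n * itg a b (f n).
Proof.
move=> cf0; elim: N => [|N [IH1 IH2]].
  rewrite big_geq //; have -> : (fun t => \sum_(0 <= n < 0) r n * f n t) = (fun=> 0).
    by apply/funext => t; rewrite big_geq.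
  split; first exact: cfC.
  have h := @itgZ R a b 0 (fun=> 0) (@cfC R 0); rewrite [RHS]mul0r in h; rewrite -[RHS]h.
  by apply: itg_ext => t _; rewrite mul0r.
have -> : (fun t => \sum_(0 <= n < N.+1) r n * f n t) =
  (fun t => \sum_(0 <= n < N) r n * f n t + r N * f N t).
  by apply/funext => t; rewrite big_nat_recr.
have cN : continuous (fun t => r N * f N t) by apply: cfM => //; exact: cfC.
split; first exact: cfD.
by rewrite itgD // IH2 itgZ // big_nat_recr.
Qed.

Variables (c : nat -> C) (M : R).
Hypothesis c0 : c 0%N = 0.
Hypothesis cM : forall n, (0 < n)%N -> nrm (c n) <= M / n%:R.
Hypothesis hF : forall sigma eta : R, 0 < sigma -> 0 < eta -> exists N0 : nat, forall N, (N0 <= N)%N ->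
  forall z : C, sigma <= Re z -> nrm (\sum_(0 <= n < N) c n * natcpow n (- z) - F z) <= eta.

(** The smoothed sum of r_n K_n minus Re A * P is small by the integral estimate. Replacing K_n by P
    for n <= m and by 0 for n > m costs at most the window sum, O(1 / lam). It remains to divide by
    P >= 1/2. *)
Lemma tauberian_Re (zeta : R) : 0 < zeta -> exists m0 : nat, forall m, (m0 <= m)%N ->
  `|Re (\sum_(0 <= n < m.+1) c n - A)| <= zeta.
Proof.
move=> zeta0; have pi0 := pi_gt0 R; have pi4 := pihalf_lt2 R.
have M0 : 0 <= M by have := cM (ltn0Sn 0); rewrite divr1; apply: le_trans; exact: nrm_ge0.
have E4 := expR1_le4 R; have E1 : 1 <= expR 1 :> R by rewrite -expR0 ler_expR.
pose G := expR 1 * 108 : R.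
have G0 : 0 < G by rewrite mulr_gt0 ?expR_gt0.
(* 104 = 8 * 13, so that the window sum 13 / lam, weighted by M G, is at most zeta / 8. *)
pose lam := 1 + 104 * M * G / zeta.
have lam1 : 1 <= lam by rewrite lerDl divr_ge0 ?mulr_ge0 // ltW.
have lam0 : 0 < lam by lra.
have lamE : M * G * (13 / lam) <= zeta / 8.
  have e : zeta / 8 * lam = zeta / 8 + 13 * (M * G) by rewrite /lam; field; rewrite gt_eqF.
  by rewrite mulrA ler_pdivrMr // e; lra.
have z8 : 0 < zeta / 8 by rewrite divr_gt0.
have [T1 hT1] := test_integral_small hUC hLip lam0 z8.
have [T2 hT2] := log_window_sum lam1.
have [T3 [T31 hT3]] := kernel_plateau_ge R.
pose TT := `|T1| + `|T2| + T3 + lam.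
have [aT1 aT2] : T1 <= `|T1| /\ T2 <= `|T2| by split; exact: ler_norm.
have [nT1 nT2] : 0 <= `|T1| /\ 0 <= `|T2| by [].
exists (Num.truncn (expR (TT / lam))).+1 => m hm.
have m0 : (0 < m)%N by apply: leq_trans hm.
have mR : 0 < m%:R :> R by rewrite ltr0n.
(* With this T the change of sign of x_n - T occurs exactly at n = m. *)
pose T := lam * ln m%:R.
have hT : TT <= T.
  rewrite /T mulrC -ler_pdivrMr // -ler_expR lnK ?posrE //.
  by apply: le_trans (ltW (truncnS_gt _)) _; rewrite ler_nat.
have TT1 : T1 <= T by rewrite /TT in hT; lra.
have TT2 : T2 <= T by rewrite /TT in hT; lra.
have TT3 : T3 <= T by rewrite /TT in hT; lra.
have TTl : lam <= T by rewrite /TT in hT; lra.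
have T0 : 0 < T by lra.
have e0 : 0 < T^-1 by rewrite invr_gt0.
have [cH IH] := hT1 T TT1 TTl T0.
have K0 := hT3 T TT3.
pose x n : R := lam * ln n%:R.
(* [test_integrand_dist] multiplies this tolerance by 2 expR 1 * T <= 8 T, which leaves zeta /
   32. *)
have eta0 : 0 < zeta * T^-1 / 256.
  by have := mulr_gt0 zeta0 e0; lra.
have s0 : 0 < lam * T^-1 by rewrite mulr_gt0.
have [N0 hN0] := hF s0 eta0.
pose N := (N0 + m.+1)%N.
have mN : (m.+1 <= N)%N by rewrite leq_addl.
pose GN (z : C) := \sum_(0 <= n < N) c n * cexp (- (z * (x n)%:C)).
have GNE z : GN z = \sum_(0 <= n < N) c n * natcpow n (- (lam%:C * z)).
  apply: eq_bigr => n _; congr (_ * _); rewrite /natcpow /x; congr cexp.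
  by rewrite rmorphM /=; ring.
have dist s : nrm (GN (T^-1 +i* s) - F (lam%:C * (T^-1 +i* s))) <= zeta * T^-1 / 256.
  rewrite GNE; apply: hN0; first by rewrite leq_addr.
  by rewrite scale_line.
have Idist t : nrm (test_integrand GN A T^-1 T t - test_integrand (fun z => F (lam%:C * z)) A T^-1 T t) <= zeta / 32.
  apply: le_trans (test_integrand_dist A T t e0 dist) _.
  rewrite mulVf ?gt_eqF // (_ : expR 1 * (zeta * T^-1 / 256) / T^-1 = expR 1 * zeta / 256); last first.
    by field; rewrite gt_eqF.
  clear - hUC hLip c0 cM hF E4 zeta0; nra.
pose r n := Re (c n).
have kc n : continuous (kernel_integrand T^-1 (x n - T)) by exact: kernel_integrand_cont.
have kc' : continuous (kernel_integrand T^-1 (- T)) by exact: kernel_integrand_cont.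
have [cS IS] := itg_sum 0 pi r N kc.
have ReGN t : Re (test_integrand GN A T^-1 T t) =
  \sum_(0 <= n < N) r n * kernel_integrand T^-1 (x n - T) t - Re A * kernel_integrand T^-1 (- T) t.
  rewrite -kernel_sumE // ReD ReN Re_sum; congr (_ - _).
    by apply: eq_bigr => n _; rewrite ReM /= mulr0 subr0.
  by rewrite ReM /= mulr0 subr0.
have cA : continuous (fun t => Re A * kernel_integrand T^-1 (- T) t) by apply: cfM => //; exact: cfC.
have cG : continuous (fun t => \sum_(0 <= n < N) r n * kernel_integrand T^-1 (x n - T) t - Re A * kernel_integrand T^-1 (- T) t).
  by apply: cfD => //; exact: cfN.
pose K n := kernel T^-1 (x n - T).
pose P := kernel T^-1 (- T).
have big_eq : itg 0 pi (fun t => \sum_(0 <= n < N) r n * kernel_integrand T^-1 (x n - T) t - Re A * kernel_integrand T^-1 (- T) t)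
  = \sum_(0 <= n < N) r n * K n - Re A * P.
  by rewrite itgB // IS itgZ.
have total : `|\sum_(0 <= n < N) r n * K n - Re A * P| <= zeta / 4.
  rewrite -big_eq.
  have := ler_normD (itg 0 pi (fun t => \sum_(0 <= n < N) r n * kernel_integrand T^-1 (x n - T) t - Re A * kernel_integrand T^-1 (- T) t)
    - itg 0 pi (fun t => Re (test_integrand (fun z => F (lam%:C * z)) A T^-1 T t)))
    (itg 0 pi (fun t => Re (test_integrand (fun z => F (lam%:C * z)) A T^-1 T t))).
  rewrite subrK -itgB //.
  have := @itg_abs_le R 0 pi (fun t => (\sum_(0 <= n < N) r n * kernel_integrand T^-1 (x n - T) t - Re A * kernel_integrand T^-1 (- T) t) -
     Re (test_integrand (fun z => F (lam%:C * z)) A T^-1 T t)) (zeta / 32) (ltW pi0) _ _.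
  move=> /(_ _ _) h; have {}h := h _ _.
  have h1 : continuous (fun t => (\sum_(0 <= n < N) r n * kernel_integrand T^-1 (x n - T) t - Re A * kernel_integrand T^-1 (- T) t) -
     Re (test_integrand (fun z => F (lam%:C * z)) A T^-1 T t)) by apply: cfD => //; exact: cfN.
  have {}h := h h1.
  have h2 : forall t, 0 <= t <= pi -> `|(\sum_(0 <= n < N) r n * kernel_integrand T^-1 (x n - T) t - Re A * kernel_integrand T^-1 (- T) t) -
     Re (test_integrand (fun z => F (lam%:C * z)) A T^-1 T t)| <= zeta / 32.
    by move=> t _; rewrite -ReGN -ReN -ReD; apply: le_trans (Re_le_nrm _) (Idist t).
  have {}h := h h2.
  have pi_le4 : pi <= 4 :> R by clear - hUC hLip c0 cM hF pi4; lra.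
  have q1 : zeta / 32 * (pi - 0) <= zeta / 8 by rewrite subr0; have := ler_wpM2l (ltW zeta0) pi_le4; clear - hUC hLip c0 cM hF; lra.
  by move=> q2; clear - hUC hLip c0 cM hF q1 q2 h IH; lra.
pose b n : R := G * (1 + (x n - T) ^+ 2)^-1.
have b0 n : 0 <= b n by rewrite mulr_ge0 ?(ltW G0) // invr_ge0 addr_ge0 ?sqr_ge0.
have Gk (u : R) : 0 <= u -> G / (1 + u) ^+ 2 <= G * (1 + u ^+ 2)^-1.
  move=> u0; have h : 1 + u ^+ 2 <= (1 + u) ^+ 2.
    by rewrite (_ : (1 + u) ^+ 2 = 1 + u ^+ 2 + 2 * u); [clear - hUC hLip c0 cM hF u0; lra|ring].
  have p1 : 0 < 1 + u ^+ 2 by rewrite ltr_pwDl ?sqr_ge0.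
  by rewrite ler_pM2l // lef_pV2 // posrE; exact: lt_le_trans h.
have near n : (0 < n < m.+1)%N -> `|K n - P| <= b n.
  move=> /andP[n0 nm]; have nR : 1 <= n%:R :> R by rewrite ler1n.
  have u1 : - T <= x n - T by rewrite lerDr mulr_ge0 ?ln_ge0 // ltW.
  have u2 : x n - T <= 0.
    by rewrite subr_le0 ler_pM2l // ler_ln ?posrE ?ltr0n // ler_nat -ltnS.
  apply: le_trans (kernel_near_plateau T0 _) _; first by rewrite u1 u2.
  have u3 : 0 <= - (x n - T) by clear - hUC hLip c0 cM hF u2; lra.
  by apply: le_trans (Gk _ u3) _; rewrite sqrrN.
have far n : (m.+1 <= n)%N -> `|K n| <= b n.
  move=> mn; have n0 : (0 < n)%N by apply: leq_trans mn.
  have u2 : 0 <= x n - T.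
    by rewrite subr_ge0 ler_pM2l // ler_ln ?posrE ?ltr0n // ler_nat ltnW.
  apply: le_trans (kernel_decay e0 u2) _; apply: le_trans (Gk _ u2).
  by rewrite ler_pM2r ?invr_gt0 ?exprn_gt0 // /G; clear - hUC hLip c0 cM hF E1 u2; lra.
have rb n : (0 < n)%N -> `|r n| <= M / n%:R.
  by move=> n0; apply: le_trans (Re_le_nrm _) (cM n0).
(* At index 0 the convention ln 0 = 0 gives a spurious point x_0 = 0; the vanishing coefficient
   removes it. *)
have r0 : r 0%N = 0 by rewrite /r c0.
have split : \sum_(0 <= n < N) r n * K n - Re A * P =
   P * (\sum_(0 <= n < m.+1) r n - Re A) +
   (\sum_(0 <= n < m.+1) r n * (K n - P) + \sum_(m.+1 <= n < N) r n * K n).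
  rewrite (big_cat_nat (n := m.+1)) //=.
  rewrite (_ : \sum_(0 <= n < m.+1) r n * (K n - P) = \sum_(0 <= n < m.+1) r n * K n - (\sum_(0 <= n < m.+1) r n) * P).
    by ring.
  by rewrite mulr_suml -sumrB; apply: eq_bigr => n _; rewrite mulrBr.
have err : `|\sum_(0 <= n < m.+1) r n * (K n - P) + \sum_(m.+1 <= n < N) r n * K n| <= zeta / 8.
  apply: le_trans (ler_normD _ _) _.
  apply: le_trans (_ : \sum_(1 <= n < N) M / n%:R * b n <= _); last first.
    rewrite (_ : \sum_(1 <= n < N) _ = M * G * \sum_(1 <= n < N) (n%:R * (1 + (x n - T) ^+ 2))^-1).
      apply: le_trans lamE; rewrite ler_wpM2l ?mulr_ge0 ?(ltW G0) //.
      exact: hT2.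
    by rewrite mulr_sumr; apply: eq_bigr => n _; rewrite /b invfM; ring.
  rewrite (big_cat_nat (n := m.+1) (m := 1)) //=; apply: lerD.
    rewrite big_ltn // r0 mul0r add0r.
    apply: le_trans (ler_norm_sum _ _ _) _; apply: ler_sum_nat => n /andP[n1 nm].
    rewrite normrM; apply: ler_pM => //; first exact: rb.
    by apply: near; rewrite n1.
  apply: le_trans (ler_norm_sum _ _ _) _; apply: ler_sum_nat => n /andP[mn _].
  by rewrite normrM; apply: ler_pM => //; [apply: rb; exact: leq_trans mn|exact: far].
rewrite ReD ReN Re_sum -/(r _).
have PS : `|P * (\sum_(0 <= n < m.+1) r n - Re A)| <= zeta / 2.
  have := ler_normB (\sum_(0 <= n < N) r n * K n - Re A * P) (\sum_(0 <= n < m.+1) r n * (K n - P) + \sum_(m.+1 <= n < N) r n * K n).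
  rewrite split addrK -split => h; clear - hUC hLip c0 cM hF h total err zeta0; lra.
rewrite normrM in PS; have P0 : 1 / 2 <= `|P| by apply: le_trans (ler_norm _).
set S := `|_ - _| in PS *.
have P1 : 1 / 2 * S <= `|P| * S by rewrite ler_wpM2r ?normr_ge0.
by move: (le_trans P1 PS); clear - hUC hLip c0 cM hF; lra.
Qed.

End TauberianRealPart.

(** * The Tauberian theorem for complex coefficients *)

Section Tauberian.
Variable R : realType.
Local Notation C := R[i].
Local Notation Re := complex.Re.
Local Notation Im := complex.Im.

Lemma nrm_i : nrm ('i%C : C) = 1.
Proof. by rewrite nrmE /= expr0n expr1n add0r sqrtr1. Qed.

(** The kernel is real, so the real-part estimate is applied to F and to -iF; the hypotheses are
    invariant under multiplication by a number of modulus 1. *)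
Theorem tauberian (c : nat -> C) (M : R) (F : C -> C) (A : C) :
  c 0%N = 0 -> (forall n, (0 < n)%N -> nrm (c n) <= M / n%:R) ->
  strip_unif_cont F -> boundary_lipschitz F A ->
  (forall sigma eta : R, 0 < sigma -> 0 < eta -> exists N0 : nat, forall N, (N0 <= N)%N ->
    forall z : C, sigma <= Re z -> nrm (\sum_(0 <= n < N) c n * natcpow n (- z) - F z) <= eta) ->
  forall zeta : R, 0 < zeta -> exists m0 : nat, forall m, (m0 <= m)%N ->
    nrm (\sum_(0 <= n < m.+1) c n - A) <= zeta.
Proof.
move=> c0 cM hUC hLip hF zeta zeta0.
have z2 : 0 < zeta / 2 by rewrite divr_gt0.
have [m1 h1] := tauberian_Re hUC hLip c0 cM hF z2.
pose F' z := - 'i%C * F z.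
have nI (z : C) : nrm (- 'i%C * z) = nrm z by rewrite nrmM nrmN nrm_i mul1r.
have hUC' : strip_unif_cont F'.
  move=> La e e0; have [d d0 hd] := hUC La e e0; exists d => // z w h2 h3 h4 h5 h6.
  by rewrite /F' -mulrBr nI; exact: hd.
have hLip' : boundary_lipschitz F' (- 'i%C * A).
  move=> La; have [K hK] := hLip La; exists K => z h2 h3.
  by rewrite /F' -mulrBr nI; exact: hK.
have c0' : - 'i%C * c 0%N = 0 by rewrite c0 mulr0.
have cM' n : (0 < n)%N -> nrm (- 'i%C * c n) <= M / n%:R by move=> n0; rewrite nI; exact: cM.
have hF' (sigma eta : R) : 0 < sigma -> 0 < eta -> exists N0 : nat, forall N, (N0 <= N)%N ->
    forall z : C, sigma <= Re z -> nrm (\sum_(0 <= n < N) - 'i%C * c n * natcpow n (- z) - F' z) <= eta.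
  move=> s0 e0; have [N0 hN] := hF sigma eta s0 e0; exists N0 => N NN z hz.
  have -> : \sum_(0 <= n < N) - 'i%C * c n * natcpow n (- z) - F' z =
     - 'i%C * (\sum_(0 <= n < N) c n * natcpow n (- z) - F z).
    by rewrite mulrBr mulr_sumr; congr (_ - _); apply: eq_bigr => n _; rewrite mulrA.
  by rewrite nI; exact: hN.
have [m2 h2] := @tauberian_Re R F' (- 'i%C * A) hUC' hLip' (fun n => - 'i%C * c n) M c0' cM' hF' _ z2.
exists (maxn m1 m2) => m; rewrite geq_max => /andP[mm1 mm2].
apply: le_trans (nrm_le _) _.
have := h1 m mm1; have := h2 m mm2.
rewrite -mulr_sumr -mulrBr ReM ReN ImN /= oppr0 mul0r mulN1r opprK add0r; lra.
Qed.

End Tauberian.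

(** * Prime ideals of a given norm *)

Section PrimeIdeals.
Variable K : fieldExtType rat.
Local Notation O := (ring_of_integers K).
Local Notation n := (\dim {:K})%VS.

Lemma int_dependence (m : nat) (s : 'I_m -> K) : (n < m)%N ->
  exists2 c : 'I_m -> int, \sum_i s i *~ c i = 0 & exists i, c i != 0.
Proof.
move=> nm; pose X := [tuple s i | i < m].
have /freeP nf : ~~ free X.
  apply/negP; rewrite /free => /eqP h.
  by have := dimvS (subvf <<X>>); rewrite h size_tuple leqNgt nm.
have [k hk] : exists k : 'I_m -> rat, ~ (\sum_(i < m) k i *: X`_i = 0 -> forall i, k i = 0).
  by apply/existsNP.
have [sk /existsNP[i0 /eqP ki0]] := (not_implyP _ _).1 hk.
pose D := \prod_j denq (k j).
pose c i := numq (k i) * \prod_(j | j != i) denq (k j).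
have cE i : (c i)%:~R = D%:~R * k i.
  rewrite /D (bigD1 i) //= rmorphM /= /c rmorphM /= mulrAC; congr (_ * _).
  by rewrite mulrC -{2}(divq_num_den (k i)) divfK // intr_eq0 denq_eq0.
exists c.
  rewrite (eq_bigr (fun i => D%:~R *: (k i *: X`_i))).
    by rewrite -scaler_sumr sk scaler0.
  by move=> i _; rewrite scalerA -cE scaler_int -tnth_nth tnth_mktuple.
exists i0; rewrite -(intr_eq0 rat) cE mulf_neq0 // intr_eq0.
by apply/prodf_neq0 => j _; rewrite denq_eq0.
Qed.

(* A relation that is primitive at p; it bounds the dimension of O / pO by
   [K : Q] without an integral basis. *)
Lemma int_dependence_mod (p m : nat) (s : 'I_m -> O) : prime p -> (n < m)%N ->
  exists2 c : 'I_m -> int, \sum_i s i *~ c i = 0 & exists i, ~~ (p%:Z %| c i)%Z.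
Proof.
move=> pp nm; have [c0 hc0 [i0 ci0]] := int_dependence (fun i => \val (s i)) nm.
have p0 : p%:Z != 0 by rewrite -lt0n prime_gt0.
(* Descent: while p divides every coefficient, dividing by p keeps the relation and strictly lowers
   the sum of absolute values. *)
have main : forall N (c : 'I_m -> int), (\sum_i `|c i| <= N)%N -> \sum_i \val (s i) *~ c i = 0 ->
   (exists i, c i != 0) ->
   exists2 c : 'I_m -> int, \sum_i \val (s i) *~ c i = 0 & exists i, ~~ (p%:Z %| c i)%Z.
  elim=> [|N IH] c hN hc [i ci].
    move: hN; rewrite leqn0 sum_nat_eq0 => /forallP /(_ i) /=.
    by rewrite absz_eq0 (negbTE ci).
  have [h|/existsNP[j /negP hj]] := pselect (forall j, p%:Z %| c j)%Z; last by exists c => //; exists j.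
  pose d j := (c j %/ p%:Z)%Z.
  have cd j : c j = d j * p%:Z by rewrite /d divzK.
  apply: (IH d); last by exists i; apply: contraNneq ci => d0; rewrite cd d0 mul0r.
    rewrite -ltnS; apply: leq_trans hN.
    have lej j : (`|d j| <= `|c j|)%N.
      by rewrite (cd j) abszM leq_pmulr // prime_gt0.
    rewrite (bigD1 i) //= [X in (_ < X)%N](bigD1 i) //= -addSn; apply: leq_add; last exact: leq_sum.
    rewrite (cd i) abszM absz_nat ltn_Pmulr ?prime_gt1 // absz_gt0.
    by apply: contraNneq ci => d0; rewrite cd d0 mul0r.
  have : (\sum_j \val (s j) *~ d j) *~ p%:Z = 0.
    by rewrite mulrz_suml -[RHS]hc; apply: eq_bigr => j _; rewrite cd mulrzA.
  by move/eqP; rewrite -scaler_int scaler_eq0 intr_eq0 (negbTE p0) /= => /eqP.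
have [c hc hi] := main _ c0 (leqnn _) hc0 (ex_intro _ i0 ci0).
exists c => //; apply: val_inj; rewrite raddf_sum -[RHS]hc.
by apply: eq_bigr => i _; exact: raddfMz.
Qed.

Section OnePrime.
Variable P : nonzero_prime K.
Local Notation "x \inP" := (x \in prime_set P) (at level 70).

Lemma pr0 : 0 \inP. Proof. by have [] := prime_set_ideal P. Qed.
Lemma pr1 : (1 \in prime_set P) = false.
Proof. by have [_ /negbTE] := prime_set_ideal P. Qed.
Lemma prDM a u v : u \inP -> v \inP -> a * u + v \inP.
Proof. by have [_ _] := prime_set_ideal P; apply. Qed.
Lemma prM a u : u \inP -> a * u \inP.
Proof. by move=> h; rewrite -[_ * _]addr0; apply: prDM => //; exact: pr0. Qed.
Lemma prD u v : u \inP -> v \inP -> u + v \inP.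
Proof. by move=> h1 h2; rewrite -[u]mul1r; apply: prDM. Qed.
Lemma prN u : u \inP -> - u \inP.
Proof. by move=> h; rewrite -mulN1r; apply: prM. Qed.
Lemma prMz u (a : int) : u \inP -> u *~ a \inP.
Proof. by move=> h; rewrite -mulrzl; apply: prM. Qed.
Lemma prP u v : u * v \inP -> u \inP \/ v \inP.
Proof. by move=> /(prime_set_prime) /orP. Qed.
Lemma pr_sum (I : Type) (r : seq I) (Q : pred I) (f : I -> O) :
  (forall i, Q i -> f i \inP) -> \sum_(i <- r | Q i) f i \inP.
Proof. by move=> h; elim/big_ind: _ => //; [exact: pr0|exact: prD]. Qed.

(** If q(0) = 0, cancel a factor X, which is legitimate since x != 0 in a domain. Otherwise q(0) is
    a multiple of x up to sign. *)
Lemma poly_root_int_in_prime (x : O) (q : {poly int}) : x \inP -> x != 0 -> q != 0 ->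
  (map_poly (intr : int -> O) q).[x] = 0 -> exists2 m : int, m != 0 & m%:~R \inP.
Proof.
move=> xP x0.
have [N] := ubnP (size q); elim: N q => // N IH q sq q0 hq.
have [r e] : exists r, q = r * 'X + (q`_0)%:P.
  by exists (\poly_(i < (size q).-1) q`_i.+1); apply/polyP => i; rewrite coefD coefMX coefC coef_poly;
   case: i => [|i] /=; rewrite ?add0r ?addr0 //; case: ltnP => // h; rewrite nth_default //; lia.
have [c0|c0] := eqVneq q`_0 0.
  rewrite c0 addr0 in e; have r0 : r != 0 by apply: contraNneq q0 => r0; rewrite e r0 mul0r.
  apply: (IH r) => //.
    by move: sq; rewrite e size_mulX.
  move: hq; rewrite e rmorphM /= map_polyX hornerMX => h.
  have : \val (map_poly intr r).[x] * \val x = 0 by rewrite -rmorphM h rmorph0.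
  have vx : \val x != 0 by apply: contraNneq x0 => vx0; apply/eqP/val_inj; rewrite rmorph0.
  by move/eqP; rewrite mulf_eq0 (negbTE vx) orbF => /eqP v0; apply: val_inj; rewrite v0 rmorph0.
exists q`_0; first exact: c0.
rewrite e rmorphD rmorphM /= map_polyX map_polyC /= hornerD hornerMX hornerC in hq.
move/eqP: hq; rewrite addrC addr_eq0 => /eqP h.
have -> : ((q`_0)%:~R : O) = - ((map_poly intr r).[x] * x) := h.
by apply: prN; apply: prM.
Qed.

Lemma int_in_prime : exists2 m : int, m != 0 & m%:~R \inP.
Proof.
have [x [xP x0]] := prime_set_nonzero P.
have : \val x \in @algebraic_integer K := valP x.
move/asboolP => [q qm qr].
apply: (@poly_root_int_in_prime x q) => //; first exact: monic_neq0.
apply: val_inj; move: qr => /rootP; rewrite [\val 0]rmorph0 => <-.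
rewrite -horner_map; congr (_.[_]); apply/polyP => i.
rewrite [LHS]coef_map !coef_map_id0; [|by []..].
exact: (rmorph_int (\val : O -> K)).
Qed.

(** Split off the smallest prime factor of a positive integer in P: either it lies in P, or the
    smaller cofactor does. The descent cannot reach 1, because P is proper. *)
Lemma prime_in_prime : exists2 p : nat, prime p & p%:R \inP.
Proof.
have [m m0 mP] := int_in_prime.
have : (`|m|%N%:R : O) \inP.
  have [e|e] : m = `|m|%N :> int \/ m = - (`|m|%N : int) by case: (m) => k /=; [left|right].
    by move: mP; rewrite {1}e.
  by move/prN: mP; rewrite {1}e rmorphN /= opprK.
have : (0 < `|m|)%N by rewrite absz_gt0.
move: `|m|%N => k; have [N] := ubnP k; elim: N k => // N IH k kN k0 kP.
have [k1|k1] := leqP k 1; first by move: kP; rewrite (_ : k = 1%N) ?pr1 //; apply/eqP; rewrite eqn_leq k1.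
have dk := pdiv_dvd k; move: kP; rewrite -{1}(divnK dk) natrM => /prP[]; last first.
  by exists (pdiv k) => //; exact: pdiv_prime.
apply: IH; last by rewrite divn_gt0 ?pdiv_gt0 // dvdn_leq.
by rewrite -ltnS (leq_trans _ kN) // ltnS ltn_Pdiv // prime_gt1 // pdiv_prime.
Qed.

Lemma int_in_primeE (p : nat) (a : int) : prime p -> p%:R \inP ->
  ((a%:~R : O) \in prime_set P) = (p%:Z %| a)%Z.
Proof.
move=> pp pP; apply/idP/idP => [aP|/dvdzP[b ->]]; last first.
  by rewrite rmorphM /=; apply: prM.
apply: contraT => h.
have cop : coprimez p%:Z a by rewrite coprimezE prime_coprime.
have /eqP := cop; have [u v e _] := egcdzP p%:Z a; rewrite -e => /(congr1 (fun z : int => z%:~R : O)).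
rewrite rmorphD !rmorphM /= => e1.
have : (1%:~R : O) \inP by rewrite -e1; apply: prD; apply: prM.
by rewrite pr1.
Qed.

Lemma int_inv_mod (p : nat) (a : int) : prime p -> ~~ (p%:Z %| a)%Z ->
  exists u v : int, u * a + v * p%:Z = 1.
Proof.
move=> pp h; have cop : coprimez a p%:Z by rewrite coprimez_sym coprimezE prime_coprime.
by have [u v e _] := egcdzP a p%:Z; exists u, v; rewrite e; apply/eqP.
Qed.

(** This is maximality of P. Take an integer relation among 1, a, ..., a^n and its first coefficient
    c_i prime to p. The earlier terms lie in P, so a^i (c_i + a b) does too; cancel a^i, then invert
    c_i modulo p. *)
Lemma prime_inv (p : nat) (a : O) : prime p -> p%:R \inP -> a \in prime_set P = false ->
  exists b : O, 1 - a * b \inP.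
Proof.
move=> pp pP aP.
have [c hc [i0 hi0]] := int_dependence_mod (fun i : 'I_n.+1 => a ^+ i) pp (ltnSn n).
have [i hi imin] := @arg_minnP _ i0 (fun i => ~~ (p%:Z %| c i)%Z) (fun i => i : nat) hi0.
pose b := \sum_(j < n.+1 | (i < j)%N) a ^+ (j - i.+1) *~ c j.
have h : a ^+ i * ((c i)%:~R + a * b) \inP.
  pose S := \sum_(j < n.+1 | (j < i)%N) a ^+ j *~ c j.
  have e0 : \sum_(j < n.+1) a ^+ j *~ c j = a ^+ i *~ c i + (S + a ^+ i.+1 * b).
    rewrite (bigD1 i) //=; congr (_ + _).
    rewrite (bigID (fun j : 'I_n.+1 => (j < i)%N)) /=; congr (_ + _).
      by apply: eq_bigl => j; rewrite -val_eqE /=; case: ltngtP.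
    rewrite /b mulr_sumr; apply: eq_big => [j|j ij]; first by rewrite -val_eqE /=; case: ltngtP.
    rewrite mulrzAr -exprD subnKC //.
    by move: ij; rewrite -val_eqE /=; case: ltngtP.
  have e : a ^+ i * ((c i)%:~R + a * b) = - S.
    have hS : a ^+ i *~ c i + (S + a ^+ i.+1 * b) = 0 by rewrite -e0.
    apply/eqP; rewrite -addr_eq0; apply/eqP; rewrite -[RHS]hS -[a ^+ i *~ c i]mulrzr exprS.
    by move: (a ^+ i) ((c i)%:~R) => q w; ring.
  rewrite e; apply: prN; apply: pr_sum => j ji; rewrite -mulrzr; apply: prM.
  rewrite (int_in_primeE _ pp pP); apply: contraT => hj; have := imin j hj.
  by rewrite leqNgt ji.
have ai k : a ^+ k \in prime_set P = false.
  elim: k => [|k IH]; first exact: pr1.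
  by apply/negP => /= ak; move: ak; rewrite exprS => /prP[]; rewrite ?aP ?IH.
have {}h : (c i)%:~R + a * b \inP by have [] := prP h; rewrite ?ai.
have [u [v e]] := int_inv_mod pp hi.
exists (- u%:~R * b).
have -> : 1 - a * (- u%:~R * b) = u%:~R * ((c i)%:~R + a * b) + v%:~R * p%:R.
  have e' : u%:~R * (c i)%:~R + v%:~R * p%:R = 1 :> O.
    by have := congr1 (fun z : int => z%:~R : O) e; rewrite rmorphD !rmorphM.
  by rewrite -[X in X - _]e'; ring.
by apply: prD; apply: prM.
Qed.

End OnePrime.

Lemma nonzero_prime_eq (P Q : nonzero_prime K) : prime_set P = prime_set Q -> P = Q.
Proof.
case: P => f1 a1 b1 c1; case: Q => f2 a2 b2 c2 /= e; subst f2.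
by congr NonzeroPrime; exact: Prop_irrelevance.
Qed.

(** If Q were contained in P, an element of P outside Q would be invertible modulo Q, and 1 would
    lie in P. *)
Lemma prime_separation (p : nat) (P Q : nonzero_prime K) : prime p ->
  p%:R \in prime_set P -> p%:R \in prime_set Q -> P != Q ->
  exists y : O, y \in prime_set Q /\ y \in prime_set P = false.
Proof.
move=> pp pP pQ PQ; apply: contrapT => hn.
have sub y : y \in prime_set Q -> y \in prime_set P.
  by move=> yQ; apply: contrapT => /negP/negbTE yP; apply: hn; exists y.
case/eqP: PQ; apply: nonzero_prime_eq; apply/funext => a; apply/idP/idP => h; last exact: sub.
apply: contraT => /negbTE aQ; have [b hb] := prime_inv pp pQ aQ.
have := prD (sub _ hb) (prM b h); rewrite mulrC subrK.
by rewrite pr1.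
Qed.

(** As in the Chinese remainder theorem, the product e_i of separating elements lies in every P_j
    with j != i but not in P_i. A relation among the e_i, read modulo P_i, forces p to divide its
    i-th coefficient, so more than n of them contradict [int_dependence_mod]. *)
Lemma primes_above_le (p : nat) (s : seq (nonzero_prime K)) : prime p -> uniq s ->
  (forall P, P \in s -> p%:R \in prime_set P) -> (size s <= n)%N.
Proof.
move=> pp us hs; rewrite leqNgt; apply/negP => ns.
pose m := size s; pose PP (i : 'I_m) := tnth (in_tuple s) i.
have PPp i : p%:R \in prime_set (PP i) by apply: hs; exact: mem_tnth.
have PPi i j : i != j -> PP i != PP j.
  by move=> ij; rewrite /PP !(tnth_nth (PP i)) /= nth_uniq.
have [y hy] : exists y : 'I_m -> 'I_m -> O, forall i j, i != j ->
    y i j \in prime_set (PP j) /\ y i j \in prime_set (PP i) = false.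
  have h (ij : 'I_m * 'I_m) : exists y : O, ij.1 != ij.2 -> y \in prime_set (PP ij.2) /\ y \in prime_set (PP ij.1) = false.
    have [->|ne] := eqVneq ij.1 ij.2; first by exists 0.
    by have [y hy] := prime_separation pp (PPp ij.1) (PPp ij.2) (PPi _ _ ne); exists y.
  have [y hy] := choice h; exists (fun i j => y (i, j)) => i j ij; exact: (hy (i, j)).
pose e i := \prod_(j | j != i) y i j.
have e1 i j : i != j -> e i \in prime_set (PP j).
  move=> ij; rewrite /e (bigD1 j) /=; last by rewrite eq_sym.
  by rewrite mulrC; apply: prM; have [] := hy i j ij.
have e2 i : e i \in prime_set (PP i) = false.
  rewrite /e; elim/big_rec: _ => [|j x ji IH]; first exact: pr1.
  by apply/negP => /prP[]; rewrite ?IH //; have [_ ->] := hy i j (contra_neq esym ji).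
have [c hc [i /negP hi]] := int_dependence_mod e pp ns.
apply: hi; rewrite -(int_in_primeE (P := PP i)) //.
have h : (c i)%:~R * e i \in prime_set (PP i).
  rewrite mulrzl; move: hc; rewrite (bigD1 i) //= => /eqP; rewrite addr_eq0 => /eqP ->.
  by apply: prN; apply: pr_sum => j ji; apply: prMz; exact: e1.
by have [] := prP h; rewrite ?e2.
Qed.

End PrimeIdeals.

(** * The absolute norm as a power of the residue characteristic *)

Section AbsoluteNorm.
Local Open Scope quotient_scope.
Variable K : fieldExtType rat.
Local Notation O := (ring_of_integers K).
Local Notation n := (\dim {:K})%VS.

Section Residue.
Variables (P : nonzero_prime K) (p : nat).
Hypotheses (pp : prime p) (pP : p%:R \in prime_set P).

(** Linear independence over F_p of the residues in O / P, expressed with integer coefficients so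
    that the quotient needs no vector space structure. *)
Definition indep_mod (m : nat) (s : 'I_m -> O) := forall c : 'I_m -> int,
  \sum_i s i *~ c i \in prime_set P -> forall i, (p%:Z %| c i)%Z.

Lemma indep_mod_size m (s : 'I_m -> O) : indep_mod s -> (m <= n)%N.
Proof.
move=> hs; rewrite leqNgt; apply/negP => nm.
have [c hc [i hi]] := int_dependence_mod s pp nm.
by move/negP: hi; apply; apply: hs; rewrite hc; exact: pr0.
Qed.

(** Independent families have at most n members, so a largest one exists; being maximal, it spans O
    / P. *)
Lemma indep_mod_max : exists m (s : 'I_m -> O), indep_mod s /\
  forall x : O, exists f : {ffun 'I_m -> 'I_p}, x - \sum_i s i *+ f i \in prime_set P.
Proof.
pose ok m := `[< exists s : 'I_m -> O, indep_mod s >].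
have ex : exists m, ok m by exists 0%N; apply/asboolP; exists (fun=> 0) => c _ [].
have bd m : ok m -> (m <= n)%N by move=> /asboolP[s]; exact: indep_mod_size.
have [m /asboolP[s hs] mmax] := ex_maxnP ex bd.
exists m, s; split => // x.
have [c hc hn] : exists2 c : 'I_m.+1 -> int,
    \sum_i (if unlift ord0 i is Some j then s j else x) *~ c i \in prime_set P &
    ~ forall i, (p%:Z %| c i)%Z.
  apply: contrapT => hno.
  have : ok m.+1.
    apply/asboolP; exists (fun i => if unlift ord0 i is Some j then s j else x) => c hc.
    by apply: contrapT => hn; apply: hno; exists c.
  by move/mmax; rewrite ltnn.
move: hc; rewrite big_ord_recl unlift_none.
under eq_bigr do rewrite liftK.
move=> hc.
(* Otherwise the term of x lies in P, and independence of s makes p divide the remaining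
   coefficients as well. *)
have c0 : ~~ (p%:Z %| c ord0)%Z.
  apply/negP => h0; apply: hn => i.
  have xP : x *~ c ord0 \in prime_set P.
    by rewrite -mulrzr; apply: prM; rewrite (int_in_primeE _ pp pP).
  have := prD (prN xP) hc; rewrite addKr => /hs h.
  by have [j|] := unliftP ord0 i => [->|->].
have [u [v e]] := int_inv_mod pp c0.
(* Solving the relation for x modulo P, with u an inverse of its coefficient modulo p; the digits
   are the residues of b i. *)
pose b i : int := - u * c (lift ord0 i).
have pz : p%:Z != 0 by rewrite -lt0n prime_gt0.
have bp i : (`|(b i %% p%:Z)%Z| < p)%N.
  have := ltz_pmod (b i) (d := p%:Z); rewrite ltz_nat prime_gt0 // => /(_ isT).
  by rewrite -{1}(gez0_abs (modz_ge0 (b i) pz)) ltz_nat.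
exists [ffun i => Ordinal (bp i)].
have e' : u%:~R * (c ord0)%:~R + v%:~R * p%:R = 1 :> O.
  by have := congr1 (fun z : int => z%:~R : O) e; rewrite rmorphD !rmorphM.
pose q i := (b i %/ p%:Z)%Z.
have be i : (b i)%:~R = (q i)%:~R * p%:R + `|(b i %% p%:Z)%Z|%N%:R :> O.
  rewrite {1}(divz_eq (b i) p%:Z) rmorphD rmorphM /=; congr (_ + _).
  by rewrite -{1}(gez0_abs (modz_ge0 (b i) pz)).
have -> : x - \sum_i s i *+ [ffun i => Ordinal (bp i)] i =
  u%:~R * (x *~ c ord0 + \sum_(i < m) s i *~ c (lift ord0 i)) + (v%:~R * x + \sum_i s i * (q i)%:~R) * p%:R.
  have sE : \sum_i s i *+ [ffun i => Ordinal (bp i)] i =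
    - (u%:~R * \sum_(i < m) s i *~ c (lift ord0 i)) - (\sum_i s i * (q i)%:~R) * p%:R.
    rewrite mulr_sumr mulr_suml -sumrN -sumrB; apply: eq_bigr => i _.
    rewrite ffunE /= -[LHS]mulr_natr.
    have -> : `|(b i %% p%:Z)%Z|%N%:R = (b i)%:~R - (q i)%:~R * p%:R :> O by rewrite be addrC addKr.
    by rewrite /b rmorphM rmorphN /= -[s i *~ _]mulrzr; ring.
  have xE : x = (u%:~R * (c ord0)%:~R + v%:~R * p%:R) * x by rewrite e' mul1r.
  by rewrite sE -[x *~ _]mulrzr {1}xE; ring.
by apply: prD; apply: prM.
Qed.

(** Combinations of a maximal independent family with digits below p represent each residue class
    exactly once. *)
Lemma abs_norm_pow : exists2 m, (0 < m)%N & abs_norm P = (p ^ m)%N.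
Proof.
have [m [s [hs surj]]] := indep_mod_max.
pose Q := {ideal_quot (prime_set P : idealr O)}.
have piE (x y : O) : (\pi_Q x = \pi_Q y) <-> (x - y \in prime_set P).
  split => [h|h].
    by rewrite (Quotient.idealrBE (prime_set P : idealr O)) h.
  by apply/eqP; rewrite -(Quotient.idealrBE (prime_set P : idealr O)).
pose f (g : {ffun 'I_m -> 'I_p}) : Q := \pi_Q (\sum_i s i *+ g i).
have fsurj (y : Q) : exists g, y = f g.
  have [g hg] := surj (repr y); exists g.
  by rewrite -[y]reprK; apply/piE.
have finj : injective f.
  move=> g h /piE; rewrite -sumrB => e; apply/ffunP => i; apply: val_inj => /=.
  have := hs (fun i => (g i : nat)%:Z - (h i : nat)%:Z).
  rewrite (eq_bigr (fun i => s i *+ g i - s i *+ h i)); last first.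
    by move=> j _; rewrite mulrzBr.
  move=> /(_ e i); rewrite -eqz_mod_dvd => /eqP.
  by rewrite !modz_small ?ltz_nat ?ltn_ord // => -[].
exists m.
  (* An empty spanning family would put 1 in P. *)
  case: m s hs surj f fsurj finj {piE} => // s hs surj f fsurj finj.
  have [g] := surj 1; rewrite big_ord0 subr0.
  by rewrite pr1.
have fin : finite_set [set: Q].
  have -> : [set: Q] = f @` [set: {ffun 'I_m -> 'I_p}].
    by apply/seteqP; split => y // _; have [g ->] := fsurj y; exists g.
  exact: finite_image.
rewrite /abs_norm -/Q.
have -> : fset_set [set: Q] = [fset f g | g in [set: {ffun 'I_m -> 'I_p}]%SET]%fset.
  apply/fsetP => y; rewrite in_fset_set // mem_set //; apply/esym/imfsetP.
  by have [g ->] := fsurj y; exists g => //; exact: finset.in_setT.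
rewrite card_imfset //= -cardE cardsT card_ffun !card_ord //.
Qed.

End Residue.

Lemma abs_norm_gt1 (P : nonzero_prime K) : (1 < abs_norm P)%N.
Proof.
have [p pp pP] := prime_in_prime P; have [m m0 ->] := abs_norm_pow pp pP.
by rewrite -{1}(exp1n m) ltn_exp2r // prime_gt1.
Qed.

(** Being a power of the prime below P, the norm determines that prime; thus all members of s lie
    above the same p. *)
Lemma norm_fiber_le (k : nat) (s : seq (nonzero_prime K)) : uniq s ->
  (forall P, P \in s -> abs_norm P = k) -> (size s <= n)%N.
Proof.
case: s => [//|P0 s0] us hs; set s := P0 :: s0 in us hs *.
have [p pp pP] := prime_in_prime P0; have [m m0 h0] := abs_norm_pow pp pP.
apply: (primes_above_le pp us) => P Ps.
have [q pq qP] := prime_in_prime P; have [j j0 hj] := abs_norm_pow pq qP.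
have e : (q ^ j = p ^ m)%N by rewrite -hj -h0 !hs // mem_head.
have : (p %| q ^ j)%N by rewrite e dvdn_exp.
by rewrite Euclid_dvdX // => /andP[+ _]; rewrite dvdn_prime2 // => /eqP ->.
Qed.

(** The lengths of duplicate-free lists of primes of norm k are bounded, and a longest list misses
    none. *)
Lemma norm_fiber_exists (k : nat) : exists s : seq (nonzero_prime K),
  [/\ uniq s, (size s <= n)%N & forall P, (P \in s) = (abs_norm P == k)].
Proof.
pose ok m := `[< exists s : seq (nonzero_prime K), [/\ uniq s, size s = m & forall P, P \in s -> abs_norm P = k] >].
have ex : exists m, ok m by exists 0%N; apply/asboolP; exists [::].
have bd m : ok m -> (m <= n)%N by move=> /asboolP[s [us <- hs]]; exact: norm_fiber_le hs.
have [m /asboolP[s [us sm hs]] mmax] := ex_maxnP ex bd.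
exists s; split => //; first exact: norm_fiber_le hs.
move=> P; apply/idP/eqP => [|hP]; first exact: hs.
apply: contraT => Ps.
have : ok m.+1.
  apply/asboolP; exists (P :: s); split => /=; rewrite ?Ps ?us ?sm //.
  by move=> Q; rewrite inE => /orP[/eqP ->|/hs].
by move/mmax; rewrite ltnn.
Qed.

End AbsoluteNorm.

(** * Logarithms and absolutely convergent series *)

Section LogSeries.
Variable R : realType.
Local Notation C := R[i].
Local Notation Re := complex.Re.
Local Notation Im := complex.Im.

(* The principal value of - log (1 - z) for |z| < 1. *)
Definition ell (z : C) : C :=
  (- ln (nrm (1 - z))) +i* (- atan (Im (1 - z) / Re (1 - z))).

Lemma ell0 : ell 0 = 0.
Proof.
by rewrite /ell subr0 nrm1 ln1 /= mul0r atan0 oppr0.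
Qed.

Lemma Re_1B_ge (z : C) : nrm z <= 1 / 2 -> 1 / 2 <= Re (1 - z).
Proof. by move=> h; rewrite ReD ReN /=; have := nrm_ge_Re z; lra. Qed.

Lemma nrm_1B_ge (z : C) : nrm z <= 1 / 2 -> 1 / 2 <= nrm (1 - z).
Proof. by move=> h; apply: le_trans (Re_1B_ge h) (nrm_ge_Re _). Qed.

Lemma cexp_ell (z : C) : nrm z <= 1 / 2 -> cexp (ell z) = (1 - z)^-1.
Proof.
move=> h; have x0 := Re_1B_ge h; have n0 := nrm_1B_ge h.
rewrite -[ell z]opprK cexpN; congr (_^-1).
set w := 1 - z in x0 n0 *; set x := Re w in x0; set y := Im w.
have sq : Num.sqrt (1 + (y / x) ^+ 2) = nrm w / x.
  rewrite nrmE -/x -/y (_ : 1 + _ = (x ^+ 2 + y ^+ 2) / x ^+ 2); last by field; rewrite gt_eqF; lra.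
  rewrite sqrtrM ?addr_ge0 ?sqr_ge0 // sqrtrV ?sqr_ge0 // sqrtr_sqr ger0_norm //; lra.
have ca : cos (atan (y / x)) = x / nrm w by rewrite cos_atan sq invf_div.
have cn0 : cos (atan (y / x)) != 0 by rewrite ca mulf_neq0 ?invr_eq0 // gt_eqF //; lra.
have sa : sin (atan (y / x)) = y / nrm w.
  have := atanK (y / x); rewrite /tan ca => /(canRL (divfK _)) ->; last by rewrite -ca.
  by field; rewrite !gt_eqF //; lra.
have el : expR (ln (nrm w)) = nrm w by rewrite lnK // posrE; lra.
apply: complexP; rewrite /cexp /ell -/w -/x -/y /= !opprK el ?ca ?sa mulrCA divff ?mulr1 // gt_eqF //; lra.
Qed.

Lemma atan_lip (s t : R) : `|atan s - atan t| <= `|s - t|.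
Proof.
have h (a b : R) : a <= b -> `|atan b - atan a| <= b - a.
  move=> ab.
  have := @le_increment_of_derive R (@atan R) (fun t => t) (fun t => (1 + t ^+ 2)^-1) (fun=> 1) a b ab
   (fun t _ => der_atan t) (fun t _ => der_id t).
  apply => t0 _; rewrite ger0_norm ?invr_ge0 ?addr_ge0 ?sqr_ge0 // invf_le1 ?ltr_pwDl ?sqr_ge0 //.
  by rewrite lerDl sqr_ge0.
have [st|ts] := leP s t.
  by rewrite distrC (distrC s) [X in _ <= X]ger0_norm ?subr_ge0 // h.
by rewrite [X in _ <= X]ger0_norm ?subr_ge0 ?h ?(ltW ts).
Qed.

Lemma ln_lip (a b : R) : 1 / 2 <= a -> 1 / 2 <= b -> `|ln a - ln b| <= 2 * `|a - b|.
Proof.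
have key (u v : R) : 1 / 2 <= u -> 1 / 2 <= v -> ln u - ln v <= 2 * `|u - v|.
  move=> hu hv; rewrite -ln_div ?posrE; try lra.
  have -> : u / v = 1 + (u - v) / v by field; rewrite gt_eqF //; lra.
  apply: le_trans (le_ln1Dx _) _.
    by rewrite (_ : (u - v) / v = u / v - 1) ?ltrDr ?divr_gt0 //; try lra; field; rewrite gt_eqF //; lra.
  rewrite ler_pdivrMr; last lra.
  by have := ler_norm (u - v); have := normr_ge0 (u - v); nra.
move=> ha hb; rewrite ler_norml; have := key a b ha hb; have := key b a hb ha.
by rewrite (distrC b); lra.
Qed.

Lemma ell_lip (z w : C) : nrm z <= 1 / 2 -> nrm w <= 1 / 2 -> nrm (ell z - ell w) <= 6 * nrm (z - w).
Proof.
move=> hz hw.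
have [x1 x2] := (Re_1B_ge hz, Re_1B_ge hw); have [n1 n2] := (nrm_1B_ge hz, nrm_1B_ge hw).
apply: le_trans (nrm_le _) _; rewrite ReD ImD ReN ImN /= !opprK !(addrC (- _)).
have d : (1 - w) - (1 - z) = z - w by ring.
have b1 : `|ln (nrm (1 - w)) - ln (nrm (1 - z))| <= 2 * nrm (z - w).
  by apply: le_trans (ln_lip n2 n1) _; rewrite ler_pM2l // -d nrm_dist.
have b2 : `|atan (Im (1 - w) / Re (1 - w)) - atan (Im (1 - z) / Re (1 - z))| <= 4 * nrm (z - w).
  apply: le_trans (atan_lip _ _) _.
  set x := Re (1 - w) in x2 *; set y := Im (1 - w); set x' := Re (1 - z) in x1 *; set y' := Im (1 - z).
  have yb : `|y'| <= 1 / 2.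
    by rewrite /y' ImD ImN add0r normrN; apply: le_trans (Im_le_nrm _) hz.
  have -> : y / x - y' / x' = (y - y') / x - y' * (x - x') / (x * x').
    by field; rewrite !gt_eqF //; lra.
  have e1 : `|y - y'| <= nrm (z - w) by rewrite -d -ImN -ImD Im_le_nrm.
  have e2 : `|x - x'| <= nrm (z - w) by rewrite -d -ReN -ReD Re_le_nrm.
  have xx0 : 1 / 4 <= x * x' by nra.
  have x0 : 0 < x by lra.
  apply: le_trans (ler_normB _ _) _.
  have f1 : `|(y - y') / x| <= 2 * nrm (z - w).
    rewrite normrM normfV (gtr0_norm x0) ler_pdivrMr //.
    by have := nrm_ge0 (z - w); nra.
  have f2 : `|y' * (x - x') / (x * x')| <= 2 * nrm (z - w).
    rewrite normrM normfV (@gtr0_norm _ (x * x')); last lra.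
    rewrite ler_pdivrMr; last lra.
    rewrite normrM; apply: le_trans (_ : 1 / 2 * nrm (z - w) <= _); first exact: ler_pM.
    by have := nrm_ge0 (z - w); nra.
  lra.
lra.
Qed.

(** 144 expR 6 = 4 * 6^2 * expR 6 is the Taylor remainder at an argument of size 6 |z - w|; the 2
    bounds 1 / |1 - z|. *)
Definition ell_const : R := 144 * expR 6 + 2.

Lemma ell_const_gt0 : 0 < ell_const.
Proof. by rewrite /ell_const; have := expR_gt0 (6 : R); lra. Qed.

(** With phi = ell z - ell w one has exp phi - 1 = (z - w) / (1 - z), which differs from z - w by a
    term of second order; Taylor passes from exp phi - 1 to phi. The factor |z| + |w| is what makes
    the remainder series Lipschitz up to Re s = 1. *)
Lemma ell_second_order (z w : C) : nrm z <= 1 / 2 -> nrm w <= 1 / 2 ->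
  nrm (ell z - ell w - (z - w)) <= ell_const * (nrm z + nrm w) * nrm (z - w).
Proof.
move=> hz hw; set phi := ell z - ell w; set D := nrm (z - w).
have nz : 1 - z != 0 by rewrite -nrm_gt0; have := nrm_1B_ge hz; lra.
have nw : 1 - w != 0 by rewrite -nrm_gt0; have := nrm_1B_ge hw; lra.
have ep : cexp phi - 1 = (z - w) / (1 - z).
  by rewrite /phi cexpB !cexp_ell // invrK; field.
have -> : phi - (z - w) = (z - w) * z / (1 - z) - (cexp phi - 1 - phi).
  by rewrite ep; field.
have D0 : 0 <= D := nrm_ge0 _.
have Dzw : D <= nrm z + nrm w := nrmB z w.
have D1 : D <= 1 by lra.
have phi6 : nrm phi <= 6 * D := ell_lip hz hw.
have E6 : expR (nrm phi) <= expR 6 by rewrite ler_expR; lra.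
have t1 : nrm (cexp phi - 1 - phi) <= 144 * expR 6 * (nrm z + nrm w) * D.
  apply: le_trans (cexp_taylor2 phi) _.
  apply: le_trans (_ : 4 * expR 6 * (6 * D) ^+ 2 <= _).
    have g1 : 4 * expR (nrm phi) <= 4 * expR 6 by lra.
    have g2 : nrm phi ^+ 2 <= (6 * D) ^+ 2 by rewrite lerXn2r ?nnegrE ?nrm_ge0 // mulr_ge0.
    have g3 : 0 <= 4 * expR (nrm phi) by have := expR_gt0 (nrm phi); lra.
    by apply: ler_pM => //; exact: sqr_ge0.
  have -> : 4 * expR 6 * (6 * D) ^+ 2 = 144 * expR 6 * D * D by ring.
  rewrite ler_wpM2r // ler_wpM2l // mulr_ge0 ?expR_ge0 //.
have t2 : nrm ((z - w) * z / (1 - z)) <= 2 * (nrm z + nrm w) * D.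
  rewrite !nrmM nrmV ler_pdivrMr; last by have := nrm_1B_ge hz; lra.
  have := nrm_1B_ge hz; have := nrm_ge0 z; have := nrm_ge0 w; rewrite -/D => h1 h2 h3.
  have h4 : 0 <= (nrm z + nrm w) * D by rewrite mulr_ge0 // addr_ge0.
  have h5 : D * nrm z <= (nrm z + nrm w) * D by rewrite mulrC ler_wpM2r //; lra.
  nra.
have -> : ell_const * (nrm z + nrm w) * D = 2 * (nrm z + nrm w) * D + 144 * expR 6 * (nrm z + nrm w) * D.
  by rewrite /ell_const; ring.
by apply: le_trans (nrmB _ _) _; exact: lerD.
Qed.

Lemma real_series_tail (x v : nat -> R) : (forall k, `|x k| <= v k) -> cvgn (series v) ->
  cvgn (series x) /\ forall N, `|limn (series x) - \sum_(0 <= k < N) x k| <= limn (series v) - \sum_(0 <= k < N) v k.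
Proof.
move=> xv cv; have cx : cvgn (series x).
  by apply: normed_cvg; apply: (series_le_cvg _ _ xv cv) => k //; exact: le_trans (xv k).
split => // N; have step (M : nat) : (N <= M)%N -> `|series x M - series x N| <= series v M - series v N.
  move=> NM; rewrite !sub_series_geq //.
  by apply: le_trans (ler_norm_sum _ _ _) _; apply: ler_sum.
have vl (M : nat) : series v M <= limn (series v).
  apply: nondecreasing_cvgn_le => // a b ab; rewrite -subr_ge0 sub_series_geq //.
  by apply: sumr_ge0 => k _; apply: le_trans (xv k).
have lo : series x N - (limn (series v) - series v N) <= limn (series x).
  apply: limr_ge => //; near=> M; have NM : (N <= M)%N by near: M; exact: nbhs_infty_ge.
  by have := step M NM; have := vl M; rewrite ler_norml; lra.
have up : limn (series x) <= series x N + (limn (series v) - series v N).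
  apply: limr_le => //; near=> M; have NM : (N <= M)%N by near: M; exact: nbhs_infty_ge.
  by have := step M NM; have := vl M; rewrite ler_norml; lra.
move: lo up; rewrite /series /= ler_norml; lra.
Unshelve. all: by end_near. Qed.

Definition csum (u : nat -> C) : C :=
  limn (series (fun k => Re (u k))) +i* limn (series (fun k => Im (u k))).

Definition tail (v : nat -> R) (N : nat) : R := limn (series v) - \sum_(0 <= k < N) v k.

Lemma csum_tail (u : nat -> C) (v : nat -> R) : (forall k, nrm (u k) <= v k) -> cvgn (series v) ->
  forall N, nrm (csum u - \sum_(0 <= k < N) u k) <= 2 * tail v N.
Proof.
move=> uv cv N.
have [|_ h1] := @real_series_tail (fun k => Re (u k)) v _ cv.
  by move=> k; apply: le_trans (Re_le_nrm _) (uv k).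
have [|_ h2] := @real_series_tail (fun k => Im (u k)) v _ cv.
  by move=> k; apply: le_trans (Im_le_nrm _) (uv k).
apply: le_trans (nrm_le _) _; rewrite ReD ImD ReN ImN Re_sum Im_sum /=.
by have := h1 N; have := h2 N; rewrite /tail; lra.
Qed.

Lemma tail_small (v : nat -> R) : cvgn (series v) -> forall e, 0 < e ->
  exists N0 : nat, forall N, (N0 <= N)%N -> tail v N <= e.
Proof.
move=> cv e e0; have /cvgrPdist_le /(_ e e0) [N0 _ h] := cv; exists N0 => N NN.
by apply: le_trans (ler_norm _) _; apply: h.
Qed.

Lemma csum_dist (u w : nat -> C) (v y : nat -> R) (d Y : R) :
  (forall k, nrm (u k) <= v k) -> (forall k, nrm (w k) <= v k) -> cvgn (series v) ->
  0 <= d -> (forall k, nrm (u k - w k) <= d * y k) -> (forall N, \sum_(0 <= k < N) y k <= Y) ->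
  nrm (csum u - csum w) <= d * Y.
Proof.
move=> uv wv cv d0 uw hY; apply/ler_addgt0Pr => e e0.
have e4 : 0 < e / 4 by rewrite divr_gt0.
have [N0 hN] := tail_small cv e4; have {}hN := hN _ (leqnn _).
have h1 := csum_tail uv cv N0; have h2 := csum_tail wv cv N0.
have h3 : nrm (\sum_(0 <= k < N0) u k - \sum_(0 <= k < N0) w k) <= d * Y.
  rewrite -sumrB; apply: le_trans (nrm_sum _ _ _) _.
  apply: le_trans (_ : \sum_(0 <= k < N0) d * y k <= _); first exact: ler_sum.
  by rewrite -mulr_sumr ler_wpM2l.
have := nrm_tri (\sum_(0 <= k < N0) u k) (csum u) (csum w).
have := nrm_tri (\sum_(0 <= k < N0) w k) (\sum_(0 <= k < N0) u k) (csum w).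
by rewrite nrmC in h2; lra.
Qed.

(* k^(-sg) for k >= 1, with the junk value 1 at k = 0. *)
Definition psum (sg : R) (k : nat) : R := expR (- (sg * ln k%:R)).

Lemma psum_ge0 sg k : 0 <= psum sg k. Proof. exact: expR_ge0. Qed.

(** The integral test in telescoping form. *)
Lemma psum_step (t : R) (k : nat) : 0 < t -> (1 < k)%N ->
  psum (1 + t) k <= t^-1 * (psum t k.-1 - psum t k).
Proof.
move=> t0 k1; have s1 := ln_step R k1.
have k0 : 0 < k%:R :> R by rewrite ltr0n ltnW.
have -> : psum (1 + t) k = k%:R^-1 * psum t k.
  by rewrite /psum mulrDl mul1r opprD expRD (expRN (ln k%:R)) lnK.
rewrite ler_pdivlMl //.
have -> : psum t k.-1 = psum t k * expR (t * (ln k%:R - ln k.-1%:R)).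
  by rewrite /psum -expRD; congr expR; ring.
have -> : psum t k * expR (t * (ln k%:R - ln k.-1%:R)) - psum t k =
  psum t k * (expR (t * (ln k%:R - ln k.-1%:R)) - 1) by ring.
rewrite mulrA mulrC ler_wpM2l ?psum_ge0 //.
have := expR_ge1Dx (t * (ln k%:R - ln k.-1%:R)).
have : t * k%:R^-1 <= t * (ln k%:R - ln k.-1%:R) by rewrite ler_pM2l.
lra.
Qed.

(** The 2 accounts for the terms k = 0 and k = 1, both equal to 1; from k = 2 on the sum
    telescopes. *)
Lemma psum_bound (t : R) : 0 < t -> forall N : nat, \sum_(0 <= k < N) psum (1 + t) k <= 2 + t^-1.
Proof.
move=> t0 N.
have i0 : 0 < t^-1 by rewrite invr_gt0.
have p1 : psum t 1 = 1 by rewrite /psum ln1 mulr0 oppr0 expR0.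
have key (M : nat) : \sum_(0 <= k < M.+2) psum (1 + t) k <= 2 + t^-1 * (1 - psum t M.+1).
  elim: M => [|M IH].
    by rewrite !big_nat_recr //= big_geq // p1 subrr mulr0 addr0 add0r /psum ln0 // ln1 !mulr0 oppr0 expR0; lra.
  rewrite big_nat_recr //=; have := psum_step t0 (ltn0Sn M : (1 < M.+2)%N); rewrite /=.
  by move: IH; rewrite !mulrBr; lra.
have le_key : \sum_(0 <= k < N) psum (1 + t) k <= \sum_(0 <= k < N.+2) psum (1 + t) k.
  rewrite [X in _ <= X](big_cat_nat (n := N)) //=; last by rewrite ltnW.
  by rewrite lerDl sumr_ge0 // => k _; exact: psum_ge0.
apply: le_trans le_key _; apply: le_trans (key N) _.
by rewrite lerD2l ler_piMr ?(ltW i0) // lerBlDr lerDl psum_ge0.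
Qed.

Lemma psum_cvg (t : R) : 0 < t -> cvgn (series (psum (1 + t))).
Proof.
move=> t0; apply: nondecreasing_is_cvgn.
  move=> a b ab; rewrite -subr_ge0 sub_series_geq //.
  by apply: sumr_ge0 => k _; exact: psum_ge0.
by exists (2 + t^-1) => x [N _ <-]; exact: psum_bound.
Qed.

Lemma ln_psum (t : R) (sg : R) (k : nat) : 0 < t -> ln k%:R * psum (sg + t) k <= t^-1 * psum sg k.
Proof.
move=> t0; rewrite ler_pdivlMl // mulrA.
have -> : psum sg k = expR (t * ln k%:R) * psum (sg + t) k.
  by rewrite /psum -expRD; congr expR; ring.
rewrite ler_wpM2r ?psum_ge0 //.
by have := expR_ge1Dx (t * ln k%:R); lra.
Qed.

End LogSeries.

(** * The logarithm of the Euler product *)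

Section EulerProduct.
Variable R : realType.
Local Notation C := R[i].
Local Notation Re := complex.Re.
Local Notation Im := complex.Im.

(** A positive element of R[i] is real, so real tolerances suffice. *)
Lemma cvg_nrm (T : Type) (G : set_system T) {FG : Filter G} (f : T -> C) (l : C) :
  (forall e : R, 0 < e -> \forall x \near G, nrm (f x - l) <= e) ->
  (f : T -> R[i]^o) @ G --> (l : R[i]^o).
Proof.
move=> h; apply/cvgrPdist_le => e e0.
have eE : e = (Re e)%:C by apply: complexP => //=; rewrite ger0_Im // ltW.
have e0' : 0 < Re e by move: e0; rewrite eE ltcR.
near=> x; rewrite eE normE lecR nrmC; near: x; exact: h.
Unshelve. all: by end_near. Qed.

Lemma nrm_natcpow (k : nat) (s : C) : nrm (natcpow k (- s)) = psum (Re s) k.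
Proof. by rewrite /natcpow nrm_cexp ReM ReN /= mulr0 subr0 mulNr. Qed.

Lemma natcpowD (k : nat) (s t : C) : natcpow k (s + t) = natcpow k s * natcpow k t.
Proof. by rewrite /natcpow mulrDl cexpD. Qed.

Lemma ln_nat_ge0 (k : nat) : 0 <= ln k%:R :> R.
Proof. by case: k => [|k]; [rewrite ln0|rewrite ln_ge0 // ler1n]. Qed.

Lemma psum_le (a b : R) (k : nat) : a <= b -> psum b k <= psum a k.
Proof. by move=> ab; rewrite /psum ler_expR lerN2 ler_wpM2r ?ln_nat_ge0. Qed.

Lemma psum1 (k : nat) : (0 < k)%N -> psum 1 k = k%:R^-1 :> R.
Proof. by move=> k0; rewrite /psum mul1r expRN lnK // posrE ltr0n. Qed.

Lemma psum_half (a : R) (k : nat) : 1 <= a -> (1 < k)%N -> psum a k <= 1 / 2.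
Proof.
move=> a1 k1; apply: le_trans (psum_le k a1) _; rewrite psum1; last exact: ltnW.
by rewrite mul1r lef_pV2 ?posrE ?ltr0n ?ler_nat // ltnW.
Qed.

(** If |s - t| ln k <= 1 the exponential is compared with 1; otherwise the triangle inequality is
    already good enough. *)
Lemma natcpow_dist (k : nat) (s t : C) (sg : R) : sg <= Re s -> sg <= Re t ->
  nrm (natcpow k (- s) - natcpow k (- t)) <= 17 * (nrm (s - t) * (ln k%:R * psum sg k)).
Proof.
move=> hs ht; have l0 := ln_nat_ge0 k; have p0 := psum_ge0 sg k.
have ps := psum_le k hs; have pt := psum_le k ht.
set w := - (s - t) * (ln k%:R)%:C.
have wn : nrm w = nrm (s - t) * ln k%:R by rewrite /w nrmM nrmN nrmR ger0_norm.
have e : natcpow k (- s) - natcpow k (- t) = natcpow k (- t) * (cexp w - 1).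
  rewrite mulrBr mulr1; congr (_ - _); rewrite (_ : - s = - t + - (s - t)); last by ring.
  by rewrite natcpowD.
have -> : 17 * (nrm (s - t) * (ln k%:R * psum sg k)) = 17 * (nrm w * psum sg k).
  by rewrite wn; ring.
have [w1|w1] := leP (nrm w) 1.
  have w2 := cexp_sub1_upper w1.
  rewrite e nrmM nrm_natcpow [X in _ <= X](_ : _ = psum sg k * (17 * nrm w)); last by ring.
  by apply: ler_pM; rewrite ?nrm_ge0 ?psum_ge0.
apply: le_trans (nrmB _ _) _; rewrite !nrm_natcpow.
have : psum sg k <= nrm w * psum sg k by rewrite ler_peMl // ltW.
lra.
Qed.

Lemma cvg_seriesM (c : R) (f : nat -> R) : cvgn (series f) -> cvgn (series (fun k => c * f k)).
Proof. exact: is_cvg_seriesZ. Qed.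

Variables (K : fieldExtType rat) (d : nat) (alpha : nonzero_prime K -> 'I_d -> C).
Hypothesis halpha : forall p j, `|alpha p j| <= 1.
Local Notation n := (\dim {:K})%VS.

Definition fib (k : nat) : seq (nonzero_prime K) := projT1 (cid (norm_fiber_exists K k)).

Lemma fib_uniq k : uniq (fib k). Proof. by rewrite /fib; case: cid => s []. Qed.
Lemma fib_size k : (size (fib k) <= n)%N. Proof. by rewrite /fib; case: cid => s []. Qed.
Lemma mem_fib k p : (p \in fib k) = (abs_norm p == k).
Proof. by rewrite /fib; case: cid => s []. Qed.

Lemma nrm_alpha p j : nrm (alpha p j) <= 1.
Proof. by have := halpha p j; rewrite normE lecR. Qed.

Definition local_root p j (s : C) : C := alpha p j * natcpow (abs_norm p) (- s).

Lemma nrm_local_root p j s (sg : R) : sg <= Re s -> nrm (local_root p j s) <= psum sg (abs_norm p).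
Proof.
move=> h; rewrite /local_root nrmM nrm_natcpow -[X in _ <= X]mul1r.
by apply: ler_pM; rewrite ?nrm_ge0 ?psum_ge0 ?nrm_alpha ?psum_le.
Qed.

Lemma nrm_local_root_half p j s : 1 <= Re s -> nrm (local_root p j s) <= 1 / 2.
Proof.
by move=> h; apply: le_trans (nrm_local_root p j h) _; apply: psum_half => //; exact: abs_norm_gt1.
Qed.

Lemma local_root_dist p j s t (sg : R) : sg <= Re s -> sg <= Re t ->
  nrm (local_root p j s - local_root p j t) <= 17 * (nrm (s - t) * (ln (abs_norm p)%:R * psum sg (abs_norm p))).
Proof.
move=> hs ht; rewrite /local_root -mulrBr nrmM -[X in _ <= X]mul1r.
by apply: ler_pM; rewrite ?nrm_ge0 ?nrm_alpha ?natcpow_dist.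
Qed.

Definition local_log p (s : C) : C := \sum_(j < d) ell (local_root p j s).

Lemma cexp_local_log p s : 1 <= Re s -> cexp (local_log p s) = euler_factor alpha s p.
Proof.
move=> h; rewrite /local_log cexp_sum /euler_factor -prodfV; apply: eq_bigr => j _.
by rewrite cexp_ell // nrm_local_root_half.
Qed.

Definition coefB : R := (n * d)%:R.

Lemma coefB_ge0 : 0 <= coefB. Proof. by rewrite /coefB. Qed.

Lemma fib_bound (k : nat) (f : nonzero_prime K -> 'I_d -> C) (b : R) : 0 <= b ->
  (forall p j, p \in fib k -> nrm (f p j) <= b) ->
  nrm (\sum_(p <- fib k) \sum_(j < d) f p j) <= coefB * b.
Proof.
move=> b0 h; apply: le_trans (nrm_sum _ _ _) _.
apply: le_trans (_ : \sum_(p <- fib k) d%:R * b <= _).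
  rewrite big_seq_cond [X in _ <= X]big_seq_cond; apply: ler_sum => p; rewrite andbT => pk.
  apply: le_trans (nrm_sum _ _ _) _.
  apply: le_trans (_ : \sum_(j < d) b <= _); first by apply: ler_sum => j _; exact: h.
  by rewrite sumr_const card_ord mulr_natl.
rewrite big_const_seq count_predT iter_addr_0 -[X in X <= _]mulr_natl mulrA.
by rewrite ler_wpM2r // -natrM ler_nat leq_mul2r fib_size orbT.
Qed.

Definition log_term k s := \sum_(p <- fib k) local_log p s.
Definition lin_coef k : C := \sum_(p <- fib k) \sum_(j < d) alpha p j.
Definition rem_term k s := \sum_(p <- fib k) \sum_(j < d) (ell (local_root p j s) - local_root p j s).

Lemma log_termE k s : log_term k s = lin_coef k * natcpow k (- s) + rem_term k s.
Proof.
rewrite /log_term /lin_coef /rem_term mulr_suml -big_split /= big_seq [RHS]big_seq.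
apply: eq_bigr => p; rewrite mem_fib => /eqP pk.
rewrite mulr_suml -big_split /=; apply: eq_bigr => j _.
by rewrite /local_root pk addrC subrK.
Qed.

Lemma lin_coef_bound k : nrm (lin_coef k) <= coefB.
Proof. by rewrite -[coefB]mulr1; apply: fib_bound => // p j _; exact: nrm_alpha. Qed.

Lemma lin_coef0 : lin_coef 0 = 0.
Proof.
rewrite /lin_coef big_seq big1 // => p; rewrite mem_fib => /eqP h.
by have := abs_norm_gt1 p; rewrite h.
Qed.

Lemma log_term_bound k s (sg : R) : 1 <= sg -> sg <= Re s -> nrm (log_term k s) <= coefB * 6 * psum sg k.
Proof.
move=> s1 hs; rewrite -mulrA; apply: fib_bound => [|p j]; first by rewrite mulr_ge0 ?psum_ge0.
rewrite mem_fib => /eqP pk.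
have h : nrm (local_root p j s) <= 1 / 2 by apply: nrm_local_root_half; lra.
have := @ell_lip R (local_root p j s) 0 h; rewrite nrm0 ell0 !subr0 => /(_ _) e.
apply: le_trans (e _) _; first by lra.
by rewrite ler_pM2l // -pk nrm_local_root.
Qed.

Lemma log_term_dist k s t (sg : R) : 1 <= sg -> sg <= Re s -> sg <= Re t ->
  nrm (log_term k s - log_term k t) <= nrm (s - t) * (coefB * 102 * (ln k%:R * psum sg k)).
Proof.
move=> s1 hs ht; rewrite /log_term /local_log -sumrB; under eq_bigr do rewrite -sumrB.
have -> : nrm (s - t) * (coefB * 102 * (ln k%:R * psum sg k)) =
  coefB * (102 * (nrm (s - t) * (ln k%:R * psum sg k))) by ring.
apply: fib_bound => [|p j].
  by rewrite !mulr_ge0 ?nrm_ge0 ?psum_ge0 ?ln_nat_ge0.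
rewrite mem_fib => /eqP pk.
apply: le_trans (ell_lip _ _) _; try (apply: nrm_local_root_half; lra).
have := local_root_dist p j hs ht; rewrite pk; lra.
Qed.

Lemma psum_sq (k : nat) : psum 1 k * psum 1 k = psum 2 k :> R.
Proof. by rewrite /psum -expRD; congr expR; ring. Qed.

Lemma rem_term_bound k s : 1 <= Re s -> nrm (rem_term k s) <= coefB * ell_const R * psum 2 k.
Proof.
move=> hs; have c0 := ell_const_gt0 R; rewrite -mulrA; apply: fib_bound => [|p j].
  by rewrite mulr_ge0 ?psum_ge0 // ltW.
rewrite mem_fib => /eqP pk.
have h : nrm (local_root p j s) <= 1 / 2 by exact: nrm_local_root_half.
have h0 : nrm (0 : C) <= 1 / 2 by rewrite nrm0; lra.
have := ell_second_order h h0; rewrite nrm0 ell0 !subr0 addr0 => e.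
apply: le_trans e _; rewrite -mulrA ler_pM2l // -psum_sq -pk.
by apply: ler_pM; rewrite ?nrm_ge0 ?nrm_local_root.
Qed.

(** [ell_second_order] supplies one factor 1/k and [local_root_dist] the other, together with ln k;
    a first-order bound would lead to the divergent series of ln k / k. The constant is 34 = 2 *
    17. *)
Lemma rem_term_dist k s t : 1 <= Re s -> 1 <= Re t ->
  nrm (rem_term k s - rem_term k t) <= nrm (s - t) * (coefB * ell_const R * 34 * (ln k%:R * psum 2 k)).
Proof.
move=> hs ht; have c0 := ell_const_gt0 R; rewrite /rem_term -sumrB; under eq_bigr do rewrite -sumrB.
have -> : nrm (s - t) * (coefB * ell_const R * 34 * (ln k%:R * psum 2 k)) =
  coefB * (ell_const R * 34 * (nrm (s - t) * (ln k%:R * psum 2 k))) by ring.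
apply: fib_bound => [|p j].
  by rewrite !mulr_ge0 ?nrm_ge0 ?psum_ge0 ?ln_nat_ge0 // ltW.
rewrite mem_fib => /eqP pk.
rewrite (_ : _ - _ = ell (local_root p j s) - ell (local_root p j t) - (local_root p j s - local_root p j t)); last by ring.
apply: le_trans (ell_second_order _ _) _; try exact: nrm_local_root_half.
have h1 := nrm_local_root p j hs; have h2 := nrm_local_root p j ht; have h3 := local_root_dist p j hs ht.
rewrite pk in h1 h2 h3.
rewrite -psum_sq (_ : ell_const R * 34 * (nrm (s - t) * (ln k%:R * (psum 1 k * psum 1 k))) =
  ell_const R * (2 * psum 1 k) * (17 * (nrm (s - t) * (ln k%:R * psum 1 k)))); last by ring.
apply: ler_pM; rewrite ?nrm_ge0 //.
  by rewrite mulr_ge0 ?addr_ge0 ?nrm_ge0 // ltW.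
by rewrite ler_pM2l //; lra.
Qed.

Definition logL (s : C) : C := csum (fun k => log_term k s).
Definition remL (s : C) : C := csum (fun k => rem_term k s).

(** The constant Y blows up as t tends to 0. This is harmless: it serves to make paths of logarithms
    continuous, and the conclusion of [cexp_path_small] does not involve it. *)
Lemma logL_lip (t : R) : 0 < t -> exists2 Y : R, 0 <= Y & forall s w : C, 1 + t <= Re s -> 1 + t <= Re w ->
  nrm (logL s - logL w) <= nrm (s - w) * Y.
Proof.
move=> t0; pose Y := coefB * 102 * ((t / 2)^-1 * (2 + (t / 2)^-1)).
have t2 : 0 < t / 2 by rewrite divr_gt0.
have i0 : 0 < (t / 2)^-1 by rewrite invr_gt0.
have B0 := coefB_ge0.
exists Y => [|s w hs hw].
  by rewrite /Y !mulr_ge0 //; lra.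
apply: (@csum_dist R _ _ (fun k => coefB * 6 * psum (1 + t) k) (fun k => coefB * 102 * (ln k%:R * psum (1 + t) k))).
- by move=> k; apply: log_term_bound => //; lra.
- by move=> k; apply: log_term_bound => //; lra.
- by apply: cvg_seriesM; exact: psum_cvg.
- exact: nrm_ge0.
- by move=> k; apply: log_term_dist => //; lra.
- move=> N; rewrite -mulr_sumr /Y ler_wpM2l //; first by rewrite mulr_ge0.
  apply: le_trans (_ : \sum_(0 <= k < N) (t / 2)^-1 * psum (1 + t / 2) k <= _).
    apply: ler_sum => k _; have := ln_psum (1 + t / 2) k t2.
    by rewrite (_ : 1 + t / 2 + t / 2 = 1 + t) //; lra.
  by rewrite -mulr_sumr ler_pM2l // psum_bound.
Qed.

Lemma half_gt0 : 0 < 1 / 2 :> R. Proof. by lra. Qed.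

Lemma psum2_cvg : cvgn (series (@psum R 2)).
Proof. by rewrite (_ : 2 = 1 + 1 :> R) //; exact: psum_cvg. Qed.

Lemma remL_lip : exists2 Y : R, 0 <= Y & forall s w : C, 1 <= Re s -> 1 <= Re w ->
  nrm (remL s - remL w) <= nrm (s - w) * Y.
Proof.
pose Y := coefB * ell_const R * 34 * ((1 / 2)^-1 * (2 + (1 / 2)^-1)).
have i0 : 0 < (1 / 2 : R)^-1 by rewrite invr_gt0 half_gt0.
have B0 := coefB_ge0; have c0 := ell_const_gt0 R.
exists Y => [|s w hs hw].
  by rewrite /Y; apply: mulr_ge0; [rewrite !mulr_ge0 // ltW|apply: mulr_ge0; lra].
apply: (@csum_dist R _ _ (fun k => coefB * ell_const R * psum 2 k) (fun k => coefB * ell_const R * 34 * (ln k%:R * psum 2 k))).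
- by move=> k; exact: rem_term_bound.
- by move=> k; exact: rem_term_bound.
- by apply: cvg_seriesM; exact: psum2_cvg.
- exact: nrm_ge0.
- by move=> k; exact: rem_term_dist.
- move=> N; rewrite -mulr_sumr /Y ler_wpM2l //; first by rewrite !mulr_ge0 // ltW.
  apply: le_trans (_ : \sum_(0 <= k < N) (1 / 2)^-1 * psum (1 + 1 / 2) k <= _).
    apply: ler_sum => k _; have := ln_psum (1 + 1 / 2) k half_gt0.
    by rewrite (_ : 1 + 1 / 2 + 1 / 2 = 2 :> R) //; lra.
  by rewrite -mulr_sumr ler_pM2l // psum_bound // half_gt0.
Qed.

Lemma logL_tail (t : R) : 0 < t -> forall e : R, 0 < e -> exists N0 : nat, forall N, (N0 <= N)%N ->
  forall s, 1 + t <= Re s -> nrm (logL s - \sum_(0 <= k < N) log_term k s) <= e.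
Proof.
move=> t0 e e0; have e2 : 0 < e / 2 by rewrite divr_gt0.
have [N0 h] := tail_small (cvg_seriesM (c := coefB * 6) (psum_cvg t0)) e2.
exists N0 => N NN s hs.
apply: le_trans (@csum_tail R _ (fun k => coefB * 6 * psum (1 + t) k) _ _ N) _.
- by move=> k; apply: log_term_bound => //; lra.
- by apply: cvg_seriesM; exact: psum_cvg.
- by have := h N NN; lra.
Qed.

Lemma remL_tail (e : R) : 0 < e -> exists N0 : nat, forall N, (N0 <= N)%N ->
  forall s, 1 <= Re s -> nrm (remL s - \sum_(0 <= k < N) rem_term k s) <= e.
Proof.
move=> e0; have e2 : 0 < e / 2 by rewrite divr_gt0.
have [N0 h] := tail_small (cvg_seriesM (c := coefB * ell_const R) psum2_cvg) e2.
exists N0 => N NN s hs.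
apply: le_trans (@csum_tail R _ (fun k => coefB * ell_const R * psum 2 k) _ _ N) _.
- by move=> k; exact: rem_term_bound.
- by apply: cvg_seriesM; exact: psum2_cvg.
- by have := h N NN; lra.
Qed.

Lemma group_by_norm (A : seq (nonzero_prime K)) (f : nonzero_prime K -> C) (N : nat) : uniq A ->
  (forall p, (abs_norm p < N)%N -> p \in A) ->
  \sum_(p <- A | (abs_norm p < N)%N) f p = \sum_(0 <= k < N) \sum_(p <- fib k) f p.
Proof.
move=> uA; elim: N => [|N IH] h; first by rewrite [RHS]big_geq // big_pred0.
rewrite big_nat_recr //= -IH; last by move=> p pN; apply: h; exact: ltnW.
rewrite (bigID (fun p => abs_norm p < N)%N) /=; congr (_ + _).
  by apply: eq_bigl => p; case: (ltngtP (abs_norm p) N) => // hp; rewrite ?andbF // ltnS ltnW.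
rewrite -big_filter; apply: perm_big; apply: uniq_perm.
- exact: filter_uniq.
- exact: fib_uniq.
- move=> p; rewrite mem_filter mem_fib -leqNgt ltnS -eqn_leq.
  by case: eqP => // e; rewrite h // e.
Qed.

Lemma sum_norm_tail (A : seq (nonzero_prime K)) (g : nat -> R) (N M : nat) : uniq A ->
  (forall k, 0 <= g k) -> (N <= M)%N ->
  \sum_(p <- A | (N <= abs_norm p < M)%N) g (abs_norm p) <= \sum_(N <= k < M) n%:R * g k.
Proof.
move=> uA g0; elim: M => [|M IH].
  by rewrite leqn0 => /eqP ->; rewrite [X in _ <= X]big_geq // big_pred0 // => p; rewrite ltn0 andbF.
rewrite leq_eqVlt => /orP[/eqP <-|]; last rewrite ltnS => NM.
  rewrite [X in _ <= X]big_geq // big_pred0 // => p; apply/negP => /andP[h1 h2].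
  by have := leq_ltn_trans h1 h2; rewrite ltnn.
rewrite [X in _ <= X]big_nat_recr //= (bigID (fun p => abs_norm p < M)%N) /=; apply: lerD.
  apply: le_trans (IH NM); rewrite le_eqVlt; apply/orP; left; apply/eqP; apply: eq_bigl => p.
  by case: (ltnP (abs_norm p) M) => hp; rewrite ?andbF // ltnS (ltnW hp) ?andbT.
rewrite (eq_bigl (fun p => abs_norm p == M)); last first.
  move=> p; rewrite ltnS -leqNgt -andbA -eqn_leq; case: eqP => [->|]; rewrite ?andbT ?andbF //.
rewrite (eq_bigr (fun _ => g M)); last by move=> p /eqP ->.
rewrite big_const_seq iter_addr_0 -[X in X <= _]mulr_natl ler_wpM2r // ler_nat -size_filter.
apply: (@norm_fiber_le K M); first exact: filter_uniq.
by move=> p; rewrite mem_filter => /andP[/eqP].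
Qed.

(** Once A contains all primes of norm below N, its other members contribute at most the tail of a
    convergent series, whatever they are. The limit over finite sets thus reduces to a limit in
    N. *)
Lemma euler_product_cexp (s : C) : 1 < Re s -> euler_product alpha s = cexp (logL s).
Proof.
move=> hs; rewrite /euler_product.
have t0 : 0 < Re s - 1 by rewrite subr_gt0.
have tE : 1 + (Re s - 1) = Re s by ring.
have PF : ProperFilter (@summability.totally (nonzero_prime K)) := summability.totally_filter.
apply: cvg_lim; first exact: norm_hausdorff.
apply: cvg_nrm => e e0.
set E := expR (Re (logL s)); have E0 : 0 < E := expR_gt0 _.
pose eta := Num.min 1 (e / (17 * E)).
have eta0 : 0 < eta by rewrite lt_min ltr01 divr_gt0 // mulr_gt0.
have eta4 : 0 < eta / 4 by rewrite divr_gt0.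
have [N1 h1] := logL_tail t0 eta4.
have [N2 h2] := tail_small (cvg_seriesM (c := n%:R * (d%:R * 6)) (psum_cvg t0)) eta4.
pose N := maxn N1 N2.
have H1 := h1 N (leq_maxl _ _) s; rewrite tE lexx in H1; have {}H1 := H1 isT.
have H2 := h2 N (leq_maxr _ _); rewrite tE in H2.
pose A0 : {fset nonzero_prime K} := [fset p in flatten [seq fib k | k <- iota 0 N]]%fset.
exists A0 => // A /= A0A.
have memA p : (abs_norm p < N)%N -> p \in A.
  move=> pN; apply: (fsubsetP A0A); rewrite in_fset /=; apply/flattenP; exists (fib (abs_norm p)).
    by apply: map_f; rewrite mem_iota.
  by rewrite mem_fib.
have uA : uniq A := fset_uniq A.
have -> : \prod_(p <- A) euler_factor alpha s p = cexp (\sum_(p <- A) local_log p s).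
  by rewrite cexp_sum; apply: eq_bigr => p _; rewrite cexp_local_log // ltW.
rewrite (bigID (fun p => abs_norm p < N)%N) /= (group_by_norm _ uA memA).
set S1 := \sum_(0 <= k < N) _ in H1 *; set S2 := \sum_(p <- A | _) _.
have S2b : nrm S2 <= eta / 4.
  apply: le_trans (nrm_sum _ _ _) _.
  apply: le_trans (_ : \sum_(p <- A | ~~ (abs_norm p < N)%N) d%:R * 6 * psum (Re s) (abs_norm p) <= _).
    apply: ler_sum => p _; apply: le_trans (nrm_sum _ _ _) _.
    apply: le_trans (_ : \sum_(j < d) 6 * psum (Re s) (abs_norm p) <= _); last first.
      by rewrite sumr_const card_ord -[X in X <= _]mulr_natl mulrA.
    apply: ler_sum => j _.
    have h : nrm (local_root p j s) <= 1 / 2 by apply: nrm_local_root_half; lra.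
    have h0 : nrm (0 : C) <= 1 / 2 by rewrite nrm0; lra.
    have := ell_lip h h0; rewrite ell0 !subr0 => /le_trans; apply.
    by rewrite ler_pM2l // nrm_local_root.
  (* A is finite, so its norms lie below some M and the excess fits into a window from N to M. *)
  pose M := maxn N (\max_(p <- A) abs_norm p).+1.
  have NM : (N <= M)%N := leq_maxl _ _.
  have pM p : p \in A -> (abs_norm p < M)%N.
    by move=> pA; rewrite leq_max ltnS (leq_bigmax_seq _ pA) ?orbT.
  pose g k : R := d%:R * 6 * psum (Re s) k.
  have g0 k : 0 <= g k by rewrite /g !mulr_ge0 ?psum_ge0.
  have := sum_norm_tail uA g0 NM.
  have -> : \sum_(p <- A | (N <= abs_norm p < M)%N) g (abs_norm p) =
     \sum_(p <- A | ~~ (abs_norm p < N)%N) d%:R * 6 * psum (Re s) (abs_norm p).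
    rewrite big_seq_cond [RHS]big_seq_cond; apply: eq_bigl => p; rewrite -leqNgt.
    by case pA : (p \in A) => //=; rewrite pM ?andbT.
  move=> /le_trans; apply; apply: le_trans H2; rewrite /tail.
  have -> : \sum_(N <= k < M) n%:R * g k = series (fun k => n%:R * (d%:R * 6) * psum (Re s) k) M -
     series (fun k => n%:R * (d%:R * 6) * psum (Re s) k) N.
    by rewrite sub_series_geq //; apply: eq_bigr => k _; rewrite /g; ring.
  rewrite lerB //; have cv := cvg_seriesM (c := n%:R * (d%:R * 6)) (psum_cvg t0); rewrite tE in cv.
  apply: nondecreasing_cvgn_le => // a b ab; rewrite -subr_ge0 sub_series_geq //.
  by apply: sumr_ge0 => k _; rewrite !mulr_ge0 ?psum_ge0.
have dist : nrm (S1 + S2 - logL s) <= eta.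
  rewrite (_ : S1 + S2 - logL s = S2 - (logL s - S1)); last by ring.
  by apply: le_trans (nrmB _ _) _; lra.
have eE : cexp (S1 + S2) - cexp (logL s) = cexp (logL s) * (cexp (S1 + S2 - logL s) - 1).
  by rewrite mulrBr mulr1 -cexpD; congr (cexp _ - _); ring.
change (nrm (cexp (S1 + S2) - cexp (logL s)) <= e).
rewrite eE nrmM nrm_cexp -/E.
apply: le_trans (_ : E * (17 * eta) <= _).
  rewrite ler_pM2l //; apply: le_trans (cexp_sub1_upper _) _.
    by apply: le_trans dist _; rewrite ge_min lexx.
  by rewrite ler_pM2l.
rewrite (_ : E * (17 * eta) = eta * (17 * E)); last by ring.
by rewrite -ler_pdivlMr ?mulr_gt0 // ge_min lexx orbT.
Qed.

Lemma partial_euler_product_cexp (s : C) (x : R) : 1 <= Re s -> 0 <= x ->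
  partial_euler_product alpha s x = cexp (\sum_(0 <= k < (Num.truncn x).+1) log_term k s).
Proof.
move=> hs x0; rewrite /partial_euler_product.
set S := [set p : nonzero_prime K | _]; set N := (Num.truncn x).+1.
have memS p : S p <-> (abs_norm p < N)%N.
  by rewrite /S /= /N ltnS truncn_ge_nat.
(* Finiteness is what turns the product over the set S into a genuine finite product, rather than a
   default value. *)
have fS : finite_set S.
  apply: (@sub_finite_set _ _ [set` flatten [seq fib k | k <- iota 0 N]]); last exact: finite_seq.
  move=> p /memS pN; apply/flattenP; exists (fib (abs_norm p)).
    by apply: map_f; rewrite mem_iota.
  by rewrite mem_fib.
have mem p : (p \in fset_set S) = (abs_norm p < N)%N.
  by rewrite in_fset_set //; apply/idP/idP => [/set_mem/memS|/memS/mem_set].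
rewrite fsbig_finite //=.
have -> : \sum_(0 <= k < N) log_term k s = \sum_(p <- fset_set S | (abs_norm p < N)%N) local_log p s.
  by rewrite group_by_norm ?fset_uniq // => p; rewrite mem.
rewrite cexp_sum [LHS]big_seq [RHS]big_seq_cond; apply: eq_big => p.
  by rewrite mem andbb.
by move=> _; rewrite cexp_local_log.
Qed.

End EulerProduct.

(** * Boundary behaviour *)

Section Continuation.
Variable R : realType.
Local Notation C := R[i].
Local Notation Re := complex.Re.
Local Notation Im := complex.Im.

(** The analyticity of L enters through this estimate: as continuity on compact rectangles, and as
    the Lipschitz bound at s0. *)
Lemma derivable_local_lip (f : C -> C) (z : C) : derivable (f : R[i]^o -> R[i]^o) z 1 ->
  exists K d : R, [/\ 0 <= K, 0 < d & forall w : C, nrm (w - z) < d -> nrm (f w - f z) <= K * nrm (w - z)].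
Proof.
move=> /cvg_ex[l hl].
have /cvgrPdist_lt /(_ 1 ltr01) := hl.
rewrite /dnbhs /within /= => /nbhs_ballP[e /= e0 he].
have eE : e = (Re e)%:C by apply: complexP => //=; rewrite ger0_Im // ltW.
have e0' : 0 < Re e by move: e0; rewrite eE ltcR.
exists (nrm (l : C) + 1), (Re e); split => //; first by rewrite addr_ge0 ?nrm_ge0.
move=> w hw; set h := w - z in hw *.
have [h0|h0] := eqVneq h 0.
  have -> : w = z by apply/eqP; rewrite -subr_eq0 -/h h0.
  by rewrite subrr nrm0 mulr_ge0 ?addr_ge0 ?nrm_ge0.
have hb : ball (0 : R[i]^o) e h.
  by rewrite /ball /= sub0r normrN normE eE ltcR.
have /= := he h hb h0; rewrite normE -[1]/(1%:C) ltcR => hq.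
have wE : h *: (1 : R[i]^o) + z = w by rewrite /GRing.scale /= mulr1 /h subrK.
have fE : f w - f z = h * (h^-1 * (f w - f z)) by rewrite mulrA divff // mul1r.
rewrite wE in hq.
rewrite fE nrmM mulrC ler_wpM2r ?nrm_ge0 //.
have hq' : nrm ((l : C) - h^-1 * (f w - f z)) < 1 by exact: hq.
have := nrmB (l : C) ((l : C) - h^-1 * (f w - f z)).
rewrite (_ : (l : C) - (l - h^-1 * (f w - f z)) = h^-1 * (f w - f z)); last by ring.
lra.
Qed.

Definition rect (tau La : R) (z : C) := 1 <= Re z <= 2 /\ `|Im z - tau| <= La.

(** Compactness of the rectangle makes the local estimates uniform. The error is relative to |L w|
    because it will bound L(z) / L(w) - 1, hence a difference of logarithms. *)
Lemma rect_uniform (L : C -> C) (tau La e : R) :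
  (forall z, 1 <= Re z -> derivable (L : R[i]^o -> R[i]^o) z 1) ->
  (forall z, 1 <= Re z -> L z != 0) -> 0 < e ->
  exists2 d : R, 0 < d & forall z w : C, rect tau La z -> rect tau La w ->
   nrm (z - w) < d -> nrm (L z - L w) <= e * nrm (L w).
Proof.
move=> dL nL e0.
pose Q : set (R * R) := `[1, 2] `*` `[tau - La, tau + La].
have cQ : compact Q by apply: compact_setX; exact: segment_compact.
have nc := (compact_near_coveringP _).1 cQ.
pose P (d : R) (x : R * R) := forall w : C, rect tau La w -> nrm ((x.1 +i* x.2) - w) < d ->
  nrm (L (x.1 +i* x.2) - L w) <= e * nrm (L w).
have loc (x : R * R) : Q x -> \forall x' \near x & d \near (0 : R)^'+, P d x'.
  move=> [/= x1 x2]; set z := x.1 +i* x.2.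
  have z1 : 1 <= Re z by move: x1; rewrite in_itv /= => /andP[].
  have Lz : 0 < nrm (L z) by rewrite nrm_gt0 nL.
  have [K [d [K0 d0 hd]]] := derivable_local_lip (dL z z1).
  (* 1/2 gives |L z| <= 2 |L w|; then the two deviations from L z add up to at most 4 eta |L w| <= e
     |L w|. *)
  pose eta := Num.min (1 / 2) (e / 4).
  have eta0 : 0 < eta by rewrite lt_min; apply/andP; split; lra.
  pose r := Num.min d (eta * nrm (L z) / (K + 1)).
  have r0 : 0 < r by rewrite lt_min d0 divr_gt0 ?mulr_gt0 //; lra.
  have near_z u : nrm (u - z) < r -> nrm (L u - L z) <= eta * nrm (L z).
    rewrite lt_min => /andP[u1 u2]; apply: le_trans (hd u u1) _.
    move: u2; rewrite ltr_pdivlMr; last lra.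
    have := nrm_ge0 (u - z); nra.
  have r4 : 0 < r / 4 by lra.
  exists (ball x (r / 4), [set d' : R | 0 < d' < r / 2]) => /=.
    split; first exact: nbhsx_ballx.
    near=> q; apply/andP; split; near: q; first exact: nbhs_right_gt.
    by apply: nbhs_right_lt; lra.
  move=> [x' d'] /= [[b1 b2] /andP[d'0 d'r]] w rw hw.
  set u := x'.1 +i* x'.2 in hw *.
  have uz : nrm (u - z) < r / 2.
    apply: le_lt_trans (nrm_le _) _; rewrite /u /z /=.
    by move: b1 b2; rewrite /ball /= !(distrC x.1) !(distrC x.2); lra.
  have wz : nrm (w - z) < r.
    by have := nrm_tri u w z; rewrite (nrmC w u); lra.
  have e1 : nrm (L u - L z) <= eta * nrm (L z) by apply: near_z; lra.
  have e2 := near_z w wz.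
  have e3 : nrm (L z) <= 2 * nrm (L w).
    have h1 : eta <= 1 / 2 by rewrite ge_min lexx.
    by have := nrmB (L w) (L w - L z); rewrite opprB addrC subrK; nra.
  have e4 : eta <= e / 4 by rewrite ge_min lexx orbT.
  have := nrm_tri (L z) (L u) (L w); rewrite (nrmC (L z) (L w)).
  by have := nrm_ge0 (L w); nra.
have /(_ _ _ P _ loc) h := nc.
have [d [d0 hd]] : exists d : R, 0 < d /\ Q `<=` P d.
  have hh : \forall d \near (0 : R)^'+, 0 < d /\ Q `<=` P d.
    by near=> q; split; near: q; [exact: nbhs_right_gt|exact: h].
  by have [q hq] := filter_ex hh; exists q.
exists d => // z w [z1 z2] rw zw.
have := hd (Re z, Im z); rewrite /Q /P /=; case: z z1 z2 zw => a b /= z1 z2 zw; apply => //.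
by split => /=; rewrite in_itv /= //; move: z2; rewrite ler_norml; lra.
Unshelve. all: by end_near. Qed.

(** The half-open strip is not compact, so bounded variation comes from chaining: a segment of
    length at most 1 + 2 La is cut into N steps shorter than d, each changing G by at most 1. *)
Lemma strip_bounded (G : C -> C) : strip_unif_cont G -> forall La : R, 0 <= La ->
  exists2 Bd : R, 0 <= Bd & forall z w : C, 0 < Re z <= 1 -> 0 < Re w <= 1 -> `|Im z| <= La -> `|Im w| <= La ->
   nrm (G z - G w) <= Bd.
Proof.
move=> hG La La0; have [d d0 hd] := hG La 1 ltr01.
pose N := (Num.truncn ((1 + 2 * La) / d)).+1.
have NR : 0 < N%:R :> R by rewrite ltr0n.
exists N%:R => // z w hz hw hz' hw'.
pose pt (i : nat) := w + (i%:R / N%:R)%:C * (z - w).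
have zw : nrm (z - w) <= 1 + 2 * La.
  apply: le_trans (nrm_le _) _; rewrite ReD ImD ReN ImN.
  apply: lerD; first by rewrite ler_norml; lra.
  by have := ler_normB (Im z) (Im w); lra.
have inst i : (i <= N)%N -> 0 < Re (pt i) <= 1 /\ `|Im (pt i)| <= La.
  move=> iN; have t1 : i%:R / N%:R <= 1 :> R by rewrite ler_pdivrMr // mul1r ler_nat.
  have t0 : 0 <= i%:R / N%:R :> R by rewrite divr_ge0.
  rewrite /pt ReD ImD ReM ImM /= !mul0r subr0 addr0 ReD ImD ReN ImN.
  set t := i%:R / N%:R in t0 t1 *.
  move: hz' hw'; rewrite !ler_norml => /andP[a1 a2] /andP[a3 a4].
  by split; [nra|apply/andP; split; nra].
have step i : (i <= N)%N -> nrm (G (pt i) - G w) <= i%:R.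
  elim: i => [|i IH] iN; first by rewrite /pt mul0r mul0r addr0 subrr nrm0.
  have [s1 s2] := inst i (ltnW iN); have [s3 s4] := inst i.+1 iN.
  have h : nrm (G (pt i.+1) - G (pt i)) <= 1.
    apply: hd => //.
    have -> : pt i.+1 - pt i = (N%:R^-1)%:C * (z - w).
      have -> : (N%:R^-1 : R) = i.+1%:R / N%:R - i%:R / N%:R by rewrite -mulrBl -natr1 [_ + 1 - _]addrC addKr mul1r.
      by rewrite /pt rmorphB /=; ring.
    rewrite nrmM nrmR gtr0_norm ?invr_gt0 // mulrC ltr_pdivrMr //.
    have := truncnS_gt ((1 + 2 * La) / d); rewrite -/N ltr_pdivrMr //; lra.
  have := IH (ltnW iN); have := nrm_tri (G (pt i)) (G (pt i.+1)) (G w).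
  by rewrite -natr1; lra.
have -> : z = pt N by rewrite /pt divff ?gt_eqF // mul1r; ring.
exact: step.
Qed.

Variables (K : fieldExtType rat) (d : nat) (alpha : nonzero_prime K -> 'I_d -> C).
Hypothesis halpha : forall p j, `|alpha p j| <= 1.
Variable L : C -> C.
Hypothesis hL : forall s : C, 1 < Re s -> L s = cexp (logL alpha s).
Hypothesis dL : forall s : C, 1 <= Re s -> derivable (L : R[i]^o -> R[i]^o) s 1.
Hypothesis nL : forall s : C, Re s = 1 -> L s != 0.
Variable s0 : C.
Hypothesis s01 : Re s0 = 1.

Local Notation D := (logL alpha).
Local Notation Rr := (remL alpha).

Let nL1 (z : C) : 1 <= Re z -> L z != 0.
Proof.
rewrite le_eqVlt => /orP[/eqP/esym/nL //|h]; rewrite hL //; exact: cexp_neq0.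
Qed.

(** Along the segment from w to z the ratio of the values of L stays close to 1, so the exponential
    of the increment of D does; [cexp_path_small] excludes a jump by a multiple of 2 pi i. *)
Lemma logL_strip_unif_cont : strip_unif_cont (fun z => D (s0 + z)).
Proof.
move=> La e e0.
(* [cexp_path_small] doubles the error and asks for e' < 1/64. *)
pose e' := Num.min (e / 2) (1 / 128).
have e'0 : 0 < e' by rewrite lt_min; apply/andP; split; lra.
have e'1 : e' <= e / 2 by rewrite ge_min lexx.
have e'2 : e' < 1 / 64 by apply: le_lt_trans (_ : 1 / 128 < _); [rewrite ge_min lexx orbT|lra].
have [dd dd0 hd] := @rect_uniform L (Im s0) La e' dL nL1 e'0.
exists dd => // z w hz hw hz' hw' zw.
pose pt (t : R) := s0 + (w + t%:C * (z - w)).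
have RePt t : Re (pt t) = 1 + (Re w + t * (Re z - Re w)).
  by rewrite /pt !(ReD, ReM, ReN) /= s01 mul0r subr0.
have ImPt t : Im (pt t) = Im s0 + (Im w + t * (Im z - Im w)).
  by rewrite /pt !(ImD, ImM, ImN) /= mul0r addr0.
(* The segment stays in Re s >= 1 + sg, where D is Lipschitz; the constant depends on sg, but the
   resulting bound does not. *)
pose sg := Num.min (Re z) (Re w).
have sg0 : 0 < sg by rewrite lt_min; lra.
have [sgz sgw] : sg <= Re z /\ sg <= Re w by split; rewrite ge_min lexx ?orbT.
have [Y Y0 hY] := logL_lip halpha sg0.
have ptR t : 0 <= t <= 1 -> 1 + sg <= Re (pt t) by move=> /andP[t0 t1]; rewrite RePt; nra.
have ptrect t : 0 <= t <= 1 -> rect (Im s0) La (pt t).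
  move=> /andP[t0 t1]; split; rewrite ?RePt ?ImPt; first by apply/andP; split; nra.
  move: hz' hw'; rewrite !ler_norml => /andP[a1 a2] /andP[a3 a4].
  by apply/andP; split; nra.
have wE : pt 0 = s0 + w by rewrite /pt mul0r addr0.
have zE : pt 1 = s0 + z by rewrite /pt mul1r; ring.
pose phi t := D (pt t) - D (s0 + w).
have := @cexp_path_small R phi (Y * nrm (z - w)) e' e'2.
rewrite {1}/phi wE subrr => /(_ erefl) h.
have h1 : nrm (phi 1) <= 2 * e'.
  apply: h => [s t hs ht|t ht].
    have -> : phi s - phi t = D (pt s) - D (pt t) by rewrite /phi opprB addrA subrK.
    apply: le_trans (hY _ _ (ptR s hs) (ptR t ht)) _.
    have -> : pt s - pt t = (s - t)%:C * (z - w) by rewrite /pt rmorphB /=; ring.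
    by rewrite nrmM nrmR mulrC (mulrC `|s - t|) mulrA.
  have tw : 1 < Re (pt t) by have := ptR t ht; lra.
  have w1 : 1 < Re (s0 + w) by rewrite ReD s01; lra.
  rewrite /phi cexpB -!hL //.
  have Lw0 : L (s0 + w) != 0 by apply: nL1; exact: ltW.
  rewrite (_ : L (pt t) / L (s0 + w) - 1 = (L (pt t) - L (s0 + w)) / L (s0 + w)); last by field.
  rewrite nrmM nrmV ler_pdivrMr ?nrm_gt0 //; apply: hd.
  - exact: ptrect.
  - by rewrite -wE; apply: ptrect; rewrite lexx ler01.
  - rewrite -wE (_ : pt t - pt 0 = t%:C * (z - w)); last by rewrite /pt; ring.
    rewrite nrmM nrmR ger0_norm; last by case/andP: ht.
    apply: le_lt_trans zw; rewrite ler_piMl ?nrm_ge0 //; by case/andP: ht.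
apply: le_trans (_ : nrm (phi 1) <= _); first by rewrite /phi zE.
by apply: le_trans h1 _; lra.
Qed.

Lemma quotient_strip_unif_cont : strip_unif_cont (fun z => D (s0 + z) - Rr (s0 + z)).
Proof.
move=> La e e0; have e2 : 0 < e / 2 by lra.
have [d1 d10 h1] := logL_strip_unif_cont La e2.
have [Y Y0 hY] := remL_lip halpha.
have q0 : 0 < e / 2 / (Y + 1) by rewrite divr_gt0 //; lra.
exists (Num.min d1 (e / 2 / (Y + 1))) => [|z w hz hw hz' hw'].
  by rewrite lt_min d10.
rewrite lt_min => /andP[zw1 zw2].
have k1 := h1 z w hz hw hz' hw' zw1.
have k2 : nrm (Rr (s0 + z) - Rr (s0 + w)) <= nrm (s0 + z - (s0 + w)) * Y.
  by apply: hY; rewrite ReD s01; lra.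
have k3 : nrm (s0 + z - (s0 + w)) * Y <= e / 2.
  rewrite (_ : s0 + z - (s0 + w) = z - w); last by ring.
  move: zw2; rewrite ltr_pdivlMr; last lra.
  have := nrm_ge0 (z - w); nra.
rewrite (_ : _ - _ = (D (s0 + z) - D (s0 + w)) - (Rr (s0 + z) - Rr (s0 + w))); last by ring.
by apply: le_trans (nrmB _ _) _; lra.
Qed.

(* [A], the boundary value of log L at s0, is obtained from the value at a nearby
   point s1 by subtracting the principal logarithm of L(s1) / L(s0). *)
Lemma boundary_value : exists A : C, cexp A = L s0 /\
  boundary_lipschitz (fun z => D (s0 + z) - Rr (s0 + z)) (A - Rr s0).
Proof.
have L0 : 0 < nrm (L s0) by rewrite nrm_gt0; exact: nL.
have e1 : 0 < 1 / 128 :> R by lra.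
have [d1 d10 h1] := logL_strip_unif_cont 1 e1.
(* 1/128 + 6/600 <= 1/32: the variation of D plus |ell zt| keeps D(s0 + z) - A in the disc where
   [cexp_sub1_lower] applies. *)
have e2 : 0 < 1 / 600 :> R by lra.
have [d2 d20 h2] := @rect_uniform L (Im s0) 1 _ dL nL1 e2.
have s01' : 1 <= Re s0 by rewrite s01.
have [K4 [d4 [K40 d40 h4]]] := derivable_local_lip (dL s01').
pose r := Num.min 1 (Num.min (d1 / 2) (d2 / 2)).
have r0 : 0 < r by rewrite !lt_min ltr01; apply/andP; split; lra.
have r1 : r <= 1 by rewrite ge_min lexx.
have rd1 : r <= d1 / 2 by rewrite !ge_min lexx !orbT.
have rd2 : r <= d2 / 2 by rewrite !ge_min lexx !orbT.
pose s1 := s0 + r%:C.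
have Res1 : Re s1 = 1 + r by rewrite /s1 ReD s01.
have Ims1 : Im s1 = Im s0 by rewrite /s1 ImD /= addr0.
have L1 : 0 < nrm (L s1) by rewrite nrm_gt0; apply: nL1; lra.
have L1' : L s1 != 0 by rewrite -nrm_gt0.
pose zt := 1 - L s0 / L s1.
have ztb : nrm zt <= 1 / 600.
  rewrite /zt (_ : 1 - _ = - ((L s0 - L s1) / L s1)); last by field.
  rewrite nrmN nrmM nrmV ler_pdivrMr //; apply: h2.
  - by split; rewrite ?s01 ?subrr ?normr0; lra.
  - by split; rewrite ?Res1 ?Ims1 ?subrr ?normr0; lra.
  - by rewrite (_ : s0 - s1 = - r%:C) ?nrmN ?nrmR ?gtr0_norm //; [lra|rewrite /s1; ring].
have zth : nrm zt <= 1 / 2 by lra.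
have ellb : nrm (ell zt) <= 6 / 600.
  have h0 : nrm (0 : C) <= 1 / 2 by rewrite nrm0; lra.
  by have := ell_lip zth h0; rewrite ell0 !subr0; lra.
pose A := D s1 - ell zt.
have eA : cexp A = L s0.
  rewrite /A cexpB cexp_ell // invrK -hL; last by lra.
  by rewrite /zt; field.
exists A; split => //.
have [Y Y0 hY] := remL_lip halpha.
(* Near s0 the local Lipschitz bound for L passes to its logarithm, the exponential being invertible
   in that small disc. *)
have near0 z : 0 < Re z <= 1 -> `|Im z| <= 1 -> nrm z < d1 / 2 -> nrm z < d4 ->
   nrm (D (s0 + z) - Rr (s0 + z) - (A - Rr s0)) <= (2 * K4 / nrm (L s0) + Y) * nrm z.
  move=> hz hz' zd1 zd4.
  have b1 : nrm (D (s0 + z) - A) <= 1 / 32.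
    have k1 : nrm (D (s0 + z) - D (s0 + r%:C)) <= 1 / 128.
      apply: h1; rewrite ?normr0 //=; try (clear - halpha hL dL nL s01 nL1 r0 r1; lra).
      by apply: le_lt_trans (nrmB _ _) _; rewrite nrmR gtr0_norm //; clear - halpha hL dL nL s01 nL1 zd1 rd1; lra.
    rewrite (_ : D (s0 + z) - A = (D (s0 + z) - D s1) + ell zt); last by rewrite /A; ring.
    by apply: le_trans (nrmD _ _) _; move: k1; rewrite -/s1; clear - halpha hL dL nL s01 nL1 ellb; lra.
  have b2 := cexp_sub1_lower b1.
  have b3 : nrm (cexp (D (s0 + z) - A) - 1) <= K4 / nrm (L s0) * nrm z.
    rewrite cexpB eA -hL; last by rewrite ReD s01; clear - halpha hL dL nL s01 nL1 hz; lra.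
    rewrite (_ : _ - 1 = (L (s0 + z) - L s0) / L s0); last by field; exact: nL.
    rewrite nrmM nrmV mulrAC ler_pM2r ?invr_gt0 //.
    have := h4 (s0 + z); rewrite addrAC subrr add0r; exact.
  have b4 : nrm (Rr (s0 + z) - Rr s0) <= nrm z * Y.
    have := hY (s0 + z) s0; rewrite addrAC subrr add0r ReD s01; apply; clear - halpha hL dL nL s01 nL1 hz; lra.
  rewrite (_ : _ - (A - Rr s0) = (D (s0 + z) - A) - (Rr (s0 + z) - Rr s0)); last by ring.
  apply: le_trans (nrmB _ _) _.
  rewrite mulrDl (_ : 2 * K4 / nrm (L s0) * nrm z = 2 * (K4 / nrm (L s0) * nrm z)); last by ring.
  clear - halpha hL dL nL s01 nL1 b2 b3 b4; lra.
(* Away from 0 boundedness suffices: for |z| >= dm a bound B2 is at most (B2 / dm) |z|. *)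
move=> La; pose La' := `|La| + 1.
have La0 : 0 <= La' by rewrite addr_ge0.
have LaLa : La <= La' by rewrite /La'; have := ler_norm La; clear - halpha hL dL nL s01 nL1; lra.
have [Bd Bd0 hB] := strip_bounded quotient_strip_unif_cont La0.
pose dm := Num.min 1 (Num.min (d1 / 2) d4).
have dm0 : 0 < dm by rewrite !lt_min ltr01 d40 andbT; clear - halpha hL dL nL s01 nL1 d10; lra.
set K1 := 2 * K4 / nrm (L s0) + Y in near0.
have K10 : 0 <= K1 by rewrite addr_ge0 // divr_ge0 ?nrm_ge0 // mulr_ge0.
pose B2 := Bd + nrm (D (s0 + r%:C) - Rr (s0 + r%:C) - (A - Rr s0)).
have B20 : 0 <= B2 by rewrite addr_ge0 ?nrm_ge0.
exists (K1 + B2 / dm) => z hz hz'.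
have [zd|zd] := ltP (nrm z) dm.
  move: zd; rewrite !lt_min => /and3P[zd1 zd2 zd3].
  have hz1 : `|Im z| <= 1 by apply: le_trans (Im_le_nrm z) _; exact: ltW.
  apply: le_trans (near0 z hz hz1 zd2 zd3) _.
  by rewrite ler_wpM2r ?nrm_ge0 // lerDl divr_ge0 // ltW.
have k : nrm (D (s0 + z) - Rr (s0 + z) - (D (s0 + r%:C) - Rr (s0 + r%:C))) <= Bd.
  apply: hB; rewrite ?normr0 //=; first by clear - halpha hL dL nL s01 nL1 r0 r1; lra.
  exact: le_trans LaLa.
apply: le_trans (_ : B2 <= _).
  by apply: le_trans (nrm_tri (D (s0 + r%:C) - Rr (s0 + r%:C)) _ _) _; rewrite lerD2r.
apply: le_trans (_ : B2 / dm * nrm z <= _).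
  by rewrite mulrAC ler_pdivlMr // ler_wpM2l.
by rewrite ler_wpM2r ?nrm_ge0 // lerDr.
Qed.

End Continuation.

(** * Convergence of the Euler product on Re s = 1 *)

Theorem theoremA1 (R : realType) (K : fieldExtType rat) (d : nat)
    (hd : (1 <= d)%N)
    (alpha : nonzero_prime K -> 'I_d -> R[i])
    (halpha : forall p j, `|alpha p j| <= 1)
    (L : R[i] -> R[i])
    (hL : forall s : R[i], 1 < complex.Re s -> L s = euler_product alpha s)
    (hLan : analytic_on [set s : R[i] | 1 <= complex.Re s] L)
    (hLnz : forall s : R[i], complex.Re s = 1 -> L s != 0) :
  forall s : R[i], complex.Re s = 1 ->
    partial_euler_product alpha s x @[x --> +oo] --> (L s : R[i]^o).
Proof.
move=> s0 s01.
have dL s : 1 <= complex.Re s -> derivable (L : R[i]^o -> R[i]^o) s 1.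
  by have [U [_ AU] hU] := hLan; move=> hs; apply: hU; exact: AU.
have hL' s : 1 < complex.Re s -> L s = cexp (logL alpha s).
  by move=> hs; rewrite hL // euler_product_cexp.
have s01' : 1 <= complex.Re s0 by rewrite s01.
have [A [eA hLip]] := boundary_value halpha hL' dL hLnz s01.
have hUC := quotient_strip_unif_cont halpha hL' dL hLnz s01.
(* Recentring at s0: the series in z has coefficients of size O(1 / k), and its value at z = 0 is
   the linear part of the logarithm at s0. *)
pose c k := lin_coef alpha k * natcpow k (- s0).
have c0 : c 0%N = 0 by rewrite /c lin_coef0 mul0r.
have cM k : (0 < k)%N -> nrm (c k) <= coefB R K d / k%:R.
  move=> k0; rewrite /c nrmM nrm_natcpow s01 psum1 //.
  by apply: ler_pM; rewrite ?nrm_ge0 ?invr_ge0 // lin_coef_bound.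
have cE k z : c k * natcpow k (- z) = log_term alpha k (s0 + z) - rem_term alpha k (s0 + z).
  by rewrite log_termE addrK /c -mulrA -natcpowD opprD.
have hF (sigma eta : R) : 0 < sigma -> 0 < eta -> exists N0 : nat, forall N, (N0 <= N)%N ->
    forall z : R[i], sigma <= complex.Re z ->
    nrm (\sum_(0 <= n < N) c n * natcpow n (- z) - (logL alpha (s0 + z) - remL alpha (s0 + z))) <= eta.
  move=> sg0 eta0; have e2 : 0 < eta / 2 by rewrite divr_gt0.
  have [N1 h1] := logL_tail halpha sg0 e2; have [N2 h2] := remL_tail halpha e2.
  exists (maxn N1 N2) => N; rewrite geq_max => /andP[NN1 NN2] z hz.
  have zR : complex.Re (s0 + z) = 1 + complex.Re z by rewrite ReD s01.
  have k1 : nrm (logL alpha (s0 + z) - \sum_(0 <= k < N) log_term alpha k (s0 + z)) <= eta / 2.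
    by apply: h1 => //; rewrite zR lerD2l.
  have k2 : nrm (remL alpha (s0 + z) - \sum_(0 <= k < N) rem_term alpha k (s0 + z)) <= eta / 2.
    by apply: h2 => //; rewrite zR lerDl; apply: le_trans hz; exact: ltW.
  under eq_bigr do rewrite cE.
  rewrite sumrB (_ : _ - _ = (remL alpha (s0 + z) - \sum_(0 <= k < N) rem_term alpha k (s0 + z)) -
     (logL alpha (s0 + z) - \sum_(0 <= k < N) log_term alpha k (s0 + z))); last by ring.
  by apply: le_trans (nrmB _ _) _; lra.
have taub := tauberian c0 cM hUC hLip hF.
apply: cvg_nrm => e e0; rewrite -eA.
set E := expR (complex.Re A); have E0 : 0 < E := expR_gt0 _.
(* An error eta <= 1 in the logarithm costs at most 17 eta E in the product, by
   [cexp_sub1_upper]. *)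
pose eta := Num.min 1 (e / (17 * E)).
have eta0 : 0 < eta by rewrite lt_min ltr01 divr_gt0 // mulr_gt0.
have eta2 : 0 < eta / 2 by rewrite divr_gt0.
have [m0 hm] := taub _ eta2; have [N2 h2] := remL_tail halpha eta2.
near=> x.
have x0 : 0 <= x by near: x; exact: nbhs_pinfty_ge.
have xm : (m0 <= Num.truncn x)%N by rewrite truncn_ge_nat //; near: x; exact: nbhs_pinfty_ge.
have xN : (N2 <= (Num.truncn x).+1)%N.
  by apply: ltnW; rewrite ltnS truncn_ge_nat //; near: x; exact: nbhs_pinfty_ge.
rewrite partial_euler_product_cexp //.
set N := Num.truncn x in xm xN *; set S := \sum_(0 <= k < N.+1) _.
have SE : S = \sum_(0 <= k < N.+1) c k + \sum_(0 <= k < N.+1) rem_term alpha k s0.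
  by rewrite /S -big_split; apply: eq_bigr => k _; rewrite log_termE.
have dist : nrm (S - A) <= eta.
  have k1 := hm N xm; have k2 := h2 _ xN s0 s01'.
  rewrite SE (_ : _ - A = (\sum_(0 <= k < N.+1) c k - (A - remL alpha s0)) -
    (remL alpha s0 - \sum_(0 <= k < N.+1) rem_term alpha k s0)); last by ring.
  by apply: le_trans (nrmB _ _) _; lra.
have -> : cexp S - cexp A = cexp A * (cexp (S - A) - 1).
  by rewrite mulrBr mulr1 -cexpD; congr (cexp _ - _); ring.
rewrite nrmM nrm_cexp -/E.
apply: le_trans (_ : E * (17 * eta) <= _).
  rewrite ler_pM2l //; apply: le_trans (cexp_sub1_upper _) _.
    by apply: le_trans dist _; rewrite ge_min lexx.
  by rewrite ler_pM2l.
rewrite (_ : E * (17 * eta) = eta * (17 * E)); last by ring.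
by rewrite -ler_pdivlMr ?mulr_gt0 // ge_min lexx orbT.
Unshelve. all: by end_near. Qed.
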